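(* Let $L\ge 0$ be an integer and $\psi\in\mathbb{R}^{L+1}$. Let $\{Y_n\}$ be a causal stationary autoregressive process of order $L$ with filter $\psi$, i.e. $Y_n=\underline{Y}_n^{\mathrm{T}}\psi+\varepsilon_n$, where $\underline{Y}_n=[1,Y_{n-1},\ldots,Y_{n-L}]^{\mathrm{T}}$ (and $\underline{Y}_n=1$ if $L=0$), and the noises $\varepsilon_n$ are i.i.d. with mean $0$ and finite variance $\sigma^2>0$. For each $N$ let $N_1=N_1(N)$ and $N_2=N-N_1$ with $N_1,N_2\to\infty$ as $N\to\infty$. Let $\hat\psi_1\in\mathbb{R}^{L+1}$ and $\hat\psi_2\in\mathbb{R}^{L+1}$ be the least squares estimates of the filter computed from $\{Y_1,\ldots,Y_{N_1}\}$ and from $\{Y_{N_1+1},\ldots,Y_N\}$, respectively. Assume (A.1) $E[\max\{\log|\varepsilon_n|,0\}]<\infty$ and the distribution of $\varepsilon_n$ has a nontrivial absolutely continuous component. Then $\sqrt{N_1}(\hat\psi_1-\psi)$ and $\sqrt{N_2}(\hat\psi_2-\psi)$ converge (jointly, in distribution) to two Gaussian random vectors that are independent.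
   Context: Least squares estimation of the filter from a stretch $Y_a,\ldots,Y_b$ means minimizing $\sum_n (Y_n-\underline{Y}_n^{\mathrm T}\psi)^2$ over $\psi\in\mathbb{R}^{L+1}$, the sum running over those $n$ in the stretch for which the regressors $Y_{n-1},\ldots,Y_{n-L}$ also lie in the stretch. *)

(* Defs.v *)
From HB Require Import structures.
From mathcomp Require Import all_boot all_order all_algebra.
From mathcomp Require Import all_classical all_reals all_analysis.
From mathcomp Require Import complex.
Set Implicit Arguments. Unset Strict Implicit. Unset Printing Implicit Defensive.
Import Order.TTheory GRing.Theory Num.Theory numFieldTopology.Exports.
Local Open Scope classical_set_scope.
Local Open Scope ring_scope.

(* Filters are row vectors psi = [psi_0, psi_1, ..., psi_L] in R^(L+1);
   psi_0 is the intercept. *)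

Definition regressor (R : realType) (L : nat) (y : int -> R) (n : int)
  : 'rV[R]_L.+1 :=
  \row_(i < L.+1) (if (i : nat) == 0%N then 1 else y (n - (i : nat)%:Z)).

Arguments regressor {R} L y n.

Definition dotrv (R : realType) (k : nat) (u v : 'rV[R]_k) : R :=
  \sum_(i < k) u ord0 i * v ord0 i.

Definition causal_filter (R : realType) (L : nat) (psi : 'rV[R]_L.+1) : Prop :=
  forall z : R[i], `|z| <= 1 ->
    1 - \sum_(k < L) ((psi ord0 (lift ord0 k))%:C)%C * z ^+ k.+1 != 0.

Definition strictly_stationary d (Omega : measurableType d) (R : realType)
  (P : probability Omega R) (Y : int -> Omega -> R) : Prop :=
  forall (k : nat) (t : 'I_k -> int) (B : 'I_k -> set R) (h : int),
    (forall i, measurable (B i)) ->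
    P [set w | forall i, B i (Y (t i + h) w)] =
    P [set w | forall i, B i (Y (t i) w)].

Definition iid d (Omega : measurableType d) (R : realType)
  (P : probability Omega R) (e : int -> Omega -> R) : Prop :=
  (forall n, measurable_fun setT (e n)) /\
  (forall n (A : set R), measurable A ->
     P (e n @^-1` A) = P (e 0 @^-1` A)) /\
  (forall (k : nat) (t : 'I_k -> int) (B : 'I_k -> set R),
     injective t -> (forall i, measurable (B i)) ->
     P [set w | forall i, B i (e (t i) w)] =
     (\prod_(i < k) P (e (t i) @^-1` B i))%E).

(* The law of a real random variable has a nontrivial absolutely continuous
   component (Lebesgue decomposition mu = g dx + mu_s with mu_s concentrated
   on a Lebesgue-null set S, and g dx nonzero). *)
Definition has_nontrivial_ac_component d (Omega : measurableType d)
  (R : realType) (P : probability Omega R) (X : Omega -> R) : Prop :=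
  exists g : R -> R,
    measurable_fun setT g /\ (forall x, 0 <= g x) /\
    (0 < \int[@lebesgue_measure R]_x (g x)%:E)%E /\
    exists S : set R, measurable S /\ @lebesgue_measure R S = 0%E /\
      forall A : set R, measurable A ->
        P (X @^-1` A) =
        (\int[@lebesgue_measure R]_(x in A) (g x)%:E + P (X @^-1` (A `&` S)))%E.

Definition normal_law (R : realType) (m v : R) (mu : set R -> \bar R) : Prop :=
  forall A : set R, measurable A ->
    mu A = if v == 0 then (\1_A m)%:E else normal_prob m (Num.sqrt v) A.

Definition gaussian_vector d (Omega : measurableType d) (R : realType)
  (Q : probability Omega R) (k : nat) (G : Omega -> 'rV[R]_k) : Prop :=
  (forall i, measurable_fun setT (fun w => G w ord0 i)) /\
  forall u : 'rV[R]_k, exists m v : R, 0 <= v /\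
    normal_law m v (fun A => Q ((fun w => dotrv u (G w)) @^-1` A)).

(* Independence of two random vectors (product rule on boxes, which form a
   generating pi-system of the Borel sets). *)
Definition indep_vectors d (Omega : measurableType d) (R : realType)
  (Q : probability Omega R) (k : nat) (G1 G2 : Omega -> 'rV[R]_k) : Prop :=
  forall A B : 'I_k -> set R,
    (forall i, measurable (A i)) -> (forall i, measurable (B i)) ->
    Q [set w | (forall i, A i (G1 w ord0 i)) /\ (forall i, B i (G2 w ord0 i))] =
    (Q [set w | forall i, A i (G1 w ord0 i)] *
     Q [set w | forall i, B i (G2 w ord0 i)])%E.

Definition cvg_dist_indep_gaussian d (Omega : measurableType d)
  (R : realType) (P : probability Omega R) (k : nat)
  (X1 X2 : nat -> Omega -> 'rV[R]_k) : Prop :=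
  exists (d' : measure_display) (Omega' : measurableType d')
         (Q : probability Omega' R) (G1 G2 : Omega' -> 'rV[R]_k),
    gaussian_vector Q G1 /\ gaussian_vector Q G2 /\ indep_vectors Q G1 G2 /\
    forall f : ('rV[R]_k * 'rV[R]_k)%type -> R,
      continuous f -> (exists M : R, forall z, `|f z| <= M) ->
      (fun N => \int[P]_w (f (X1 N w, X2 N w))%:E)%E @ \oo -->
      (\int[Q]_w (f (G1 w, G2 w))%:E)%E.

(* Least-squares objective on the stretch Y_a, ..., Y_b (a >= 1): sum over
   those n in the stretch whose regressors Y_{n-1}, ..., Y_{n-L} also lie in
   the stretch, i.e. a + L <= n <= b. *)
Definition ls_objective (R : realType) (L : nat) (y : int -> R) (a b : nat)
  (phi : 'rV[R]_L.+1) : R :=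
  \sum_(a + L <= n < b.+1) (y n%:Z - dotrv (regressor L y n%:Z) phi) ^+ 2.

Arguments ls_objective {R} L y a b phi.

Definition is_ls_estimate (R : realType) (L : nat) (y : int -> R) (a b : nat)
  (phi : 'rV[R]_L.+1) : Prop :=
  forall phi' : 'rV[R]_L.+1, ls_objective L y a b phi <= ls_objective L y a b phi'.

Arguments is_ls_estimate {R} L y a b phi.

(* Main.v *)
(* The normal equations read sqrt K (psihat - psi) S = W, where S is the average
   of the matrices Ybar_n Ybar_n^T over the stretch and W the normalized sum of
   the vectors eps_n Ybar_n, a martingale. Causality makes the impulse response
   absolutely summable, so that Ybar_n is, uniformly in n, a small perturbation
   of a finite moving average of the noise; hence S tends in probability to a
   positive definite matrix Gamma, uniformly in the position of the stretch.
   The increments of the sums W of the two disjoint stretches are increments of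
   a single martingale whose conditional variance becomes deterministic, and
   so E cos (u W1 + v W2 + c) tends to
   exp (- sigma^2 (u Gamma u^T + v Gamma v^T) / 2) cos c; the absence of a cross
   term gives the independence of the limits. Tightness and approximation of
   continuous functions on boxes by trigonometric polynomials turn this into
   convergence in distribution. *)
Require Import Defs.
From HB Require Import structures.
From mathcomp Require Import all_boot all_order all_algebra.
From mathcomp Require Import all_classical all_reals all_analysis.
From mathcomp Require Import measurable_realfun complex ring lra zify.
Import Order.TTheory GRing.Theory Num.Theory numFieldTopology.Exports.
Local Open Scope classical_set_scope.
Local Open Scope ring_scope.

Set Implicit Arguments.
Unset Strict Implicit.
Unset Printing Implicit Defensive.

(** * Expectation *)

(** [Y] is given only as a stationary solution of the recursion: neither moments of [Y] nor its
    measurability with respect to the past noise is assumed, so the martingale argument cannot start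
    from [Y] itself. Second moments are computed only for finite moving averages, which are square
    integrable functions of the past. The regressors are reached by letting the order M of the
    moving average tend to infinity while the length K and the position t of the stretch stay fixed.
    That error vanishes in probability, without a rate uniform in K and t; this is harmless because
    all other bounds are uniform in M. The truncated distance [d0] makes such limits a matter of
    inequalities.

    The noise itself has only two moments, hence the truncation of eps^2 in the law of large numbers
    and the remainders x^2 min (1, |x|) in the central limit theorem.

    Everything stays real: the values of E cos (X + c) for all phases c contain E cos X and E sin X,
    that is, the characteristic function. *)

Section Expectation.
Context d (T : measurableType d) (R : realType) (P : probability T R).
Implicit Types X Y : T -> R.

Definition L1 X := P.-integrable setT (EFin \o X).
(** A real number, equal to 0 when the integral is infinite; this is why most of the rules below
    carry [L1] hypotheses. *)
Definition EE X := \int[P]_w X w.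

Lemma L1_meas X : L1 X -> measurable_fun setT X.
Proof. by move=> /measurable_int /measurable_EFinP. Qed.

Lemma L1_le X Y : measurable_fun setT X -> L1 Y -> (forall w, `|X w| <= Y w) ->
  L1 X.
Proof.
move=> mX iY XY; apply: (le_integrable _ _ _ iY) => //.
  exact/measurable_EFinP.
by move=> w _ /=; rewrite lee_fin (le_trans (XY w))// ler_norm.
Qed.

Lemma L1_cst c : L1 (fun=> c).
Proof. exact: (finite_measure_integrable_cst P c). Qed.

Lemma L1_bounded X B : measurable_fun setT X -> (forall w, `|X w| <= B) -> L1 X.
Proof. by move=> mX XB; apply: (L1_le mX (L1_cst B)). Qed.

Lemma L1D X Y : L1 X -> L1 Y -> L1 (fun w => X w + Y w).
Proof. by move=> iX iY; exact: (integrableD measurableT iX iY). Qed.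

Lemma L1_ext X Y : X =1 Y -> L1 X -> L1 Y.
Proof. by move=> /funext ->. Qed.

Lemma L1Z c X : L1 X -> L1 (fun w => c * X w).
Proof. by move=> iX; exact: (integrableZl measurableT c iX). Qed.

Lemma L1B X Y : L1 X -> L1 Y -> L1 (fun w => X w - Y w).
Proof. by move=> iX iY; exact: (integrableB measurableT iX iY). Qed.

Lemma L1_norm X : L1 X -> L1 (fun w => `|X w|).
Proof. by move=> iX; exact: (integrable_norm iX). Qed.

Lemma L1_sum (I : Type) (s : seq I) (Q : pred I) (F : I -> T -> R) :
  (forall i, Q i -> L1 (F i)) -> L1 (fun w => \sum_(i <- s | Q i) F i w).
Proof.
move=> iF; elim: s => [|i s IH].
  by apply: L1_ext (L1_cst 0) => w; rewrite big_nil.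
case Qi : (Q i); last by apply: L1_ext IH => w; rewrite big_cons Qi.
by apply: L1_ext (L1D (iF _ Qi) IH) => w; rewrite big_cons Qi.
Qed.

Lemma EE_ext X Y : X =1 Y -> EE X = EE Y.
Proof. by move=> XY; apply: eq_Rintegral => w _; exact: XY. Qed.

Lemma EED X Y : L1 X -> L1 Y -> EE (fun w => X w + Y w) = EE X + EE Y.
Proof. by move=> iX iY; exact: RintegralD. Qed.

Lemma EEB X Y : L1 X -> L1 Y -> EE (fun w => X w - Y w) = EE X - EE Y.
Proof. by move=> iX iY; exact: RintegralB. Qed.

Lemma EEZ c X : L1 X -> EE (fun w => c * X w) = c * EE X.
Proof. by move=> iX; exact: RintegralZl. Qed.

Lemma EE_cst c : EE (fun=> c) = c.
Proof.
rewrite /EE Rintegral_cst//.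
by have := probability_setT P => /= ->; rewrite mulr1.
Qed.

Lemma EE_sum (I : Type) (s : seq I) (Q : pred I) (F : I -> T -> R) :
  (forall i, Q i -> L1 (F i)) ->
  EE (fun w => \sum_(i <- s | Q i) F i w) = \sum_(i <- s | Q i) EE (F i).
Proof.
move=> iF; elim: s => [|i s IH].
  by rewrite big_nil -[RHS]EE_cst; apply: EE_ext => w; rewrite big_nil.
rewrite big_cons; case Qi : (Q i); last first.
  by rewrite -IH; apply: EE_ext => w; rewrite big_cons Qi.
rewrite -IH -EED; [|exact: iF|exact: L1_sum].
by apply: EE_ext => w; rewrite big_cons Qi.
Qed.

Lemma EE_le X Y : L1 X -> L1 Y -> (forall w, X w <= Y w) -> EE X <= EE Y.
Proof. by move=> iX iY XY; apply: le_Rintegral. Qed.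

Lemma EE_ge0 X : (forall w, 0 <= X w) -> 0 <= EE X.
Proof. by move=> X0; apply: Rintegral_ge0. Qed.

Lemma EE_abs X : L1 X -> `|EE X| <= EE (fun w => `|X w|).
Proof. by move=> iX; exact: le_normr_Rintegral. Qed.

Lemma EE_fin X : L1 X -> (\int[P]_w (X w)%:E)%E = (EE X)%:E.
Proof. by move=> iX; rewrite /EE /Rintegral fineK// integrable_fin_num. Qed.

Lemma EE_dct (F : nat -> T -> R) X Y : (forall n, measurable_fun setT (F n)) ->
  measurable_fun setT X -> L1 Y -> (forall n w, `|F n w| <= Y w) ->
  (forall w, F n w @[n --> \oo] --> X w) -> EE (F n) @[n --> \oo] --> EE X.
Proof.
move=> mF mX iY FY FX; rewrite /EE /Rintegral.
have iF n : L1 (F n) by apply: L1_le iY _.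
have iX : L1 X.
  apply: L1_le iY _ => // w.
  have /cvg_norm cn := FX w.
  rewrite -(cvg_lim (@Rhausdorff R) cn); apply: limr_le; first exact/cvgP/cn.
  by apply: nearW => n.
apply: fine_cvg; rewrite fineK ?integrable_fin_num//.
have cF w : (F n w)%:E @[n --> \oo] --> (X w)%:E.
  by apply: cvg_EFin; [exact: nearW|exact: FX].
have [_ _] := @dominated_convergence _ T R P setT measurableT
  (fun n w => (F n w)%:E) (fun w => (X w)%:E) (fun w => (Y w)%:E)
  (fun n => proj2 (measurable_EFinP _ _) (mF n))
  (proj2 (measurable_EFinP _ _) mX)
  (aeW _ (fun w _ => cF w)) iY (aeW _ (fun w n _ => FY n w)).
exact.
Qed.

Definition L2 X := measurable_fun setT X /\ L1 (fun w => X w ^+ 2).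

Lemma L2_ext X Y : X =1 Y -> L2 X -> L2 Y.
Proof. by move=> /funext ->. Qed.

Lemma L2_meas X : L2 X -> measurable_fun setT X. Proof. by case. Qed.

Lemma L2_mul X Y : L2 X -> L2 Y -> L1 (fun w => X w * Y w).
Proof.
move=> [mX iX] [mY iY]; apply: L1_le (L1D iX iY) _.
  exact: measurable_funM.
move=> w /=; rewrite ler_norml; apply/andP; split.
  by have := sqr_ge0 (X w + Y w); have := sqr_ge0 (X w); have := sqr_ge0 (Y w);
     lra.
by have := sqr_ge0 (X w - Y w); have := sqr_ge0 (X w); have := sqr_ge0 (Y w);
   lra.
Qed.

Lemma L2_cst c : L2 (fun=> c).
Proof. by split; [exact: measurable_cst|exact: L1_cst]. Qed.

Lemma L2D X Y : L2 X -> L2 Y -> L2 (fun w => X w + Y w).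
Proof.
move=> L2X L2Y; split.
  exact: measurable_funD (L2_meas L2X) (L2_meas L2Y).
have := L1D (L1D L2X.2 L2Y.2) (L1Z 2 (L2_mul L2X L2Y)).
by apply: L1_ext => w; ring.
Qed.

Lemma L2Z c X : L2 X -> L2 (fun w => c * X w).
Proof.
move=> [mX iX]; split; first exact: measurable_funM.
by have := L1Z (c ^+ 2) iX; apply: L1_ext => w; ring.
Qed.

Lemma L2B X Y : L2 X -> L2 Y -> L2 (fun w => X w - Y w).
Proof.
move=> hX hY; have := L2D hX (L2Z (-1) hY).
by apply: L2_ext => w; rewrite mulN1r.
Qed.

Lemma L2_sum (I : Type) (s : seq I) (F : I -> T -> R) :
  (forall i, L2 (F i)) -> L2 (fun w => \sum_(i <- s) F i w).
Proof.
move=> iF; elim: s => [|i s IH].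
  by apply: L2_ext (L2_cst 0) => w; rewrite big_nil.
by apply: L2_ext (L2D (iF i) IH) => w; rewrite big_cons.
Qed.

Lemma L2_L1 X : L2 X -> L1 X.
Proof.
move=> hX; have := L2_mul hX (L2_cst 1).
by apply: L1_ext => w; rewrite mulr1.
Qed.

(** Replaces the Cauchy-Schwarz bound without square roots: the integrands on the two sides differ
    by (|x| - t)^2 / (2 t). The free parameter t is usually taken of the order of the admissible
    error. *)
Lemma EE_norm_le X t : 0 < t -> L2 X ->
  EE (fun w => `|X w|) <= t / 2 + EE (fun w => X w ^+ 2) / (2 * t).
Proof.
move=> t0 hX; rewrite [X in _ + X]mulrC -EEZ; last exact: hX.2.
rewrite -[X in X + _](EE_cst) -EED; [|exact: L1_cst|exact: L1Z hX.2].
apply: EE_le; [exact/L1_norm/L2_L1|apply: L1D; [exact: L1_cst|exact: L1Z hX.2]|].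
move=> w; rewrite -real_normK ?num_real//.
have -> : t / 2 + (2 * t)^-1 * `|X w| ^+ 2 =
  `|X w| + (`|X w| - t) ^+ 2 / (2 * t) by field; lra.
by rewrite lerDl mulr_ge0 ?sqr_ge0// invr_ge0; lra.
Qed.

End Expectation.

(** * Independence and the past of the noise *)

Section Independence.
Context d d1 d2 (T : measurableType d) (T1 : measurableType d1)
  (T2 : measurableType d2) (R : realType) (P : probability T R).
Variables (X : T -> T1) (Y : T -> T2).
Hypotheses (mX : measurable_fun setT X) (mY : measurable_fun setT Y).
Hypothesis XY : forall A B, measurable A -> measurable B ->
  P (X @^-1` A `&` Y @^-1` B) = (P (X @^-1` A) * P (Y @^-1` B))%E.

Let lX : {mfun T >-> T1} := HB.pack X (isMeasurableFun.Build _ _ _ _ _ mX).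
Let lY : {mfun T >-> T2} := HB.pack Y (isMeasurableFun.Build _ _ _ _ _ mY).
Let mZ : measurable_fun setT (fun w => (X w, Y w)).
Proof. exact: measurable_fun_pair. Qed.
Let lZ : {mfun T >-> (T1 * T2)%type} :=
  HB.pack (fun w => (X w, Y w)) (isMeasurableFun.Build _ _ _ _ _ mZ).

Lemma joint_law_prod C : measurable C ->
  (distribution P lX \x distribution P lY)%E C = distribution P lZ C.
Proof.
move=> mC; apply: (@product_measure_unique _ _ _ _ _ (distribution P lX) (distribution P lY)
  (distribution P lZ)) => //.
Qed.

(** Tonelli on the product of the two laws. [X] may take values in any measurable space because the
    main use takes for it the identity of [Omega], seen as a map onto [Omega] with the smaller
    sigma-algebra of the past. *)
Lemma L1_indep_mul (f : T1 -> R) (g : T2 -> R) :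
  measurable_fun setT f -> measurable_fun setT g ->
  L1 P (f \o X) -> L1 P (g \o Y) -> L1 P (fun w => f (X w) * g (Y w)).
Proof.
move=> mf mg iX iY.
have mfX : measurable_fun setT (f \o X) by exact: measurableT_comp.
have mgY : measurable_fun setT (g \o Y) by exact: measurableT_comp.
apply/integrableP; split.
  by apply/measurable_EFinP; exact: measurable_funM.
have mh : measurable_fun setT (fun z : T1 * T2 => (`|f z.1 * g z.2|)%:E).
  apply/measurable_EFinP/measurableT_comp => //; apply: measurable_funM.
    exact: measurableT_comp.
  exact: measurableT_comp.
have := @ge0_integral_distribution _ _ _ _ _ P lZ _ mh (fun=> normr_ge0 _).
rewrite /comp /= => <-.
rewrite (eq_measure_integral (distribution P lX \x distribution P lY)%E);
  last by move=> A mA _; exact/esym/joint_law_prod.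
rewrite (fubini_tonelli1 _ mh) /=; last by move=> z; rewrite lee_fin.
have FE x : (\int[distribution P lY]_y (`|f x * g y|)%:E =
    `|f x|%:E * \int[P]_w (`|g (Y w)|)%:E)%E.
  under eq_integral => y _ do rewrite normrM EFinM.
  rewrite ge0_integralZl//; last by apply/measurable_EFinP/measurableT_comp.
  by rewrite (@ge0_integral_distribution _ _ _ _ _ P lY (fun y => `|g y|%:E))//;
    apply/measurable_EFinP/measurableT_comp.
rewrite /fubini_F /=; under eq_integral do rewrite FE.
have [_ fX] := integrableP _ _ _ iX; have [_ gY] := integrableP _ _ _ iY.
rewrite ge0_integralZr//; last 2 first.
- by apply/measurable_EFinP/measurableT_comp.
- exact: integral_ge0.
rewrite (@ge0_integral_distribution _ _ _ _ _ P lX (fun y => `|f y|%:E))//;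
  last by apply/measurable_EFinP/measurableT_comp.
rewrite lte_mul_pinfty//; [by apply: integral_ge0 => x _; rewrite lee_fin|].
by rewrite ge0_fin_numE//; apply: integral_ge0 => x _; rewrite lee_fin.
Qed.

Lemma EE_indep_mul (f : T1 -> R) (g : T2 -> R) :
  measurable_fun setT f -> measurable_fun setT g ->
  L1 P (f \o X) -> L1 P (g \o Y) ->
  EE P (fun w => f (X w) * g (Y w)) = EE P (f \o X) * EE P (g \o Y).
Proof.
move=> mf mg iX iY.
have iXY := L1_indep_mul mf mg iX iY.
have mh : measurable_fun setT (fun z : T1 * T2 => (f z.1 * g z.2)%:E).
  apply/measurable_EFinP; apply: measurable_funM; exact: measurableT_comp.
have ih : (distribution P lX \x distribution P lY)%E.-integrable setT
    (fun z : T1 * T2 => (f z.1 * g z.2)%:E).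
  apply/integrableP; split => //.
  rewrite (eq_measure_integral (distribution P lZ)); last first.
    by move=> A mA _; exact: joint_law_prod.
  rewrite (@ge0_integral_distribution _ _ _ _ _ P lZ
    (fun z : T1 * T2 => `|(f z.1 * g z.2)%:E|%E))//; last exact: measurableT_comp.
  by have /integrableP[] := iXY.
apply: EFin_inj; rewrite EFinM -!EE_fin//.
have := @integral_distribution _ _ _ _ _ P lZ _ mh iXY.
rewrite /comp /= => <-.
rewrite (eq_measure_integral (distribution P lX \x distribution P lY)%E);
  last by move=> A mA _; exact/esym/joint_law_prod.
rewrite -integral12_prod_meas1//=.
have FE x : (\int[distribution P lY]_y (f x * g y)%:E =
    (f x)%:E * (EE P (g \o Y))%:E)%E.
  under eq_integral => y _ do rewrite EFinM.
  rewrite integralZl//; last first.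
    apply/integrableP; split; first exact/measurable_EFinP.
    rewrite (@ge0_integral_distribution _ _ _ _ _ P lY (fun y => `|(g y)%:E|%E))//.
      by have /integrableP[] := iY.
    by apply: measurableT_comp => //; exact/measurable_EFinP.
  rewrite (@integral_distribution _ _ _ _ _ P lY (fun y => (g y)%:E))//;
    last exact/measurable_EFinP.
  by rewrite -(EE_fin iY).
rewrite /fubini_F /=; under eq_integral do rewrite FE.
rewrite integralZr//; last first.
  apply/integrableP; split; first exact/measurable_EFinP.
  rewrite (@ge0_integral_distribution _ _ _ _ _ P lX (fun y => `|(f y)%:E|%E))//.
    by have /integrableP[] := iX.
  by apply: measurableT_comp => //; exact/measurable_EFinP.
rewrite (@integral_distribution _ _ _ _ _ P lX (fun y => (f y)%:E))//;
  last exact/measurable_EFinP.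
by rewrite (EE_fin iY).
Qed.

End Independence.

Section SameLaw.
Context d d' (T : measurableType d) (T' : measurableType d') (R : realType).
Variables (P : probability T R) (P' : probability T' R).
Variables (X : T -> R) (X' : T' -> R).
Hypotheses (mX : measurable_fun setT X) (mX' : measurable_fun setT X').
Hypothesis law : forall A, measurable A -> P (X @^-1` A) = P' (X' @^-1` A).

(** The two variables may live on different spaces, so that the transfer also covers the marginals
    of a product probability. *)
Lemma L1_same_law (g : R -> R) : measurable_fun setT g ->
  L1 P (g \o X) -> L1 P' (g \o X').
Proof.
move=> mg /integrableP[_ ig]; apply/integrableP; split.
  by apply/measurable_EFinP; exact: measurableT_comp.
have mng : measurable_fun setT (fun y => `|(g y)%:E|%E).
  by apply: measurableT_comp => //; exact/measurable_EFinP.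
have := @ge0_integral_pushforward _ _ _ _ R _ mX' P' setT _ measurableT mng
  (fun y _ => abse_ge0 _).
rewrite preimage_setT /comp /= => <-.
move: ig.
have := @ge0_integral_pushforward _ _ _ _ R _ mX P setT _ measurableT mng
  (fun y _ => abse_ge0 _).
rewrite preimage_setT /comp /= => <-.
apply: le_lt_trans; rewrite le_eqVlt; apply/orP; left; apply/eqP.
apply: eq_measure_integral => A mA _; rewrite /= /pushforward.
exact/esym/law.
Qed.

Lemma EE_same_law (g : R -> R) : measurable_fun setT g ->
  L1 P (g \o X) -> EE P (g \o X) = EE P' (g \o X').
Proof.
move=> mg ig; have ig' := L1_same_law mg ig.
apply: EFin_inj; rewrite -!EE_fin//.
have mng : measurable_fun setT (fun y => (g y)%:E) by exact/measurable_EFinP.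
have := @integral_pushforward _ _ _ _ R _ mX' P' setT _ mng.
rewrite preimage_setT => /(_ ig' measurableT); rewrite /comp /= => <-.
have := @integral_pushforward _ _ _ _ R _ mX P setT _ mng.
rewrite preimage_setT => /(_ ig measurableT); rewrite /comp /= => <-.
apply: eq_measure_integral => A mA _; rewrite /= /pushforward.
exact: law.
Qed.

End SameLaw.

(** * The sigma-algebra of the past noise *)

Section Past.
Context d (Omega : measurableType d) (R : realType) (P : probability Omega R).
Variable eps : int -> Omega -> R.
Hypothesis eiid : iid P eps.

(** Blocks of consecutive times n-1, ..., n-k generate the past, and they are closed under
    intersection: the shorter block is padded with [setT]. *)
Definition window (n : int) (k : nat) (B : nat -> set R) : set Omega :=
  [set w | forall i, (i < k)%N -> B i (eps (n - 1 - i%:Z) w)].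

Definition past_cylinders (n : int) : set (set Omega) :=
  [set A | exists k B, (forall i, measurable (B i)) /\ A = window n k B].

(** Measurability out of [Omega] with the generated sigma-algebra, so that closure under sums,
    products and composition is inherited from [measurable_fun]. *)
Definition past_measurable (n : int) (X : Omega -> R) :=
  @measurable_fun _ _ (g_sigma_algebraType (past_cylinders n)) R setT X.

Lemma eps_meas n : measurable_fun setT (eps n).
Proof. by case: eiid. Qed.

Lemma window_measurable n k B : (forall i, measurable (B i)) ->
  measurable (window n k B).
Proof.
move=> mB.
have -> : window n k B =
    \bigcap_(i in [set i | (i < k)%N]) (eps (n - 1 - i%:Z) @^-1` B i).
  by apply/seteqP; split => w /= h i; exact: h.
apply: bigcap_measurableType => i _; rewrite -[X in measurable X]setTI; exact: eps_meas.
Qed.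

Lemma past_cylinders_measurable n : past_cylinders n `<=` measurable.
Proof. by move=> _ [k [B [mB ->]]]; exact: window_measurable. Qed.

Lemma past_sigma_measurable n :
  <<s past_cylinders n >> `<=` (measurable : set (set Omega)).
Proof.
exact: (smallest_sub (@sigma_algebra_measurable _ Omega)
  (@past_cylinders_measurable n)).
Qed.

Lemma past_measurableW n X : past_measurable n X -> measurable_fun setT X.
Proof.
move=> mX mT B mB; apply: past_sigma_measurable; exact: (mX measurableT B mB).
Qed.

Lemma past_eps (n m : int) : m < n -> past_measurable n (eps m).
Proof.
move=> mn _ B mB; rewrite setTI; apply: sub_sigma_algebra.
have [j jE] : exists j : nat, m = n - 1 - j%:Z.
  by exists (absz (n - 1 - m)%R); lia.
exists j.+1, (fun i => if i == j then B else setT); split.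
  by move=> i; case: ifP.
apply/seteqP; split => w /=; rewrite /window /= jE.
  by move=> Bw i _; case: eqP => // ->.
by move=> /(_ j (ltnSn j)); rewrite eqxx.
Qed.

Lemma past_mono (n m : int) X : n <= m -> past_measurable n X -> past_measurable m X.
Proof.
move=> nm mX _ B mB; have := mX measurableT B mB; apply: sub_sigma_algebra2.
move=> _ [k [C [mC ->]]].
have [j jE] : exists j : nat, m = n + j%:Z by exists (absz (m - n)%R); lia.
exists (k + j)%N, (fun i => if (i < j)%N then setT else C (i - j)%N); split.
  by move=> i; case: ifP.
apply/seteqP; split => w /=; rewrite /window /= => h i ik.
  case: ltnP => // ji; have := h (i - j)%N.
  have -> : n - 1 - (i - j)%N%:Z = m - 1 - i%:Z by lia.
  by apply; lia.
have := h (i + j)%N; rewrite ltn_add2r => /(_ ik).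
rewrite ltnNge leq_addl /= addnK.
by have -> : m - 1 - (i + j)%N%:Z = n - 1 - i%:Z by lia.
Qed.

Lemma past_cylinders_setI n : setI_closed (past_cylinders n).
Proof.
move=> _ _ [k [B [mB ->]]] [l [C [mC ->]]].
exists (maxn k l), (fun i => (if (i < k)%N then B i else setT) `&`
                            (if (i < l)%N then C i else setT)); split.
  by move=> i; apply: measurableI; case: ifP.
apply/seteqP; split => w /=; rewrite /window /=.
  move=> [hB hC] i _; split; case: ifP => // ?; [exact: hB|exact: hC].
move=> h; split => i il.
  by have := h i (leq_trans il (leq_maxl _ _)); rewrite il => -[].
by have := h i (leq_trans il (leq_maxr _ _)); rewrite il => -[_].
Qed.

Lemma window_indep n k B C : (forall i, measurable (B i)) -> measurable C ->
  P (window n k B `&` eps n @^-1` C) = (P (window n k B) * P (eps n @^-1` C))%E.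
Proof.
move=> mB mC; have [_ [_ ei]] := eiid.
pose t (i : 'I_k.+1) : int := n - (i : nat)%:Z.
pose D (i : nat) := if i is i'.+1 then B i' else C.
have := ei k.+1 t (fun i => D i); rewrite big_ord_recl /= /t subr0 => h.
have -> : window n k B `&` eps n @^-1` C =
    [set w | forall i : 'I_k.+1, D i (eps (n - (i : nat)%:Z) w)].
  apply/seteqP; split => w /=; rewrite /window /=.
    move=> [hB hC] [[|i] ik] /=; first by rewrite subr0.
    by have := hB i ik; congr (B i (eps _ w)); lia.
  move=> hD; split; last by have := hD ord0; rewrite /= subr0.
  move=> i ik; have := hD (Ordinal (ik : (i.+1 < k.+1)%N)).
  by rewrite /=; congr (B i (eps _ w)); lia.
rewrite h; last 2 first.
- by move=> i j; rewrite /t => ?; apply: val_inj => /=; lia.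
- by case=> [[|i] ik] /=.
rewrite muleC; congr (_ * _)%E.
pose t' (i : 'I_k) : int := n - 1 - (i : nat)%:Z.
have := ei k t' (fun i => B i); rewrite /t' => h'.
have -> : window n k B =
    [set w | forall i : 'I_k, B i (eps (n - 1 - (i : nat)%:Z) w)].
  apply/seteqP; split => w /=; rewrite /window /=.
    by move=> hB i; exact: hB.
  by move=> hB i ik; have := hB (Ordinal ik).
rewrite h' //; last by move=> i j ?; apply: val_inj => /=; lia.
apply: eq_bigr => i _ /=.
by have -> : n - 1 - (i : nat)%:Z = n - (lift ord0 i : nat)%:Z;
  rewrite // /lift /= /bump /=; lia.
Qed.

(** Uniqueness of finite measures on the pi-system of windows, for the restriction of P to the event
    on eps_n and for P multiplied by the probability of that event. *)
Lemma past_indep n A C : <<s past_cylinders n >> A -> measurable C ->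
  P (A `&` eps n @^-1` C) = (P A * P (eps n @^-1` C))%E.
Proof.
move=> sA mC.
have mE : measurable (eps n @^-1` C).
  by rewrite -[X in measurable X]setTI; exact: eps_meas.
have PE0 : 0 <= fine (P (eps n @^-1` C)) by exact: fine_ge0.
pose m2 := mscale (NngNum PE0) P.
have fE : ((fine (P (eps n @^-1` C)))%:E = P (eps n @^-1` C))%E.
  by rewrite fineK// fin_num_measure.
suff : mrestr P mE A = m2 A by rewrite /mrestr /m2 /mscale/= fE muleC.
apply: (g_sigma_algebra_measure_unique_trace (past_cylinders n) setT) => //.
- by move=> B [cB _]; exact: (past_cylinders_measurable cB).
- move=> A1 A2 [c1 _] [c2 _]; split => //; exact: (past_cylinders_setI c1 c2).
- have := probability_setT P => /= PT.
  by rewrite /mrestr setTI /m2 /mscale/= fE PT mule1.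
- move=> B [[k [D [mD ->]]] _].
  by rewrite /= /mrestr /m2 /mscale/= fE muleC window_indep.
- rewrite /= /mrestr setTI; exact: (le_lt_trans (probability_le1 P mE) (ltry _)).
have -> : [set X | past_cylinders n X /\ X `<=` [set: Omega]] = past_cylinders n.
  by apply/seteqP; split => [B []|B cB].
exact: sA.
Qed.

Lemma eps_law n m (A : set R) : measurable A ->
  P (eps n @^-1` A) = P (eps m @^-1` A).
Proof. by have [_ [el _]] := eiid; move=> mA; rewrite (el n A mA) (el m A mA). Qed.

Lemma L1_eps_law (g : R -> R) n m : measurable_fun setT g ->
  L1 P (g \o eps n) -> L1 P (g \o eps m).
Proof. exact: L1_same_law (eps_meas n) (eps_meas m) (@eps_law n m) _. Qed.

Lemma EE_eps_law (g : R -> R) n m : measurable_fun setT g ->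
  L1 P (g \o eps n) -> EE P (g \o eps n) = EE P (g \o eps m).
Proof. exact: EE_same_law (eps_meas n) (eps_meas m) (@eps_law n m) _. Qed.

Lemma L1_past_mul n X (g : R -> R) : past_measurable n X ->
  measurable_fun setT g -> L1 P X -> L1 P (g \o eps n) ->
  L1 P (fun w => X w * g (eps n w)).
Proof.
move=> pX mg iX ig.
pose G := g_sigma_algebraType (past_cylinders n).
have mid : measurable_fun setT (id : Omega -> G).
  by move=> _ B mB; rewrite setTI; exact: (past_sigma_measurable mB).
apply: (@L1_indep_mul _ _ _ Omega G R R P (id : Omega -> G) (eps n) mid
  (@eps_meas n) _ X g) => //.
by move=> A B mA mB; exact: past_indep.
Qed.

Lemma EE_past_mul n X (g : R -> R) : past_measurable n X ->
  measurable_fun setT g -> L1 P X -> L1 P (g \o eps n) ->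
  EE P (fun w => X w * g (eps n w)) = EE P X * EE P (g \o eps n).
Proof.
move=> pX mg iX ig.
pose G := g_sigma_algebraType (past_cylinders n).
have mid : measurable_fun setT (id : Omega -> G).
  by move=> _ B mB; rewrite setTI; exact: (past_sigma_measurable mB).
apply: (@EE_indep_mul _ _ _ Omega G R R P (id : Omega -> G) (eps n) mid
  (@eps_meas n) _ X g) => //.
by move=> A B mA mB; exact: past_indep.
Qed.

End Past.

(** * Laws of large numbers *)

Section PastClosure.
Context d (Omega : measurableType d) (R : realType).
Variable eps : int -> Omega -> R.

Lemma past_cst n (c : R) : past_measurable eps n (fun=> c).
Proof. exact: measurable_cst. Qed.

Lemma past_comp n X (g : R -> R) : measurable_fun setT g ->
  past_measurable eps n X -> past_measurable eps n (fun w => g (X w)).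
Proof. by move=> mg mX; exact: (measurableT_comp mg mX). Qed.

Lemma pastD n X Y : past_measurable eps n X -> past_measurable eps n Y ->
  past_measurable eps n (fun w => X w + Y w).
Proof. by move=> mX mY; exact: (measurable_funD mX mY). Qed.

Lemma pastM n X Y : past_measurable eps n X -> past_measurable eps n Y ->
  past_measurable eps n (fun w => X w * Y w).
Proof. by move=> mX mY; exact: (measurable_funM mX mY). Qed.

Lemma past_sum n (I : Type) (s : seq I) (F : I -> Omega -> R) :
  (forall i, past_measurable eps n (F i)) ->
  past_measurable eps n (fun w => \sum_(i <- s) F i w).
Proof.
move=> mF; elim: s => [|i s IH].
  rewrite (_ : (fun w => _) = (fun=> 0)); first exact: past_cst.
  by apply/funext => w; rewrite big_nil.
rewrite (_ : (fun w => _) = (fun w => F i w + \sum_(j <- s) F j w)).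
  exact: pastD.
by apply/funext => w; rewrite big_cons.
Qed.

End PastClosure.

Section MartingaleL2.
Context d (Omega : measurableType d) (R : realType) (P : probability Omega R).
Variable eps : int -> Omega -> R.
Hypothesis eiid : iid P eps.
Variable f : R -> R.
Hypotheses (mf : measurable_fun setT f) (fL2 : L2 P (f \o eps 0)).
Hypothesis f0 : EE P (f \o eps 0) = 0.
Let v := EE P (fun w => f (eps 0 w) ^+ 2).

Let mf2 : measurable_fun setT (fun x => f x ^+ 2).
Proof. exact: measurable_funX. Qed.

Let fL1 n : L1 P (f \o eps n).
Proof. by apply: (L1_eps_law eiid n mf (n := 0)); exact: L2_L1. Qed.

Let f2L1 n : L1 P (fun w => f (eps n w) ^+ 2).
Proof. exact: (L1_eps_law eiid n mf2 (n := 0)) fL2.2. Qed.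

(** H^2 and f(eps_n)^2 are independent and integrable, hence so is their product; no fourth moment
    enters. *)
Lemma L2_mart_step n H : past_measurable eps n H -> L2 P H ->
  L2 P (fun w => H w * f (eps n w)).
Proof.
move=> pH [mH iH]; split.
  apply: measurable_funM => //; apply: measurableT_comp => //.
  exact: (eps_meas eiid).
apply: L1_ext (L1_past_mul eiid (n := n) (X := fun w => H w ^+ 2)
  (g := fun x => f x ^+ 2) _ mf2 iH (f2L1 n)).
  by move=> w /=; rewrite exprMn.
by apply: (past_comp (g := fun x => x ^+ 2)) => //; exact: measurable_funX.
Qed.

Lemma EE_mart_step_sqr n H : past_measurable eps n H -> L2 P H ->
  EE P (fun w => (H w * f (eps n w)) ^+ 2) = EE P (fun w => H w ^+ 2) * v.
Proof.
move=> pH [mH iH].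
rewrite (EE_ext P (Y := fun w => H w ^+ 2 * f (eps n w) ^+ 2)); last first.
  by move=> w; rewrite exprMn.
rewrite (EE_past_mul eiid (n := n) (X := fun w => H w ^+ 2)
  (g := fun x => f x ^+ 2) _ mf2 iH (f2L1 n)).
  congr (_ * _); exact: (EE_eps_law eiid 0 mf2 (f2L1 n)).
by apply: (past_comp (g := fun x => x ^+ 2)) => //; exact: measurable_funX.
Qed.

Lemma L1_mart_step n H : past_measurable eps n H -> L1 P H ->
  L1 P (fun w => H w * f (eps n w)).
Proof. by move=> pH iH; exact: (L1_past_mul eiid pH mf iH (fL1 n)). Qed.

Lemma EE_mart_step n H : past_measurable eps n H -> L1 P H ->
  EE P (fun w => H w * f (eps n w)) = 0.
Proof.
move=> pH iH; rewrite (EE_past_mul eiid pH mf iH (fL1 n)).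
by rewrite (EE_eps_law eiid 0 mf (fL1 n)) f0 mulr0.
Qed.

Variables (t : int) (H : nat -> Omega -> R).
Hypothesis pH : forall k, past_measurable eps (t + k%:Z) (H k).
Hypothesis HL2 : forall k, L2 P (H k).

(** [f] is the identity for the score and for moving averages, and a centred truncated square in the
    law of large numbers for eps^2. *)
Definition mart_sum K w := \sum_(k < K) H k w * f (eps (t + k%:Z) w).

Lemma L2_mart_sum K : L2 P (mart_sum K).
Proof. by apply: L2_sum => k; exact: L2_mart_step. Qed.

Lemma past_mart_sum K : past_measurable eps (t + K%:Z) (mart_sum K).
Proof.
elim: K => [|K IH].
  rewrite (_ : mart_sum 0 = fun=> 0); first exact: past_cst.
  by apply/funext => w; rewrite /mart_sum big_ord0.
rewrite (_ : mart_sum K.+1 =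
    fun w => mart_sum K w + H K w * f (eps (t + K%:Z) w)); last first.
  by apply/funext => w; rewrite /mart_sum big_ord_recr.
apply: pastD; first by apply: (past_mono _ IH); lia.
apply: pastM.
  by apply: (past_mono _ (@pH K)); lia.
by apply: past_comp => //; apply: past_eps; lia.
Qed.

(** Orthogonality of the increments: in the square of S_K + H_K f(eps) the cross term has the past
    factor S_K H_K, integrable as a product of two square integrable variables, and f(eps) is
    centred. *)
Lemma EE_mart_sum_sqr K :
  EE P (fun w => mart_sum K w ^+ 2) =
  v * \sum_(k < K) EE P (fun w => H k w ^+ 2).
Proof.
elim: K => [|K IH].
  rewrite big_ord0 mulr0 -[RHS](EE_cst P); apply: EE_ext => w.
  by rewrite /mart_sum big_ord0 expr0n.
rewrite big_ord_recr /= mulrDr -IH.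
have i1 := (L2_mart_sum K).2.
have i2 : L1 P (fun w => mart_sum K w * H K w).
  exact: L2_mul (L2_mart_sum K) (HL2 K).
have p2 : past_measurable eps (t + K%:Z) (fun w => mart_sum K w * H K w).
  by apply: pastM => //; exact: past_mart_sum.
have i3 := L1_mart_step p2 i2.
have i4 := (L2_mart_step (@pH K) (HL2 K)).2.
rewrite [v * _]mulrC -(EE_mart_step_sqr (@pH K) (HL2 K)).
(* The zero inserted on the right is twice the vanishing cross expectation. *)
rewrite -EED// -[RHS]addr0 -(mulr0 2) -(EE_mart_step p2 i2) -EEZ//.
rewrite -EED//; [|exact: L1D|exact: L1Z].
by apply: EE_ext => w; rewrite /mart_sum big_ord_recr /=; ring.
Qed.

End MartingaleL2.

Section LLN.
Context d (Omega : measurableType d) (R : realType) (P : probability Omega R).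

(* Uniformity in the starting time [t] is what makes the second stretch, whose
   position depends on N, no harder than the first. *)
Definition LLN (U : int -> Omega -> R) (q : R) :=
  (forall n, L1 P (U n)) /\
  forall eta : R, 0 < eta -> exists K0 : nat, forall K, (K0 < K)%N -> forall t : int,
    EE P (fun w => `|K%:R^-1 * \sum_(k < K) U (t + k%:Z) w - q|) <= eta.

Lemma L1_avg (U : int -> Omega -> R) q K t : (forall n, L1 P (U n)) ->
  L1 P (fun w => K%:R^-1 * \sum_(k < K) U (t + k%:Z) w - q).
Proof.
by move=> iU; apply: L1B; [apply/L1Z/L1_sum|exact: L1_cst].
Qed.

Lemma LLN_ext U V q : (forall n w, U n w = V n w) -> LLN U q -> LLN V q.
Proof. by move=> UV; congr LLN; apply/funext => n; apply/funext. Qed.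

Lemma LLND U V q r : LLN U q -> LLN V r ->
  LLN (fun n w => U n w + V n w) (q + r).
Proof.
move=> [iU hU] [iV hV]; split; first by move=> n; exact: L1D.
move=> eta eta0; have e2 : 0 < eta / 2 by lra.
have [K1 h1] := hU _ e2; have [K2 h2] := hV _ e2.
exists (maxn K1 K2) => K; rewrite gtn_max => /andP[k1 k2] t.
have -> : eta = eta / 2 + eta / 2 by field.
apply: le_trans (lerD (h1 K k1 t) (h2 K k2 t)).
have iUa := L1_avg q K t iU; have iVa := L1_avg r K t iV.
rewrite -EED; [|exact: L1_norm..].
apply: EE_le; [apply: L1_norm; apply: (L1_avg (U := fun n w => U n w + V n w)) => n; exact: L1D|by apply: L1D; exact: L1_norm|].
move=> w; apply: le_trans (ler_normD _ _); rewrite big_split /= le_eqVlt.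
by apply/orP; left; apply/eqP; congr `|_|; ring.
Qed.

Lemma LLNZ c U q : LLN U q -> LLN (fun n w => c * U n w) (c * q).
Proof.
move=> [iU hU]; split; first by move=> n; exact: L1Z.
move=> eta eta0.
have c0 : 0 < `|c| + 1 by rewrite ltr_wpDl.
have [K1 h1] := hU _ (divr_gt0 eta0 c0).
exists K1 => K k1 t; have := h1 K k1 t; rewrite ler_pdivlMr// mulrC.
apply: le_trans; have iUa := L1_avg q K t iU.
apply: (@le_trans _ _ (`|c| * EE P (fun w =>
  `|K%:R^-1 * (\sum_(k < K) U (t + k%:Z) w) - q|))).
  rewrite -EEZ; last exact: L1_norm.
  apply: EE_le; [apply: L1_norm; apply: (L1_avg (U := fun n w => c * U n w)) => n; exact: L1Z|exact/L1Z/L1_norm|].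
  move=> w; rewrite -normrM -mulr_sumr le_eqVlt.
  by apply/orP; left; apply/eqP; congr `|_|; ring.
by rewrite ler_wpM2r ?lerDl// EE_ge0.
Qed.

Lemma LLN_cst q : LLN (fun _ _ => q) q.
Proof.
split; first by move=> n; exact: L1_cst.
move=> eta eta0; exists 0%N => K K0 t.
rewrite (EE_ext P (Y := fun=> 0)) ?EE_cst; first exact: ltW.
move=> w; rewrite sumr_const card_ord -(mulr_natl q) mulrA mulVf ?mul1r ?subrr ?normr0//.
by rewrite pnatr_eq0 -lt0n.
Qed.

Lemma LLN_sum (I : Type) (s : seq I) (U : I -> int -> Omega -> R) (q : I -> R) :
  (forall i, LLN (U i) (q i)) ->
  LLN (fun n w => \sum_(i <- s) U i n w) (\sum_(i <- s) q i).
Proof.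
move=> hU; elim: s => [|i s IH].
  by rewrite big_nil; apply: LLN_ext (LLN_cst 0) => n w; rewrite big_nil.
by rewrite big_cons; apply: LLN_ext (LLND (hU i) IH) => n w; rewrite big_cons.
Qed.

Lemma LLN_shift s U q : LLN U q -> LLN (fun n w => U (n - s) w) q.
Proof.
move=> [iU hU]; split => // eta /hU [K0 h]; exists K0 => K kK t.
rewrite (EE_ext P (Y := fun w =>
  `|K%:R^-1 * (\sum_(k < K) U (t - s + k%:Z) w) - q|)); first exact: h.
move=> w; congr (`|_ * _ - _|); apply: eq_bigr => k _; congr (U _ w); lia.
Qed.

End LLN.

Section LLNApprox.
Context d (Omega : measurableType d) (R : realType) (P : probability Omega R).

(** An L^1 error that is uniform in n survives averaging, whatever the length and the starting
    time. *)
Lemma LLN_approx (U : int -> Omega -> R) q : (forall n, L1 P (U n)) ->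
  (forall eta : R, 0 < eta -> exists V r, [/\ LLN P V r, `|r - q| <= eta &
     forall n, EE P (fun w => `|U n w - V n w|) <= eta]) -> LLN P U q.
Proof.
move=> iU h; split => // eta eta0.
have e3 : 0 < eta / 3 by lra.
have [V [r [[iV hV] rq UV]]] := h _ e3.
have [K0 hK0] := hV _ e3; exists K0 => K kK t.
have K0' : 0 < K%:R :> R by rewrite ltr0n; lia.
have -> : eta = K%:R^-1 * (\sum_(k < K) eta / 3) + eta / 3 + eta / 3.
  rewrite sumr_const card_ord -(mulr_natl (eta / 3)) (mulrA K%:R^-1) mulVf ?gt_eqF// mul1r.
  by field.
have iUV n : L1 P (fun w => `|U n w - V n w|) by apply/L1_norm/L1B.
apply: (@le_trans _ _ (EE P (fun w =>
  K%:R^-1 * (\sum_(k < K) `|U (t + k%:Z) w - V (t + k%:Z) w|) +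
  `|K%:R^-1 * (\sum_(k < K) V (t + k%:Z) w) - r| + eta / 3))).
  apply: EE_le.
  - apply: L1_norm; exact: (L1_avg q K t iU).
  - apply: L1D; last exact: L1_cst.
    apply: L1D; first exact/L1Z/L1_sum.
    by apply: L1_norm; exact: (L1_avg r K t iV).
  - move=> w.
    have -> : K%:R^-1 * (\sum_(k < K) U (t + k%:Z) w) - q =
        K%:R^-1 * (\sum_(k < K) (U (t + k%:Z) w - V (t + k%:Z) w)) +
        (K%:R^-1 * (\sum_(k < K) V (t + k%:Z) w) - r) + (r - q).
      by rewrite sumrB; ring.
    apply: le_trans (ler_normD _ _) _; apply: lerD => //.
    apply: le_trans (ler_normD _ _) _; apply: lerD => //.
    rewrite normrM ger0_norm ?invr_ge0 ?ler0n// ler_wpM2l ?invr_ge0 ?ler0n//.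
    exact: ler_norm_sum.
have iS : L1 P (fun w => \sum_(k < K) `|U (t + k%:Z) w - V (t + k%:Z) w|).
  exact: L1_sum.
have iA := L1_norm (L1_avg r K t iV).
rewrite EED; [|by apply: L1D => //; exact: L1Z|exact: L1_cst].
rewrite EED//; last exact: L1Z.
rewrite EE_cst EEZ// EE_sum//; apply: lerD => //; apply: lerD; last exact: hK0.
by rewrite ler_wpM2l ?invr_ge0 ?ler0n//; apply: ler_sum.
Qed.

End LLNApprox.

(** * Moving averages of the noise: second moments and laws of large numbers *)

Section MovingAverage.
Context d (Omega : measurableType d) (R : realType) (P : probability Omega R).
Variable eps : int -> Omega -> R.
Hypothesis eiid : iid P eps.

(** By orthogonality the average has second moment at most v B / K, for every starting time t. *)
Lemma LLN_mart (f : R -> R) (H : int -> Omega -> R) B :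
  measurable_fun setT f -> L2 P (f \o eps 0) -> EE P (f \o eps 0) = 0 ->
  (forall n, past_measurable eps n (H n)) -> (forall n, L2 P (H n)) ->
  (forall n, EE P (fun w => H n w ^+ 2) <= B) ->
  LLN P (fun n w => H n w * f (eps n w)) 0.
Proof.
move=> mf fL2 f0 pH HL2 HB; split.
  by move=> n; apply: L2_L1; exact: (L2_mart_step eiid mf fL2).
move=> eta eta0.
pose v := EE P (fun w => f (eps 0 w) ^+ 2).
have v0 : 0 <= v by apply: EE_ge0 => w; exact: sqr_ge0.
have B0 : 0 <= B by apply: le_trans (HB 0); apply: EE_ge0 => w; exact: sqr_ge0.
(* [EE_norm_le] with t = eta leaves eta / 2 + v B / (2 eta K), which is at most eta once K exceeds v
   B / eta^2. *)
have [K0 hK0] : exists K0 : nat, v * B / eta ^+ 2 < K0%:R.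
  by exists (Num.bound (v * B / eta ^+ 2));
    exact: archi_boundP (divr_ge0 (mulr_ge0 v0 B0) (sqr_ge0 _)).
exists K0 => K kK t.
have K0' : 0 < K%:R :> R by rewrite ltr0n; lia.
have hK : v * B / eta ^+ 2 < K%:R by rewrite (lt_trans hK0)// ltr_nat.
pose S := mart_sum eps f t (fun k => H (t + k%:Z)) K.
have pH' k : past_measurable eps (t + k%:Z) (H (t + k%:Z)) by exact: pH.
have HL2' k : L2 P (H (t + k%:Z)) by exact: HL2.
have SL2 : L2 P S by exact: (L2_mart_sum eiid mf fL2 pH' HL2').
rewrite (EE_ext P (Y := fun w => `|K%:R^-1 * S w|)); last first.
  by move=> w; rewrite subr0.
apply: le_trans (EE_norm_le eta0 (L2Z K%:R^-1 SL2)) _.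
rewrite (EE_ext P (Y := fun w => K%:R^-1 ^+ 2 * S w ^+ 2)); last first.
  by move=> w; rewrite exprMn.
rewrite EEZ; last exact: SL2.2.
rewrite (EE_mart_sum_sqr eiid mf fL2 f0 pH' HL2') -/v.
rewrite [leRHS](_ : eta = eta / 2 + eta / 2); last by field.
rewrite lerD2l ler_pdivrMr; last by lra.
have hS : \sum_(k < K) EE P (fun w => H (t + k%:Z) w ^+ 2) <= K%:R * B.
  rewrite mulr_natl -[X in _ <= _ *+ X](card_ord K) -sumr_const.
  by apply: ler_sum => k _; exact: HB.
apply: (@le_trans _ _ (K%:R^-1 ^+ 2 * (v * (K%:R * B)))).
  by rewrite ler_wpM2l ?sqr_ge0// ler_wpM2l.
have -> : K%:R^-1 ^+ 2 * (v * (K%:R * B)) = v * B / K%:R by field; lra.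
rewrite ler_pdivrMr//.
move: hK; rewrite ltr_pdivrMr ?exprn_gt0// => /ltW h; apply: le_trans h _.
by rewrite le_eqVlt; apply/orP; left; apply/eqP; field; lra.
Qed.

Hypothesis eL2 : L2 P (eps 0).
Hypothesis e0 : EE P (eps 0) = 0.
Let s2 := EE P (fun w => eps 0 w ^+ 2).

Let mid : measurable_fun setT (id : R -> R).
Proof. exact: measurable_id. Qed.

Let msqr : measurable_fun setT (fun x : R => x ^+ 2).
Proof. exact: measurable_funX. Qed.

Lemma eps_L2 n : L2 P (eps n).
Proof.
split; first exact: (eps_meas eiid).
exact: (L1_eps_law eiid n msqr (n := 0)) eL2.2.
Qed.

Lemma EE_eps n : EE P (eps n) = 0.
Proof. by rewrite (EE_eps_law eiid 0 mid (n := n)) //; exact: L2_L1 (eps_L2 n). Qed.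

Lemma EE_eps_sqr n : EE P (fun w => eps n w ^+ 2) = s2.
Proof. by rewrite (EE_eps_law eiid 0 msqr (n := n)) //; exact: (eps_L2 n).2. Qed.

(** Only a first moment of eps^2 is available, so the L^2 argument is applied to min (eps^2, j)
    minus its mean; the truncation error E eps^2 - E min (eps^2, j) is the same for all n and tends
    to 0. *)
Lemma LLN_eps_sqr : LLN P (fun n w => eps n w ^+ 2) s2.
Proof.
apply: LLN_approx; first by move=> n; exact: (eps_L2 n).2.
move=> eta eta0.
pose g (j : nat) (x : R) := Num.min (x ^+ 2) j%:R.
have mg j : measurable_fun setT (g j).
  by apply: measurable_minr => //; exact: measurable_cst.
have g0 j x : 0 <= g j x by rewrite le_min sqr_ge0 ler0n.
have gle j x : g j x <= x ^+ 2 by rewrite ge_min lexx.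
have gj j x : g j x <= j%:R by rewrite ge_min lexx orbT.
have mge j n : measurable_fun setT (fun w => g j (eps n w)).
  by apply: measurableT_comp => //; exact: (eps_meas eiid).
have ig j n : L1 P (fun w => g j (eps n w)).
  by apply: (L1_bounded P (B := j%:R)) => // w; rewrite ger0_norm.
have cv : EE P (fun w => g j (eps 0 w)) @[j --> \oo] --> s2.
  apply: (EE_dct (Y := fun w => eps 0 w ^+ 2)) => //.
  - by apply: measurable_funX; exact: (eps_meas eiid).
  - exact: eL2.2.
  - by move=> j w; rewrite ger0_norm.
  - move=> w; apply: cvg_near_cst.
    exists (Num.bound (eps 0 w ^+ 2)) => // j /= hj.
    apply/min_idPl; rewrite (le_trans (ltW (archi_boundP (sqr_ge0 _))))//.
    by rewrite ler_nat.
have /cvgrPdist_le /(_ eta eta0) [J _ /(_ J (leqnn J)) /= hJ] := cv.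
pose m := EE P (fun w => g J (eps 0 w)).
exists (fun n w => g J (eps n w)), m; split.
- have mf : measurable_fun setT (fun x => g J x - m) by exact: measurable_funB.
  have fB x : `|g J x - m| <= J%:R + `|m|.
    by apply: le_trans (ler_normB _ _) _; rewrite lerD2r ger0_norm.
  have := @LLN_mart (fun x => g J x - m) (fun _ _ => 1) 1 mf.
  have mfe : measurable_fun setT (fun w => g J (eps 0 w) - m).
    exact: measurable_funB.
  case.
  + split => //; apply: (L1_bounded P (B := (J%:R + `|m|) ^+ 2)).
      exact: measurable_funX.
    by move=> w /=; rewrite normrX lerXn2r// nnegrE ?addr_ge0.
  + rewrite /comp EEB ?EE_cst ?subrr//; exact: L1_cst.
  + by move=> n; exact: past_cst.
  + by move=> n; exact: L2_cst.
  + by move=> n; rewrite (EE_ext P (Y := fun=> 1)) ?EE_cst// => w; rewrite expr1n.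
  move=> i1 h1.
  have := LLND (conj i1 h1) (LLN_cst P m); rewrite add0r; apply: LLN_ext => n w.
  by rewrite mul1r subrK.
- by rewrite distrC.
- move=> n; rewrite (EE_ext P (Y := fun w => eps n w ^+ 2 - g J (eps n w))).
    rewrite EEB//; last exact: (eps_L2 n).2.
    rewrite EE_eps_sqr (EE_eps_law eiid 0 (mg J) (ig J n)).
    exact: le_trans (ler_norm _) hJ.
  by move=> w; rewrite ger0_norm// subr_ge0.
Qed.

Lemma LLN_eps : LLN P eps 0.
Proof.
have := @LLN_mart id (fun _ _ => 1) 1 mid eL2 e0; case => //.
- by move=> n; exact: past_cst.
- by move=> n; exact: L2_cst.
- by move=> n; rewrite (EE_ext P (Y := fun=> 1)) ?EE_cst// => w; rewrite expr1n.
move=> i1 h1; apply: LLN_ext (conj i1 h1) => n w; exact: mul1r.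
Qed.

Lemma LLN_eps_lag (j : nat) : (0 < j)%N ->
  LLN P (fun n w => eps (n - j%:Z) w * eps n w) 0.
Proof.
move=> j0; have := @LLN_mart id (fun n w => eps (n - j%:Z) w) s2 mid eL2 e0.
case => //.
- by move=> n; apply: past_eps; lia.
- by move=> n; exact: eps_L2.
- by move=> n; rewrite EE_eps_sqr.
Qed.

Definition ma (c : R) (alpha : nat -> R) (m : nat) (n : int) (w : Omega) : R :=
  c + \sum_(l < m) alpha l * eps (n - 1 - l%:Z) w.

Lemma ma_recr c alpha m n w :
  ma c alpha m.+1 n w = ma c alpha m n w + alpha m * eps (n - 1 - m%:Z) w.
Proof. by rewrite /ma big_ord_recr /= addrA. Qed.

Lemma past_ma c alpha m n : past_measurable eps n (ma c alpha m n).
Proof.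
apply: pastD; first exact: past_cst.
apply: past_sum => l; apply: pastM; first exact: past_cst.
by apply: past_eps; lia.
Qed.

Lemma ma_L2 c alpha m n : L2 P (ma c alpha m n).
Proof.
apply: L2D; first exact: L2_cst.
by apply: L2_sum => l; apply: L2Z; exact: eps_L2.
Qed.

Definition ma_var c (alpha : nat -> R) m := c ^+ 2 + s2 * \sum_(l < m) alpha l ^+ 2.

(** Induction on m: the square of the new average adds a square of the noise and products of noises
    at distinct times, each of which is a martingale difference up to a time shift. *)
Lemma LLN_ma_sqr c alpha m :
  LLN P (fun n w => ma c alpha m n w ^+ 2) (ma_var c alpha m).
Proof.
elim: m => [|m IH].
  apply: LLN_ext (LLN_cst P (ma_var c alpha 0)) => n w.
  by rewrite /ma /ma_var !big_ord0 mulr0 !addr0.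
have h1 : LLN P (fun n w => ma c alpha m n w * eps (n - 1 - m%:Z) w) 0.
  have hl (l : 'I_m) :
      LLN P (fun n w => alpha l * (eps (n - 1 - l%:Z) w * eps (n - 1 - m%:Z) w)) 0.
    rewrite -(mulr0 (alpha l)); apply: LLNZ.
    (* Seen from time n - 1 - l, the noise of time n - 1 - m has lag m - l. *)
    have ml : (0 < m - l)%N by have := ltn_ord l; lia.
    have := LLN_shift (1 + (l : nat)%:Z) (LLN_eps_lag ml); apply: LLN_ext => n w.
    rewrite mulrC; congr (eps _ w * eps _ w); have := ltn_ord l; lia.
  have := LLND (LLNZ c (LLN_shift (1 + m%:Z) LLN_eps)) (LLN_sum (index_enum _) hl).
  rewrite big1 // mulr0 addr0; apply: LLN_ext => n w.
  rewrite /ma mulrDl mulr_suml; congr (_ * eps _ w + _); first lia.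
  by apply: eq_bigr => l _; rewrite mulrA.
have h2 := LLN_shift (1 + m%:Z) LLN_eps_sqr.
have := LLND IH (LLND (LLNZ (2 * alpha m) h1) (LLNZ (alpha m ^+ 2) h2)).
have -> : ma_var c alpha m + (2 * alpha m * 0 + alpha m ^+ 2 * s2) =
    ma_var c alpha m.+1.
  by rewrite /ma_var big_ord_recr /=; ring.
apply: LLN_ext => n w; rewrite ma_recr.
have -> : n - (1 + m%:Z) = n - 1 - m%:Z by lia.
ring.
Qed.

Lemma EE_ma c alpha m n : EE P (ma c alpha m n) = c.
Proof.
rewrite /ma EED; [|exact: L1_cst|]; last first.
  by apply: L1_sum => l _; apply: L1Z; exact: L2_L1 (eps_L2 _).
rewrite EE_cst EE_sum; last by move=> l _; apply: L1Z; exact: L2_L1 (eps_L2 _).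
rewrite big1 ?addr0// => l _.
rewrite EEZ; last exact: L2_L1 (eps_L2 _).
by rewrite EE_eps mulr0.
Qed.

Lemma EE_ma_sqr c alpha m n :
  EE P (fun w => ma c alpha m n w ^+ 2) = ma_var c alpha m.
Proof.
have pH (k : nat) : past_measurable eps (n - m%:Z + k%:Z)
    ((fun (k : nat) (_ : Omega) => alpha (m - k.+1)%N) k) by exact: past_cst.
have HL2 (k : nat) : L2 P ((fun (k : nat) (_ : Omega) => alpha (m - k.+1)%N) k).
  exact: L2_cst.
(* In increasing time the centred average is a martingale sum started at n - m, with deterministic
   weights in reversed order. *)
have SE : ma 0 alpha m n =1
    mart_sum eps id (n - m%:Z) (fun k _ => alpha (m - k.+1)%N) m.
  move=> w; rewrite /ma add0r /mart_sum (reindex_inj rev_ord_inj) /=.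
  apply: eq_bigr => l _; congr (_ * eps _ w); have := ltn_ord l; lia.
have i0 : L2 P (ma 0 alpha m n) by exact: ma_L2.
rewrite (EE_ext P (Y := fun w => (c ^+ 2 + 2 * c * ma 0 alpha m n w) +
  (ma 0 alpha m n w) ^+ 2)); last by move=> w; rewrite /ma; ring.
have i1 : L1 P (fun w => 2 * c * ma 0 alpha m n w) by exact/L1Z/L2_L1.
rewrite EED; [|by apply: L1D => //; exact: L1_cst|exact: i0.2].
rewrite EED//; last exact: L1_cst.
rewrite EEZ; last exact: L2_L1.
rewrite EE_ma mulr0 addr0 EE_cst /ma_var; congr (_ + _).
rewrite (EE_ext P (Y := fun w => (mart_sum eps id (n - m%:Z)
   (fun k _ => alpha (m - k.+1)%N) m w) ^+ 2)); last by move=> w; rewrite SE.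
rewrite (EE_mart_sum_sqr eiid mid eL2 e0 pH HL2); congr (_ * _).
rewrite (reindex_inj rev_ord_inj) /=; apply: eq_bigr => l _.
by rewrite EE_cst; congr (alpha _ ^+ 2); have := ltn_ord l; lia.
Qed.

Lemma EE_ma_diff_sqr c alpha m M n : (m <= M)%N ->
  EE P (fun w => (ma c alpha M n w - ma c alpha m n w) ^+ 2) =
  ma_var c alpha M - ma_var c alpha m.
Proof.
move=> mM.
(* The difference of the two averages is again a moving average, with its first m coefficients
   cancelled. *)
pose a' l := if (l < m)%N then 0 else alpha l.
rewrite (EE_ext P (Y := fun w => ma 0 a' M n w ^+ 2)).
  rewrite EE_ma_sqr /ma_var expr0n /= add0r.
  rewrite addrAC opprD addrA subrr add0r addrC -mulrBr; congr (_ * _).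
  rewrite -!(big_mkord xpredT (fun l => a' l ^+ 2)) -!(big_mkord xpredT (fun l => alpha l ^+ 2)).
  rewrite !(big_cat_nat (leq0n m) mM) /= addrAC subrr add0r.
  rewrite big_nat big1 ?add0r => [|l /andP[_ lm]]; last by rewrite /a' lm expr0n.
  apply: eq_big_nat => l /andP[ml _]; by rewrite /a' ltnNge ml.
move=> w; congr (_ ^+ 2); rewrite /ma add0r opprD addrACA subrr add0r.
rewrite -!(big_mkord xpredT (fun l => a' l * eps (n - 1 - l%:Z) w))
  -!(big_mkord xpredT (fun l => alpha l * eps (n - 1 - l%:Z) w)).
rewrite !(big_cat_nat (leq0n m) mM) /= addrAC subrr add0r.
rewrite [in RHS]big_nat [X in _ = X + _]big1 ?add0r => [|l /andP[_ lm]];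
  last by rewrite /a' lm mul0r.
by apply: eq_big_nat => l /andP[ml _]; rewrite /a' ltnNge ml.
Qed.

End MovingAverage.

(** * Central limit theorem *)

Section Elementary.
Context (R : realType).
Implicit Types x y s : R.

Lemma normr_sin_le x : `|sin x| <= `|x|.
Proof.
wlog x0 : x / 0 < x.
  move=> h; have [x0|x0|<-] := ltgtP 0 x.
  - exact: h.
  - by rewrite -normrN -[leRHS]normrN -sinN; apply: h; rewrite oppr_gt0.
  - by rewrite sin0.
have h1 y : y \in `]0, x[%R -> is_derive y (1 : R) sin (cos y).
  by move=> _; exact: is_derive_sin.
have h2 : {within `[0, x], continuous sin}.
  by apply: continuous_subspaceT => y; exact: continuous_sin.
have [c _] := MVT x0 h1 h2.
rewrite sin0 !subr0 => ->; rewrite normrM ler_piMl// ler_norml.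
by rewrite cos_geN1 cos_le1.
Qed.

Lemma cos_half x : 1 - cos x = 2 * sin (x / 2) ^+ 2.
Proof.
have {1}-> : x = x / 2 *+ 2 by rewrite mulr2n; field.
by rewrite cos_mulr2n (cos2sin2 (x / 2)); lra.
Qed.

Lemma one_minus_cos_le x : 0 <= 1 - cos x <= x ^+ 2 / 2.
Proof.
rewrite cos_half mulr_ge0 ?sqr_ge0//=.
have : sin (x / 2) ^+ 2 <= (x / 2) ^+ 2.
  rewrite -real_normK ?num_real// -[leRHS]real_normK ?num_real//.
  by rewrite lerXn2r ?nnegrE// normr_sin_le.
by rewrite expr_div_n; lra.
Qed.

(** Mean value theorem for x - sin x, whose derivative 1 - cos is at most half the square of its
    argument; the crude constant suffices. *)
Lemma sin_taylor x : `|x - sin x| <= `|x| ^+ 3 / 2.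
Proof.
wlog x0 : x / 0 < x.
  move=> h; have [x0|x0|<-] := ltgtP 0 x.
  - exact: h.
  - rewrite -normrN -[`|x|]normrN; have -> : - (x - sin x) = - x - sin (- x).
      by rewrite sinN; lra.
    by apply: h; rewrite oppr_gt0.
  - by rewrite sin0 subr0 normr0 expr0n mul0r.
have d1 y : y \in `]0, x[%R ->
    is_derive y (1 : R) (fun y : R => y - sin y) (1 - cos y).
  by move=> _; exact: is_deriveB.
have d2 : {within `[0, x], continuous (fun y : R => y - sin y)}.
  apply: continuous_subspaceT => y; apply: cvgB; first exact: cvg_id.
  exact: continuous_sin.
have [c] := MVT x0 d1 d2.
rewrite in_itv/= sin0 !subr0 => /andP[c0 cx] ->.
have /andP[h1 h2] := one_minus_cos_le c.
rewrite normrM !ger0_norm ?(ltW x0)//.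
have -> : x ^+ 3 / 2 = x ^+ 2 / 2 * x by field.
rewrite ler_wpM2r ?(ltW x0)//; apply: le_trans h2 _.
rewrite ler_wpM2r//; apply: lerXn2r; rewrite ?nnegrE ?(ltW c0) ?(ltW x0)//.
exact: ltW.
Qed.

Lemma cos_taylor0 x : `|cos x - 1 + x ^+ 2 / 2| <= x ^+ 4 / 4.
Proof.
(* With a = x / 2 the left side is 2 (a^2 - sin^2 a), a difference of squares. *)
have -> : cos x - 1 + x ^+ 2 / 2 =
    2 * (x / 2 - sin (x / 2)) * (x / 2 + sin (x / 2)).
  by have := cos_half x; nra.
rewrite !normrM (ger0_norm (ler0n _ 2)).
have h1 := sin_taylor (x / 2).
have h2 : `|x / 2 + sin (x / 2)| <= 2 * `|x / 2|.
  by apply: le_trans (ler_normD _ _) _; have := normr_sin_le (x / 2); lra.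
apply: (@le_trans _ _ (2 * (`|x / 2| ^+ 3 / 2) * (2 * `|x / 2|))).
  by apply: ler_pM => //; rewrite ler_wpM2l.
have -> : 2 * (`|x / 2| ^+ 3 / 2) * (2 * `|x / 2|) = 2 * (`|x / 2| ^+ 2) ^+ 2.
  by field.
rewrite real_normK ?num_real//.
have := sqr_ge0 (x ^+ 2).
have -> : 2 * ((x / 2) ^+ 2) ^+ 2 = (x ^+ 2) ^+ 2 / 8 by field.
have -> : x ^+ 4 / 4 = (x ^+ 2) ^+ 2 / 4 by field.
lra.
Qed.

(** Size of the second-order Taylor remainder of cos: quadratic for large x, hence integrable with
    two moments, and cubic for small x, hence negligible in Lindeberg's sense. *)
Definition cubic_cut x := x ^+ 2 * Num.min 1 `|x|.

Lemma cubic_cut_ge0 x : 0 <= cubic_cut x.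
Proof. by rewrite mulr_ge0 ?sqr_ge0// le_min ler01 normr_ge0. Qed.

Lemma cos_taylor s x :
  `|cos (s + x) - (cos s - x * sin s - x ^+ 2 / 2 * cos s)| <= 3 * cubic_cut x.
Proof.
have -> : cos (s + x) - (cos s - x * sin s - x ^+ 2 / 2 * cos s) =
    cos s * (cos x - 1 + x ^+ 2 / 2) + sin s * (x - sin x).
  by rewrite cosD; ring.
have cs : `|cos s| <= 1 by rewrite ler_norml cos_geN1 cos_le1.
have ss : `|sin s| <= 1 by rewrite ler_norml sin_geN1 sin_le1.
apply: (@le_trans _ _ (`|cos x - 1 + x ^+ 2 / 2| + `|x - sin x|)).
  by apply: le_trans (ler_normD _ _) _; rewrite !normrM; apply: lerD; rewrite ler_piMl.
rewrite /cubic_cut -[x ^+ 2 in leRHS](real_normK (num_real x)).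
have [x1|x1] := leP 1 `|x|.
  rewrite mulr1; have /andP[h1 h2] := one_minus_cos_le x.
  have : `|x - sin x| <= 2 * `|x|.
    by apply: le_trans (ler_normB _ _) _; have := normr_sin_le x; lra.
  have : `|cos x - 1 + x ^+ 2 / 2| <= `|x| ^+ 2 / 2.
    by rewrite ger0_norm; rewrite ?real_normK ?num_real//; lra.
  nra.
have h1 := cos_taylor0 x; have h2 := sin_taylor x.
apply: le_trans (lerD h1 h2) _.
have -> : x ^+ 4 = `|x| ^+ 3 * `|x|.
  by rewrite -[RHS]/(`|x| ^+ 3 * `|x| ^+ 1) -exprD -normrX ger0_norm// exprn_even_ge0.
have x0 := normr_ge0 x; have : 0 <= `|x| ^+ 3 by rewrite exprn_ge0.
have -> : `|x| ^+ 2 * `|x| = `|x| ^+ 3 by ring.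
nra.
Qed.

Lemma expRN_lip x y : 0 <= x -> 0 <= y -> `|expR (- x) - expR (- y)| <= `|x - y|.
Proof.
wlog xy : x y / x <= y.
  move=> h x0 y0; case: (leP x y) => [|/ltW] xy; first exact: h.
  by rewrite distrC [leRHS]distrC; exact: h.
move=> x0 y0.
have -> : expR (- y) = expR (- x) * expR (- (y - x)).
  by rewrite -expRD; congr expR; ring.
have h1 : 1 - (y - x) <= expR (- (y - x)) by rewrite expR_ge1Dx.
have h2 : expR (- (y - x)) <= 1.
  by rewrite -expR0 ler_expR oppr_le0 subr_ge0.
have h3 : expR (- x) <= 1 by rewrite -expR0 ler_expR oppr_le0.
have h4 := expR_gt0 (- x).
rewrite distrC [leRHS]distrC [`|y - x|]ger0_norm ?subr_ge0//.
rewrite ler_norml; apply/andP; split; nra.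
Qed.

(** exp (- y) lies between 1 - y and 1 / (1 + y) = 1 - y + y^2 / (1 + y), and is at most 1. *)
Lemma expRN_taylor y : 0 <= y -> `|1 - y - expR (- y)| <= Num.min y (y ^+ 2).
Proof.
move=> y0.
have h1 : 1 - y <= expR (- y) by rewrite expR_ge1Dx.
have h2 : expR (- y) <= 1 by rewrite -expR0 ler_expR oppr_le0.
rewrite ler0_norm; last by lra.
rewrite le_min; apply/andP; split; first by lra.
have h3 : expR (- y) <= (1 + y)^-1.
  rewrite expRN lef_pV2 ?posrE ?expR_gt0 ?expR_ge1Dx//; lra.
have : (1 + y)^-1 = 1 - y + y ^+ 2 / (1 + y) by field; lra.
have : y ^+ 2 / (1 + y) <= y ^+ 2.
  by rewrite ler_pdivrMr ?ler_peMr ?sqr_ge0//; lra.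
lra.
Qed.

Lemma expRN_taylor_sqr (v x : R) : 0 <= v ->
  `|1 - v * x ^+ 2 - expR (- (v * x ^+ 2))| <= (v + v ^+ 2) * cubic_cut x.
Proof.
move=> v0; have y0 : 0 <= v * x ^+ 2 by rewrite mulr_ge0 ?sqr_ge0.
apply: le_trans (expRN_taylor y0) _; rewrite /cubic_cut.
have x2 := sqr_ge0 x; have v2 := sqr_ge0 v.
have [x1|x1] := leP 1 `|x|.
  by rewrite ge_min; apply/orP; left; rewrite mulr1; nra.
rewrite ge_min; apply/orP; right.
have -> : (v * x ^+ 2) ^+ 2 = v ^+ 2 * (x ^+ 2 * `|x| ^+ 2).
  by rewrite real_normK ?num_real//; ring.
have h : x ^+ 2 * `|x| ^+ 2 <= x ^+ 2 * `|x|.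
  by rewrite ler_wpM2l// expr2 ler_piMr// ltW.
have h' : 0 <= x ^+ 2 * `|x| by rewrite mulr_ge0.
nra.
Qed.

Definition tail_sqr (B x : R) := if `|x| > B then x ^+ 2 else 0.

Lemma tail_sqr_ge0 B x : 0 <= tail_sqr B x.
Proof. by rewrite /tail_sqr; case: ifP => // _; exact: sqr_ge0. Qed.

Lemma tail_sqr_le B x : tail_sqr B x <= x ^+ 2.
Proof. by rewrite /tail_sqr; case: ifP => // _; exact: sqr_ge0. Qed.

(** Meant for z a weight known from the past and x the next noise: after the split at |x| > B the
    first term is a product whose expectation factors by independence, and the second no longer
    contains the noise. *)
Lemma cubic_cut_mul_le (B z x : R) : 1 <= B ->
  cubic_cut (z * x) <= z ^+ 2 * tail_sqr B x + B ^+ 3 * cubic_cut z.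
Proof.
move=> B1; rewrite /tail_sqr; case: ifPn => [_|].
  have h : cubic_cut (z * x) <= z ^+ 2 * x ^+ 2.
    by rewrite -exprMn /cubic_cut ler_piMr ?sqr_ge0// ge_min lexx.
  apply: le_trans h _; rewrite lerDl mulr_ge0 ?cubic_cut_ge0//.
  by rewrite exprn_ge0//; lra.
rewrite -leNgt mulr0 add0r => xB.
rewrite /cubic_cut exprMn normrM.
have -> : B ^+ 3 * (z ^+ 2 * Num.min 1 `|z|) =
   (z ^+ 2 * B ^+ 2) * (B * Num.min 1 `|z|) by ring.
have x2 : x ^+ 2 <= B ^+ 2.
  by rewrite -real_normK ?num_real// lerXn2r// nnegrE; lra.
apply: ler_pM.
- by rewrite mulr_ge0 ?sqr_ge0.
- by rewrite le_min ler01 mulr_ge0.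
- by rewrite ler_wpM2l ?sqr_ge0.
- have z0 := normr_ge0 z; have x0 := normr_ge0 x.
  have [z1|z1] := leP 1 `|z|.
    by rewrite ge_min; apply/orP; left; lra.
  by rewrite ge_min; apply/orP; right; nra.
Qed.

End Elementary.

Lemma measurable_cosR (R : realType) : measurable_fun setT (@cos R).
Proof. by apply: continuous_measurable_fun; exact: continuous_cos. Qed.

Lemma measurable_sinR (R : realType) : measurable_fun setT (@sin R).
Proof. by apply: continuous_measurable_fun; exact: continuous_sin. Qed.

Lemma measurable_cubic_cut (R : realType) : measurable_fun setT (@cubic_cut R).
Proof.
apply: measurable_funM; first exact: measurable_funX.
apply: measurable_minr; [exact: measurable_cst|exact: normr_measurable].
Qed.

Lemma measurable_tail_sqr (R : realType) (B : R) : measurable_fun setT (tail_sqr B).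
Proof.
apply: measurable_fun_ifT; last exact: measurable_cst.
  by apply: measurable_fun_ltr; [exact: measurable_cst|exact: normr_measurable].
exact: measurable_funX.
Qed.

(** * Lindeberg telescoping for a martingale *)

Section MartingaleCLT.
Context d (Omega : measurableType d) (R : realType) (P : probability Omega R).
Variable eps : int -> Omega -> R.
Hypothesis eiid : iid P eps.
Hypothesis eL2 : L2 P (eps 0).
Hypothesis e0 : EE P (eps 0) = 0.
Let s2 := EE P (fun w => eps 0 w ^+ 2).
Variables (t : int) (zeta : nat -> Omega -> R).
Hypothesis pz : forall k, past_measurable eps (t + k%:Z) (zeta k).
Hypothesis zL2 : forall k, L2 P (zeta k).
Variables (tau c : R).
Hypothesis tau0 : 0 <= tau.

Let v := s2 / 2.
Let v0 : 0 <= v.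
Proof. by rewrite divr_ge0// EE_ge0// => w; exact: sqr_ge0. Qed.

Let S := mart_sum eps id t zeta.
Let V K w := \sum_(k < K) zeta k w ^+ 2.
(** Conditional variance still to come, cut at 0 so that [h] stays at most 1 even when [V] exceeds
    [tau]. *)
Let D K w := Num.max (tau - V K w) 0.
Let h K w := expR (- (v * D K w)).
Let A K := EE P (fun w => h K w * cos (S K w + c)).

Let mid : measurable_fun setT (id : R -> R).
Proof. exact: measurable_id. Qed.

Let msqr : measurable_fun setT (fun x : R => x ^+ 2).
Proof. exact: measurable_funX. Qed.

(** The bound is n + 1 and not n: the last term of [V K] is zeta_(K-1), already known before the
    noise of time t + K - 1. *)
Let pV K n : t + K%:Z <= n + 1 -> past_measurable eps n (V K).
Proof.
move=> Kn; rewrite /V.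
have -> : (fun w => \sum_(k < K) zeta k w ^+ 2) =
    (fun w => \sum_(k <- index_iota 0 K) (if (k < K)%N then zeta k w else 0) ^+ 2).
  apply/funext => w; rewrite -(big_mkord xpredT (fun k => zeta k w ^+ 2)).
  by apply: eq_big_nat => k /andP[_ ->].
apply: past_sum => k; case kK : (k < K)%N; last exact: past_cst.
apply: (past_comp msqr); apply: (past_mono _ (@pz k)); lia.
Qed.

Let ph K n : t + K%:Z <= n + 1 -> past_measurable eps n (h K).
Proof.
move=> /pV pVK; rewrite /h /D.
apply: (past_comp (g := fun x => expR (- (v * Num.max (tau - x) 0)))) pVK.
apply: measurableT_comp => //; apply: measurableT_comp => //.
apply: measurable_funM => //; apply: measurable_maxr => //.
exact: measurable_funB.
Qed.

Let pS K n : t + K%:Z <= n -> past_measurable eps n (S K).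
Proof. by move=> Kn; apply: (past_mono Kn); exact: (past_mart_sum mid pz). Qed.

Let D0 K w : 0 <= D K w. Proof. by rewrite /D le_max lexx orbT. Qed.

Let h01 K w : 0 <= h K w <= 1.
Proof.
rewrite /h expR_ge0/=; have vD : 0 <= v * D K w by rewrite mulr_ge0.
by rewrite -[leRHS](@expR0 R) ler_expR oppr_le0.
Qed.

Let cos1 (x : R) : `|cos x| <= 1.
Proof. by rewrite ler_norml cos_geN1 cos_le1. Qed.

Let sin1 (x : R) : `|sin x| <= 1.
Proof. by rewrite ler_norml sin_geN1 sin_le1. Qed.

Let L1_bmul (X Y : Omega -> R) : measurable_fun setT X -> (forall w, `|X w| <= 1) ->
  L1 P Y -> L1 P (fun w => X w * Y w).
Proof.
move=> mX X1 iY; apply: (L1_le _ (L1_norm iY)).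
  by apply: measurable_funM => //; exact: L1_meas iY.
by move=> w; rewrite normrM ler_piMl.
Qed.

(** The Taylor errors committed at step k on cos and on exp (- v zeta_k^2). *)
Definition lindeberg_term k := 3 * EE P (fun w => cubic_cut (zeta k w * eps (t + k%:Z) w))
  + (v + v ^+ 2) * EE P (fun w => cubic_cut (zeta k w)).

Let iz2 k : L1 P (fun w => zeta k w ^+ 2). Proof. exact: (zL2 k).2. Qed.

Let ze_L2 k : L2 P (fun w => zeta k w * eps (t + k%:Z) w).
Proof. exact: (L2_mart_step eiid mid eL2 (@pz k)). Qed.

Let L1_cubic X : L2 P X -> L1 P (fun w => cubic_cut (X w)).
Proof.
move=> [mX iX]; apply: (L1_le _ iX).
  by apply: measurableT_comp => //; exact: measurable_cubic_cut.
move=> w; rewrite ger0_norm ?cubic_cut_ge0//.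
by rewrite /cubic_cut ler_piMr ?sqr_ge0// ge_min lexx.
Qed.

Let iV K : L1 P (V K).
Proof. by apply: L1_sum => k _. Qed.

Let iD K : L1 P (D K).
Proof.
have mVK : measurable_fun setT (V K) := L1_meas (iV K).
apply: (L1_le _ (L1D (L1_cst P tau) (iV K))).
  by apply: measurable_maxr => //; exact: measurable_funB.
have V0 w : 0 <= V K w by apply: sumr_ge0 => k _; exact: sqr_ge0.
move=> w; rewrite ger0_norm ?D0// /D ge_max; have V0w := V0 w.
rewrite /=; move: V0w tau0; move: (V K w) => x x0 t0.
by apply/andP; split; lra.
Qed.

(** Taylor expansion of cos in the new increment. The linear term is centred; in the quadratic one
    e^2 may be replaced by its mean s2, which produces the factor 1 - v z^2, close to exp (- v z^2),
    and h_(k+1) exp (- v z^2) equals h_k as long as the cut in [D] is inactive. *)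
Lemma clt_step k : `|A k.+1 - A k| <=
  lindeberg_term k + v * EE P (fun w => zeta k w ^+ 2 + D k.+1 w - D k w).
Proof.
pose e := eps (t + k%:Z).
pose z := zeta k.
pose s w := S k w + c.
have ps : past_measurable eps (t + k%:Z) s.
  by apply: pastD; [exact: pS|exact: past_cst].
(* Predictability: V_(k+1) ends with zeta_k, so h_(k+1) may stand as a past factor in front of the
   noise of time t + k. *)
have phk : past_measurable eps (t + k%:Z) (h k.+1) by apply: ph; lia.
have mh : measurable_fun setT (h k.+1) := past_measurableW eiid phk.
have ms : measurable_fun setT s := past_measurableW eiid ps.
have mh0 : measurable_fun setT (h k).
  by apply: (past_measurableW eiid (n := t + k%:Z)); apply: ph; lia.
have mcs : measurable_fun setT (fun w => cos (s w)).
  exact: measurableT_comp (@measurable_cosR R) ms.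
have mss : measurable_fun setT (fun w => sin (s w)).
  exact: measurableT_comp (@measurable_sinR R) ms.
have hn w : `|h k.+1 w| <= 1 by have /andP[? ?] := h01 k.+1 w; rewrite ger0_norm.
have h0n w : `|h k w| <= 1 by have /andP[? ?] := h01 k w; rewrite ger0_norm.
pose r w := cos (s w + z w * e w) -
  (cos (s w) - z w * e w * sin (s w) - (z w * e w) ^+ 2 / 2 * cos (s w)).
pose X1 w := h k.+1 w * sin (s w) * z w.
pose X2 w := h k.+1 w * cos (s w) * z w ^+ 2.
have pX1 : past_measurable eps (t + k%:Z) X1.
  apply: pastM; last exact: pz.
  by apply: pastM => //; exact: past_comp (@measurable_sinR R) ps.
have pX2 : past_measurable eps (t + k%:Z) X2.
  apply: pastM; last exact: past_comp msqr (@pz k).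
  by apply: pastM => //; exact: past_comp (@measurable_cosR R) ps.
have iX1 : L1 P X1.
  apply: (L1_bmul (X := fun w => h k.+1 w * sin (s w))); last exact: L2_L1 (zL2 k).
    exact: measurable_funM.
  by move=> w; rewrite normrM -[leRHS]mulr1; apply: ler_pM.
have hcn w : `|h k.+1 w * cos (s w)| <= 1.
  by rewrite normrM -[leRHS]mulr1; apply: ler_pM.
have iX2 : L1 P X2.
  apply: (L1_bmul (X := fun w => h k.+1 w * cos (s w))); last exact: iz2.
    exact: measurable_funM.
  exact: hcn.
have ie : L2 P e := eps_L2 eiid eL2 _.
have iX1e := L1_past_mul eiid pX1 mid iX1 (L2_L1 ie).
have iX2e := L1_past_mul eiid pX2 msqr iX2 ie.2.
have E1 : EE P (fun w => X1 w * e w) = 0.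
  by rewrite (EE_past_mul eiid pX1 mid iX1 (L2_L1 ie)) (EE_eps eiid eL2 e0) mulr0.
have E2 : EE P (fun w => X2 w * e w ^+ 2) = s2 * EE P X2.
  rewrite (EE_past_mul eiid pX2 msqr iX2 ie.2) mulrC; congr (_ * _).
  exact: (EE_eps_sqr eiid eL2).
have mze : measurable_fun setT (fun w => z w * e w) := L2_meas (ze_L2 k).
have mr : measurable_fun setT r.
  apply: measurable_funB.
    apply: measurableT_comp; first exact: measurable_cosR.
    exact: measurable_funD.
  apply: measurable_funB.
    apply: measurable_funB => //; exact: measurable_funM.
  apply: measurable_funM => //; apply: measurable_funM => //.
  exact: measurable_funX.
have rB w : `|r w| <= 3 * cubic_cut (z w * e w) by exact: cos_taylor.
have ir : L1 P r by apply: (L1_le mr (L1Z 3 (L1_cubic (ze_L2 k)))).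
have ihr : L1 P (fun w => h k.+1 w * r w) by exact: L1_bmul.
have bnd (X : Omega -> R) : measurable_fun setT X -> (forall w, `|X w| <= 1) ->
    L1 P X by move=> mX; exact: L1_bounded mX.
pose q w := cos (s w) * (h k.+1 w * (1 - v * z w ^+ 2) - h k w).
have ihc : L1 P (fun w => h k.+1 w * cos (s w)) by apply: bnd => //; exact: measurable_funM.
have ih0c : L1 P (fun w => h k w * cos (s w)).
  apply: bnd; first exact: measurable_funM.
  by move=> w; rewrite normrM -[leRHS]mulr1; apply: ler_pM.
have iq : L1 P q.
  apply: L1_ext (L1B (L1B ihc (L1Z v iX2)) ih0c) => w; rewrite /q /X2; ring.
have ihS : L1 P (fun w => h k.+1 w * cos (S k.+1 w + c)).
  have mS1 : measurable_fun setT (S k.+1) := L2_meas (L2_mart_sum eiid mid eL2 pz zL2 _).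
  apply: bnd.
    apply: measurable_funM => //; apply: measurableT_comp; first exact: measurable_cosR.
    exact: measurable_funD.
  by move=> w; rewrite normrM -[leRHS]mulr1; apply: ler_pM.
have AE : A k.+1 - A k = EE P (fun w => h k.+1 w * r w) + EE P q.
  (* The centred part of the expansion: the linear term, and the quadratic term with e^2 - s2 in
     place of e^2. *)
  have i3 : L1 P (fun w => (-1) * (X1 w * e w) + (-1/2) * (X2 w * e w ^+ 2 - s2 * X2 w)).
    apply: L1D; first exact: L1Z.
    by apply: L1Z; apply: L1B => //; exact: L1Z.
  have E3 : EE P (fun w => (-1) * (X1 w * e w) + (-1/2) * (X2 w * e w ^+ 2 - s2 * X2 w)) = 0.
    rewrite EED; [|exact: L1Z|by apply: L1Z; apply: L1B => //; exact: L1Z].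
    rewrite EEZ// E1 mulr0 add0r EEZ; last by apply: L1B => //; exact: L1Z.
    by rewrite EEB//; [rewrite E2 EEZ// subrr mulr0|exact: L1Z].
  rewrite /A -EEB// -EED// -[RHS]addr0 -E3 -EED//; last exact: L1D.
  apply: EE_ext => w; rewrite /S /mart_sum big_ord_recr /= -/(mart_sum eps id t zeta k w) -/S.
  rewrite /q /r /X1 /X2 /s /z /e.
  have -> : S k w + zeta k w * eps (t + k%:Z) w + c =
    S k w + c + zeta k w * eps (t + k%:Z) w by ring.
  by rewrite /v; field.
rewrite AE; apply: le_trans (ler_normD _ _) _; rewrite /lindeberg_term -addrA.
apply: lerD.
  apply: le_trans (EE_abs ihr) _; rewrite -EEZ; last exact: L1_cubic.
  apply: EE_le; [exact: L1_norm|exact/L1Z/L1_cubic|].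
  move=> w; rewrite normrM; apply: le_trans (rB w); rewrite ler_piMl//.
apply: le_trans (EE_abs iq) _.
have izD : L1 P (fun w => zeta k w ^+ 2 + D k.+1 w - D k w).
  by apply: L1B => //; exact: L1D.
rewrite -EEZ; last exact: L1_cubic.
rewrite -EEZ// -EED; [|exact/L1Z/L1_cubic|exact: L1Z].
apply: EE_le; [exact: L1_norm|by apply: L1D; [exact/L1Z/L1_cubic|exact: L1Z]|].
move=> w; rewrite /q normrM.
apply: (@le_trans _ _ `|h k.+1 w * (1 - v * z w ^+ 2) - h k w|).
  by rewrite ler_piMl.
have y0 : 0 <= v * z w ^+ 2 by rewrite mulr_ge0 ?sqr_ge0.
have -> : h k.+1 w * (1 - v * z w ^+ 2) - h k w =
    h k.+1 w * (1 - v * z w ^+ 2 - expR (- (v * z w ^+ 2))) +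
    (h k.+1 w * expR (- (v * z w ^+ 2)) - h k w) by ring.
apply: le_trans (ler_normD _ _) _; apply: lerD.
  rewrite normrM; apply: le_trans (expRN_taylor_sqr (z w) v0).
  by rewrite ler_piMl.
rewrite /h -expRD -opprD -mulrDr.
have VS : V k.+1 w = V k w + z w ^+ 2 by rewrite /V big_ord_recr.
(* An equality unless the cut at 0 acts. The defect is the second term of the bound, and it
   telescopes in k. *)
have DD : D k w <= D k.+1 w + z w ^+ 2.
  rewrite /D ge_max; apply/andP; split.
    by rewrite -lerBlDr le_max; apply/orP; left; rewrite VS; lra.
  by rewrite addr_ge0 ?sqr_ge0// le_max lexx orbT.
apply: le_trans (expRN_lip _ _) _.
- by rewrite mulr_ge0// addr_ge0 ?sqr_ge0 ?D0.
- by rewrite mulr_ge0// D0.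
rewrite -mulrBr normrM (ger0_norm v0) ler_wpM2l// ger0_norm; last by lra.
rewrite le_eqVlt; apply/orP; left; apply/eqP; rewrite /z; ring.
Qed.

(* Telescoping E[cos (S_k + c) h_k], where h_k = exp (- v (tau - V_k)^+)
   compensates in advance for the conditional variance still to come. *)
Lemma mart_clt K :
  `|EE P (fun w => cos (S K w + c)) - expR (- (v * tau)) * cos c| <=
  \sum_(k < K) lindeberg_term k + v * EE P (fun w => `|V K w - tau|).
Proof.
have mS k : measurable_fun setT (S k) := L2_meas (L2_mart_sum eiid mid eL2 pz zL2 k).
have mcS k : measurable_fun setT (fun w => cos (S k w + c)).
  apply: measurableT_comp; first exact: measurable_cosR.
  exact: measurable_funD.
have iS k : L1 P (fun w => cos (S k w + c)).
  by apply: (L1_bounded P (B := 1)).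
have mh k : measurable_fun setT (h k).
  by apply: (past_measurableW eiid (n := t + k%:Z)); apply: ph; lia.
have ihS k : L1 P (fun w => h k w * cos (S k w + c)).
  apply: (L1_bounded P (B := 1)); first exact: measurable_funM.
  move=> w; rewrite normrM -[leRHS]mulr1; apply: ler_pM => //.
  by have /andP[? ?] := h01 k w; rewrite ger0_norm.
have A0 : A 0 = expR (- (v * tau)) * cos c.
  rewrite /A -[RHS](EE_cst P); apply: EE_ext => w.
  rewrite /h /D /V /S /mart_sum !big_ord0 subr0 add0r.
  by congr (expR (- (_ * _)) * _); apply/max_idPl.
have AK : `|A K - A 0| <= \sum_(k < K) lindeberg_term k +
    v * EE P (fun w => V K w + D K w - tau).
  elim: K => [|K IH].
    rewrite subrr normr0 big_ord0 add0r mulr_ge0// EE_ge0// => w.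
    by rewrite /V big_ord0 add0r subr_ge0 /D le_max /V big_ord0 subr0 lexx.
  have -> : A K.+1 - A 0 = (A K - A 0) + (A K.+1 - A K) by ring.
  apply: le_trans (ler_normD _ _) _.
  apply: le_trans (lerD IH (clt_step K)) _.
  rewrite big_ord_recr /= addrACA lerD2l -mulrDr ler_wpM2l// -EED.
  - apply: EE_le.
    + by apply: L1D; apply: L1B => //; [exact: L1D|exact: L1_cst|exact: L1D].
    + by apply: L1B; [exact: L1D|exact: L1_cst].
    + move=> w; have -> : V K.+1 w = V K w + zeta K w ^+ 2.
        by rewrite /V big_ord_recr.
      by rewrite le_eqVlt; apply/orP; left; apply/eqP; ring.
  - by apply: L1B; [exact: L1D|exact: L1_cst].
  - by apply: L1B => //; exact: L1D.
have AKE : `|EE P (fun w => cos (S K w + c)) - A K| <= v * EE P (D K).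
  rewrite /A -EEB//; apply: le_trans (EE_abs _) _; first exact: L1B.
  rewrite -EEZ//; apply: EE_le; [exact/L1_norm/L1B|exact: L1Z|].
  move=> w.
  have -> : cos (S K w + c) - h K w * cos (S K w + c) =
    (1 - h K w) * cos (S K w + c) by ring.
  rewrite normrM; apply: (@le_trans _ _ `|1 - h K w|); first by rewrite ler_piMr.
  have := expRN_lip (lexx 0) (mulr_ge0 v0 (D0 K w)).
  by rewrite oppr0 expR0 sub0r normrN [leRHS]ger0_norm// mulr_ge0.
rewrite -A0.
have -> : EE P (fun w => cos (S K w + c)) - A 0 =
  (A K - A 0) + (EE P (fun w => cos (S K w + c)) - A K) by ring.
apply: le_trans (ler_normD _ _) _; apply: le_trans (lerD AK AKE) _.
rewrite -addrA lerD2l -mulrDr ler_wpM2l// -EED//; last first.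
  by apply: L1B; [exact: L1D|exact: L1_cst].
apply: EE_le.
- by apply: L1D => //; apply: L1B; [exact: L1D|exact: L1_cst].
- by apply: L1_norm; apply: L1B => //; exact: L1_cst.
(* The telescoped defect V + D - tau and the final cost D of replacing h_K by 1 add up to V + 2 D -
   tau = |V - tau|, since D = (tau - V)^+. *)
move=> w; rewrite /D; have [h1|h1] := leP (tau - V K w) 0.
  by rewrite ger0_norm; lra.
by rewrite ler0_norm; lra.
Qed.

End MartingaleCLT.

(** * The Lindeberg condition for moving averages *)

Section ScaledCut.
Context (R : realType).
Implicit Types x y k a : R.

(** [cubic_cut] of k x without its factor k^2. With k = 1 / sqrt K, the sum of K Lindeberg terms
    becomes an average of such quantities, which vanish as k tends to 0. *)
Definition scaled_cut k x := x ^+ 2 * Num.min 1 (k * `|x|).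

Lemma scaled_cut_ge0 k x : 0 <= k -> 0 <= scaled_cut k x.
Proof. by move=> k0; rewrite mulr_ge0 ?sqr_ge0// le_min ler01 mulr_ge0. Qed.

Lemma scaled_cut_le k x : scaled_cut k x <= x ^+ 2.
Proof. by rewrite /scaled_cut ler_piMr ?sqr_ge0// ge_min lexx. Qed.

Lemma cubic_cut_scale k x : 0 <= k ->
  cubic_cut (k * x) = k ^+ 2 * scaled_cut k x.
Proof.
by move=> k0; rewrite /cubic_cut /scaled_cut normrM (ger0_norm k0); ring.
Qed.

Lemma scaled_cut_mono k k' x : k <= k' -> scaled_cut k x <= scaled_cut k' x.
Proof.
move=> kk; rewrite /scaled_cut ler_wpM2l ?sqr_ge0//.
rewrite le_min; apply/andP; split; first by rewrite ge_min lexx.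
by rewrite ge_min; apply/orP; right; rewrite ler_wpM2r.
Qed.

Lemma scaled_cut_homo k x y : 0 <= k -> `|x| <= `|y| ->
  scaled_cut k x <= scaled_cut k y.
Proof.
move=> k0 xy; rewrite /scaled_cut; apply: ler_pM.
- exact: sqr_ge0.
- by rewrite le_min ler01 mulr_ge0.
- by rewrite -real_normK ?num_real// -[leRHS]real_normK ?num_real// lerXn2r ?nnegrE.
- rewrite le_min; apply/andP; split; first by rewrite ge_min lexx.
  by rewrite ge_min; apply/orP; right; rewrite ler_wpM2l.
Qed.

Lemma scaled_cutZ k a x : 0 <= k ->
  scaled_cut k (a * x) <= a ^+ 2 * (1 + `|a|) * scaled_cut k x.
Proof.
move=> k0; rewrite /scaled_cut exprMn normrM.
have a0 := normr_ge0 a.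
have -> : a ^+ 2 * (1 + `|a|) * (x ^+ 2 * Num.min 1 (k * `|x|)) =
  a ^+ 2 * x ^+ 2 * ((1 + `|a|) * Num.min 1 (k * `|x|)) by ring.
rewrite ler_wpM2l ?(mulr_ge0 (sqr_ge0 a) (sqr_ge0 x))//.
have y0 : 0 <= k * `|x| by rewrite mulr_ge0.
have -> : k * (`|a| * `|x|) = `|a| * (k * `|x|) by ring.
move: (k * `|x|) y0 => y y0.
have [y1|y1] := leP 1 y.
  by rewrite ge_min; apply/orP; left; lra.
by rewrite ge_min; apply/orP; right; nra.
Qed.

(** x + y is at most twice the larger of the two in absolute value; 12 is the factor a^2 (1 + |a|)
    of [scaled_cutZ] at a = 2. *)
Lemma scaled_cutD k x y : 0 <= k ->
  scaled_cut k (x + y) <= 12 * (scaled_cut k x + scaled_cut k y).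
Proof.
move=> k0.
have gx := scaled_cut_ge0 x k0; have gy := scaled_cut_ge0 y k0.
have hx := @scaled_cutZ k 2 x k0; have hy := @scaled_cutZ k 2 y k0.
rewrite ger0_norm// in hx hy.
have [xy|/ltW xy] := leP `|x| `|y|.
  have : scaled_cut k (x + y) <= scaled_cut k (2 * y).
    apply: scaled_cut_homo => //; rewrite normrM (ger0_norm (ler0n _ 2)).
    by apply: le_trans (ler_normD _ _) _; lra.
  lra.
have : scaled_cut k (x + y) <= scaled_cut k (2 * x).
  apply: scaled_cut_homo => //; rewrite normrM (ger0_norm (ler0n _ 2)).
  by apply: le_trans (ler_normD _ _) _; lra.
lra.
Qed.

Lemma measurable_scaled_cut k : measurable_fun setT (scaled_cut k).
Proof.
apply: measurable_funM; first exact: measurable_funX.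
apply: measurable_minr; first exact: measurable_cst.
by apply: measurable_funM => //; exact: normr_measurable.
Qed.

End ScaledCut.

Section BlockCLT.
Context d (Omega : measurableType d) (R : realType) (P : probability Omega R).
Variable eps : int -> Omega -> R.
Hypothesis eiid : iid P eps.
Hypothesis eL2 : L2 P (eps 0).
Hypothesis e0 : EE P (eps 0) = 0.
Let s2 := EE P (fun w => eps 0 w ^+ 2).

(** Uniform integrability of X_n^2 in the shape used after rescaling. Its stability under sums and
    multiples reduces moving averages to a single noise variable. *)
Definition unif_small (X : int -> Omega -> R) :=
  (forall n, L2 P (X n)) /\ forall eta : R, 0 < eta -> exists2 k0 : R, 0 < k0 &
    forall k, 0 <= k <= k0 -> forall n, EE P (fun w => scaled_cut k (X n w)) <= eta.

Lemma L1_scaled_cut k X : 0 <= k -> L2 P X -> L1 P (fun w => scaled_cut k (X w)).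
Proof.
move=> k0 [mX iX]; apply: (L1_le _ iX).
  by apply: measurableT_comp => //; exact: measurable_scaled_cut.
by move=> w; rewrite ger0_norm ?scaled_cut_ge0// scaled_cut_le.
Qed.

Lemma unif_smallD X Y : unif_small X -> unif_small Y ->
  unif_small (fun n w => X n w + Y n w).
Proof.
move=> [X2 hX] [Y2 hY]; split; first by move=> n; exact: L2D.
move=> eta eta0; have e24 : 0 < eta / 24 by lra.
have [k1 k10 h1] := hX _ e24; have [k2 k20 h2] := hY _ e24.
exists (Num.min k1 k2); first by rewrite lt_min k10.
move=> k; rewrite le_min => /and3P[kge kk1 kk2] n.
have := h1 k _ n; rewrite kge kk1 => /(_ isT) ?.
have := h2 k _ n; rewrite kge kk2 => /(_ isT) ?.
apply: (@le_trans _ _ (12 * (EE P (fun w => scaled_cut k (X n w)) +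
   EE P (fun w => scaled_cut k (Y n w))))); last by lra.
have iX := L1_scaled_cut kge (X2 n); have iY := L1_scaled_cut kge (Y2 n).
rewrite -EED// -EEZ; last exact: L1D.
apply: EE_le; [apply: L1_scaled_cut => //; exact: L2D|exact/L1Z/L1D|].
by move=> w; exact: scaled_cutD.
Qed.

Lemma unif_smallZ a X : unif_small X -> unif_small (fun n w => a * X n w).
Proof.
move=> [X2 hX]; split; first by move=> n; exact: L2Z.
move=> eta eta0; pose C := a ^+ 2 * (1 + `|a|) + 1.
have C0 : 0 < C by rewrite ltr_wpDl// mulr_ge0 ?sqr_ge0// addr_ge0.
have [k1 k10 h1] := hX _ (divr_gt0 eta0 C0).
exists k1 => // k /andP[kge kk1] n.
have := h1 k _ n; rewrite kge kk1 => /(_ isT); rewrite ler_pdivlMr// mulrC.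
apply: le_trans; have iX := L1_scaled_cut kge (X2 n).
rewrite -EEZ//; apply: EE_le; [apply: L1_scaled_cut => //; exact: L2Z|exact: L1Z|].
move=> w; apply: le_trans (scaled_cutZ a (X n w) kge) _.
by rewrite ler_wpM2r ?scaled_cut_ge0// lerDl.
Qed.

Lemma unif_small_cst c : unif_small (fun _ _ => c).
Proof.
split; first by move=> n; exact: L2_cst.
move=> eta eta0; have C0 : 0 < `|c| ^+ 3 + 1 by rewrite ltr_wpDl// exprn_ge0.
exists (eta / (`|c| ^+ 3 + 1)); first exact: divr_gt0.
move=> k /andP[k0 kk] n; rewrite EE_cst /scaled_cut -(real_normK (num_real c)).
apply: (@le_trans _ _ (`|c| ^+ 2 * (k * `|c|))).
  by rewrite ler_wpM2l ?exprn_ge0// ge_min lexx orbT.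
move: kk; rewrite ler_pdivlMr//.
have -> : `|c| ^+ 2 * (k * `|c|) = k * `|c| ^+ 3 by ring.
lra.
Qed.

Lemma unif_small_eps s : unif_small (fun n => eps (n - s)).
Proof.
split; first by move=> n; exact: (eps_L2 eiid eL2).
move=> eta eta0.
have cv : EE P (fun w => scaled_cut j.+1%:R^-1 (eps 0 w)) @[j --> \oo] --> 0.
  rewrite -[X in _ --> X](EE_cst P 0).
  apply: (EE_dct (Y := fun w => eps 0 w ^+ 2)) => //.
  - move=> j; apply: measurableT_comp; first exact: measurable_scaled_cut.
    exact: (eps_meas eiid).
  - exact: eL2.2.
  - by move=> j w; rewrite ger0_norm ?scaled_cut_ge0 ?scaled_cut_le ?invr_ge0.
  - move=> w; have c1 : (j.+1%:R^-1 : R) @[j --> \oo] --> 0 by exact: cvg_harmonic.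
    apply: (@squeeze_cvgr _ _ _ _ (fun=> 0)
      (fun j => eps 0 w ^+ 2 * (j.+1%:R^-1 * `|eps 0 w|))).
    + apply: nearW => j; rewrite scaled_cut_ge0 ?invr_ge0//=.
      by rewrite ler_wpM2l ?sqr_ge0// ge_min lexx orbT.
    + exact: cvg_cst.
    + rewrite -(mulr0 (eps 0 w ^+ 2)) -(mul0r `|eps 0 w|).
      by apply: cvgMr; apply: cvgMl.
have /cvgrPdist_le /(_ eta eta0) [J _ /(_ J (leqnn J)) /= hJ] := cv.
exists J.+1%:R^-1; first by rewrite invr_gt0.
move=> k /andP[k0 kJ] n.
have mc := @measurable_scaled_cut R k.
have ic : L1 P (scaled_cut k \o eps (n - s)).
  by apply: L1_scaled_cut => //; exact: (eps_L2 eiid eL2).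
rewrite (EE_eps_law eiid 0 mc ic).
apply: (@le_trans _ _ (EE P (fun w => scaled_cut J.+1%:R^-1 (eps 0 w)))).
  apply: EE_le; [exact: L1_scaled_cut|by apply: L1_scaled_cut => //; rewrite invr_ge0|].
  by move=> w; exact: scaled_cut_mono.
by apply: le_trans hJ; rewrite sub0r normrN ler_norm.
Qed.

Lemma unif_small_ma c alpha m : unif_small (ma eps c alpha m).
Proof.
elim: m => [|m IH].
  have := unif_small_cst c; congr unif_small; apply/funext => n; apply/funext => w.
  by rewrite /ma big_ord0 addr0.
have := unif_smallD IH (unif_smallZ (alpha m) (unif_small_eps (1 + m%:Z))).
congr unif_small; apply/funext => n; apply/funext => w.
by rewrite ma_recr; congr (_ + _ * eps _ w); lia.
Qed.

Lemma tail_sqr_cvg0 eta : 0 < eta ->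
  exists2 B : R, 1 <= B & EE P (fun w => tail_sqr B (eps 0 w)) <= eta.
Proof.
move=> eta0.
have cv : EE P (fun w => tail_sqr (j%:R : R) (eps 0 w)) @[j --> \oo] --> 0.
  rewrite -[X in _ --> X](EE_cst P 0).
  apply: (EE_dct (Y := fun w => eps 0 w ^+ 2)) => //.
  - move=> j; apply: measurableT_comp; first exact: measurable_tail_sqr.
    exact: (eps_meas eiid).
  - exact: eL2.2.
  - by move=> j w; rewrite ger0_norm ?tail_sqr_ge0 ?tail_sqr_le.
  - move=> w; apply: cvg_near_cst.
    exists (Num.bound `|eps 0 w|) => // j /= hj.
    rewrite /tail_sqr ltNge (le_trans (ltW (archi_boundP (normr_ge0 _))))//.
    by rewrite ler_nat.
have /cvgrPdist_le /(_ eta eta0) [J _ /(_ J.+1 (leqnSn J)) /= hJ] := cv.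
exists J.+1%:R; first by rewrite ler1n.
by apply: le_trans hJ; rewrite sub0r normrN ler_norm.
Qed.

Lemma lindeberg_term_le (t : int) (zeta : nat -> Omega -> R) B k :
  past_measurable eps (t + k%:Z) (zeta k) -> L2 P (zeta k) -> 1 <= B ->
  lindeberg_term P eps t zeta k <=
    3 * EE P (fun w => tail_sqr B (eps 0 w)) * EE P (fun w => zeta k w ^+ 2) +
    (3 * B ^+ 3 + (s2 / 2 + (s2 / 2) ^+ 2)) * EE P (fun w => cubic_cut (zeta k w)).
Proof.
move=> pz zL2 B1; rewrite /lindeberg_term -/s2 [X in _ <= _ + X]mulrDl addrA lerD2r.
have mid : measurable_fun setT (id : R -> R) by exact: measurable_id.
have zeL2 := L2_mart_step eiid mid eL2 pz zL2.
have icc (X : Omega -> R) : L2 P X -> L1 P (fun w => cubic_cut (X w)).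
  move=> X2; apply: L1_ext (L1_scaled_cut ler01 X2) => w.
  by rewrite -[X w in RHS]mul1r cubic_cut_scale// expr1n mul1r.
have mt := measurable_tail_sqr B.
have msqr : measurable_fun setT (fun x : R => x ^+ 2) by exact: measurable_funX.
have it : L1 P (tail_sqr B \o eps (t + k%:Z)).
  apply: (L1_le _ (eps_L2 eiid eL2 (t + k%:Z)).2).
    by apply: measurableT_comp => //; exact: (eps_meas eiid).
  by move=> w; rewrite ger0_norm ?tail_sqr_ge0 ?tail_sqr_le.
have pz2 := past_comp msqr pz.
have izt := L1_past_mul eiid pz2 mt zL2.2 it.
have -> : 3 * EE P (fun w => tail_sqr B (eps 0 w)) * EE P (fun w => zeta k w ^+ 2) =
    3 * EE P (fun w => zeta k w ^+ 2 * tail_sqr B (eps (t + k%:Z) w)).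
  rewrite (EE_past_mul eiid pz2 mt zL2.2 it) (EE_eps_law eiid 0 mt it).
  by rewrite -mulrA [X in 3 * X]mulrC.
rewrite -[X in _ <= _ + X]mulrA -mulrDr ler_wpM2l//.
rewrite -EEZ; last exact: icc.
rewrite -EED//; last exact/L1Z/icc.
apply: EE_le; [exact: icc|by apply: L1D => //; exact/L1Z/icc|].
by move=> w; exact: cubic_cut_mul_le.
Qed.

Variables (c1 c2 : R) (alpha1 alpha2 : nat -> R) (m : nat).
Let Z1 := ma eps c1 alpha1 m.
Let Z2 := ma eps c2 alpha2 m.
Let q1 := ma_var P eps c1 alpha1 m.
Let q2 := ma_var P eps c2 alpha2 m.

Definition block_sum (Z : int -> Omega -> R) (K : nat) (t : int) w :=
  (Num.sqrt K%:R)^-1 * \sum_(k < K) Z (t + k%:Z) w * eps (t + k%:Z) w.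

(** [mart_clt] for the concatenation of the two blocks with tau = q1 + q2: the conditional variance
    is a sum of two averages, each governed by the law of large numbers uniformly in its
    position. *)
Lemma block_clt c eta : 0 < eta -> exists K0 : nat, forall K1 K2 g : nat,
  (K0 < K1)%N -> (K0 < K2)%N -> forall t : int,
  `|EE P (fun w => cos (block_sum Z1 K1 t w +
       block_sum Z2 K2 (t + K1%:Z + g%:Z) w + c)) -
    expR (- (s2 / 2 * (q1 + q2))) * cos c| <= eta.
Proof.
move=> eta0.
have msqr : measurable_fun setT (fun x : R => x ^+ 2) by exact: measurable_funX.
have s20 : 0 <= s2 by apply: EE_ge0 => w; exact: sqr_ge0.
have q10 : 0 <= q1.
  by rewrite addr_ge0 ?sqr_ge0// mulr_ge0// sumr_ge0// => l _; exact: sqr_ge0.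
have q20 : 0 <= q2.
  by rewrite addr_ge0 ?sqr_ge0// mulr_ge0// sumr_ge0// => l _; exact: sqr_ge0.
pose Q := q1 + q2 + 1; have Q0 : 0 < Q by rewrite ltr_wpDl// addr_ge0.
(* A third of eta goes to each of three errors: large noise, 3 T Q with T at most eta / (9 Q); small
   increments, C times eta / (6 C) for each block; conditional variance, s2 / 2 times eta / (3 (s2 +
   1)) for each block. *)
have eQ : 0 < eta / (9 * Q) by rewrite divr_gt0// mulr_gt0.
have [B B1 TB] := tail_sqr_cvg0 eQ.
pose C := 3 * B ^+ 3 + (s2 / 2 + (s2 / 2) ^+ 2).
have B3 : 0 < B ^+ 3 by rewrite exprn_gt0//; lra.
have C0 : 0 < C.
  by have := sqr_ge0 (s2 / 2); rewrite /C; lra.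
have eC : 0 < eta / (6 * C) by rewrite divr_gt0// mulr_gt0.
have [Z12 /(_ _ eC) [k1 k10 hk1]] := unif_small_ma c1 alpha1 m.
have [Z22 /(_ _ eC) [k2 k20 hk2]] := unif_small_ma c2 alpha2 m.
have es : 0 < eta / (3 * (s2 + 1)) by rewrite divr_gt0// mulr_gt0// ltr_wpDl.
have [iZ1 /(_ _ es) [L1' hL1]] := LLN_ma_sqr eiid eL2 e0 c1 alpha1 m.
have [iZ2 /(_ _ es) [L2' hL2]] := LLN_ma_sqr eiid eL2 e0 c2 alpha2 m.
have [K0 hK0] : exists K0 : nat, forall K, (K0 < K)%N ->
    [/\ (0 < K)%N, (L1' < K)%N, (L2' < K)%N & (Num.sqrt (K%:R : R))^-1 <= Num.min k1 k2].
  pose kk := Num.min k1 k2.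
  have kk0 : 0 < kk by rewrite lt_min k10.
  exists (maxn (maxn L1' L2') (Num.bound (kk^-1 ^+ 2))) => K.
  rewrite !gtn_max => /andP[/andP[a b] e].
  have K0 : (0 < K)%N := leq_ltn_trans (leq0n _) a.
  split => //.
  rewrite invf_ple ?posrE ?sqrtr_gt0 ?ltr0n//.
  rewrite -[leLHS](@ger0_norm _ kk^-1) ?invr_ge0 ?(ltW kk0)// -sqrtr_sqr.
  rewrite ler_wsqrtr//; apply: (le_trans (ltW (archi_boundP (sqr_ge0 _)))).
  by rewrite ler_nat ltnW.
exists K0 => K1 K2 g /hK0 [K1p LK1 _ rk1] /hK0 [K2p _ LK2 rk2] t.
pose r1 := (Num.sqrt (K1%:R : R))^-1; pose r2 := (Num.sqrt (K2%:R : R))^-1.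
have r10 : 0 <= r1 by rewrite invr_ge0 sqrtr_ge0.
have r20 : 0 <= r2 by rewrite invr_ge0 sqrtr_ge0.
have r1sq : r1 ^+ 2 = K1%:R^-1 by rewrite exprVn sqr_sqrtr.
have r2sq : r2 ^+ 2 = K2%:R^-1 by rewrite exprVn sqr_sqrtr.
(* A single weight sequence for both blocks, zero on the g times between them. *)
pose zeta (k : nat) : Omega -> R := if (k < K1)%N then (fun w => r1 * Z1 (t + k%:Z) w) else
  if (k < K1 + g)%N then (fun=> 0) else (fun w => r2 * Z2 (t + k%:Z) w).
have pz k : past_measurable eps (t + k%:Z) (zeta k).
  rewrite /zeta; case: ifP => _; [|case: ifP => _].
  - by apply: pastM; [exact: past_cst|exact: past_ma].
  - exact: past_cst.
  - by apply: pastM; [exact: past_cst|exact: past_ma].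
have zL2 k : L2 P (zeta k).
  rewrite /zeta; case: ifP => _; [|case: ifP => _].
  - exact: L2Z.
  - exact: L2_cst.
  - exact: L2Z.
have splitS (F : nat -> (Omega -> R) -> R) : (forall k, F k (fun=> 0) = 0) ->
   \sum_(k < K1 + g + K2) F k (zeta k) =
   \sum_(k < K1) F k (fun w => r1 * Z1 (t + k%:Z) w) +
   \sum_(k < K2) F (K1 + g + k)%N (fun w => r2 * Z2 (t + K1%:Z + g%:Z + k%:Z) w).
  move=> F0; rewrite !big_split_ord /= [X in _ + X + _]big1 ?addr0.
    congr (_ + _); apply: eq_bigr => k _.
      by rewrite /zeta ltn_ord.
    have -> : zeta (K1 + g + k)%N = fun w => r2 * Z2 (t + (K1 + g + k)%N%:Z) w.
      by rewrite /zeta ltnNge -addnA leq_addr /= addnA ltnNge leq_addr.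
    by congr (F _ _); apply/funext => w; congr (_ * Z2 _ w); rewrite !PoszD !addrA.
  move=> k _; have -> // : zeta (K1 + k)%N = fun=> 0.
  by rewrite /zeta ltnNge leq_addr /= ltn_add2l ltn_ord.
have SE w : mart_sum eps id t zeta (K1 + g + K2) w =
    block_sum Z1 K1 t w + block_sum Z2 K2 (t + K1%:Z + g%:Z) w.
  rewrite /mart_sum (splitS (fun k X => X w * id (eps (t + k%:Z) w))); last first.
    by move=> k; rewrite mul0r.
  rewrite /block_sum !mulr_sumr; congr (_ + _); apply: eq_bigr => k _.
    by rewrite mulrA.
  by rewrite mulrA; congr (_ * eps _ w); rewrite !PoszD !addrA.
have VE w : \sum_(k < K1 + g + K2) zeta k w ^+ 2 =
    K1%:R^-1 * (\sum_(k < K1) Z1 (t + k%:Z) w ^+ 2) +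
    K2%:R^-1 * (\sum_(k < K2) Z2 (t + K1%:Z + g%:Z + k%:Z) w ^+ 2).
  rewrite (splitS (fun k X => X w ^+ 2)); last by move=> k; rewrite expr0n.
  by rewrite !mulr_sumr; congr (_ + _); apply: eq_bigr => k _; rewrite exprMn ?r1sq ?r2sq.
have := mart_clt eiid eL2 e0 pz zL2 c (addr_ge0 q10 q20) (K1 + g + K2).
rewrite (EE_ext P (Y := fun w => cos (block_sum Z1 K1 t w +
       block_sum Z2 K2 (t + K1%:Z + g%:Z) w + c))); last by move=> w; rewrite SE.
move=> h; apply: (le_trans h).
have -> : eta = eta / 3 + eta / 3 + eta / 3 by field.
apply: lerD.
- pose T := EE P (fun w => tail_sqr B (eps 0 w)).
  have T0 : 0 <= T by apply: EE_ge0 => w; exact: tail_sqr_ge0.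
  apply: (@le_trans _ _ (\sum_(k < K1 + g + K2)
      (3 * T * EE P (fun w => zeta k w ^+ 2) + C * EE P (fun w => cubic_cut (zeta k w))))).
    by apply: ler_sum => k _; exact: lindeberg_term_le.
  rewrite big_split /= -!mulr_sumr; apply: lerD.
    rewrite (splitS (fun k X => EE P (fun w => X w ^+ 2))); last first.
      by move=> k; rewrite -[RHS](EE_cst P); apply: EE_ext => w; rewrite expr0n.
    have -> : \sum_(k < K1) EE P (fun w => (r1 * Z1 (t + k%:Z) w) ^+ 2) = q1.
      have hE k : EE P (fun w => (r1 * Z1 (t + k%:Z) w) ^+ 2) = K1%:R^-1 * q1.
        rewrite -r1sq /q1 -(EE_ma_sqr eiid eL2 e0 c1 alpha1 m (t + k%:Z)) -EEZ.
          by apply: EE_ext => w; rewrite exprMn.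
        exact: (Z12 _).2.
      under eq_bigr do rewrite hE.
      rewrite sumr_const card_ord -(mulr_natl (K1%:R^-1 * q1)) mulrA divff ?mul1r//.
      by rewrite pnatr_eq0 -lt0n.
    have -> : \sum_(k < K2) EE P (fun w => (r2 * Z2 (t + K1%:Z + g%:Z + k%:Z) w) ^+ 2) = q2.
      have hE k : EE P (fun w => (r2 * Z2 (t + K1%:Z + g%:Z + k%:Z) w) ^+ 2) = K2%:R^-1 * q2.
        rewrite -r2sq /q2 -(EE_ma_sqr eiid eL2 e0 c2 alpha2 m (t + K1%:Z + g%:Z + k%:Z)) -EEZ.
          by apply: EE_ext => w; rewrite exprMn.
        exact: (Z22 _).2.
      under eq_bigr do rewrite hE.
      rewrite sumr_const card_ord -(mulr_natl (K2%:R^-1 * q2)) mulrA divff ?mul1r//.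
      by rewrite pnatr_eq0 -lt0n.
    apply: (@le_trans _ _ (3 * T * Q)).
      by rewrite ler_wpM2l ?mulr_ge0//; rewrite /Q; lra.
    have : 3 * T <= 3 * (eta / (9 * Q)) by rewrite ler_wpM2l.
    move=> /(ler_wpM2r (ltW Q0)) /le_trans; apply.
    by rewrite le_eqVlt; apply/orP; left; apply/eqP; field; rewrite gt_eqF.
  rewrite (splitS (fun k X => EE P (fun w => cubic_cut (X w)))); last first.
    move=> k; rewrite -[RHS](EE_cst P); apply: EE_ext => w.
    by rewrite /cubic_cut expr0n mul0r.
  have hb (K : nat) (r : R) (Z : int -> Omega -> R) (s : int) : (0 < K)%N -> 0 <= r ->
      r ^+ 2 = K%:R^-1 -> (forall n, L2 P (Z n)) ->
      (forall n, EE P (fun w => scaled_cut r (Z n w)) <= eta / (6 * C)) ->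
      \sum_(k < K) EE P (fun w => cubic_cut (r * Z (s + k%:Z) w)) <= eta / (6 * C).
    move=> Kp r0 rsq Z2' hZ.
    apply: (@le_trans _ _ (\sum_(k < K) K%:R^-1 * (eta / (6 * C)))).
      apply: ler_sum => k _; rewrite -rsq.
      rewrite (EE_ext P (Y := fun w => r ^+ 2 * scaled_cut r (Z (s + k%:Z) w))); last first.
        by move=> w; rewrite cubic_cut_scale.
      by rewrite EEZ; [rewrite ler_wpM2l ?sqr_ge0|exact: L1_scaled_cut].
    rewrite sumr_const card_ord -(mulr_natl (K%:R^-1 * _)) mulrA divff ?mul1r//.
    by rewrite pnatr_eq0 -lt0n.
  have b1 := hb K1 r1 Z1 t K1p r10 r1sq Z12 (hk1 r1 _).
  have b2 := hb K2 r2 Z2 (t + K1%:Z + g%:Z) K2p r20 r2sq Z22 (hk2 r2 _).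
  rewrite le_min in rk1; rewrite le_min in rk2.
  have {}b1 := b1 (introT andP (conj r10 (proj1 (andP rk1)))).
  have {}b2 := b2 (introT andP (conj r20 (proj2 (andP rk2)))).
  have := ler_wpM2l (ltW C0) (lerD b1 b2) => /le_trans; apply.
  by rewrite le_eqVlt; apply/orP; left; apply/eqP; field; rewrite gt_eqF.
- set X1 := fun w => K1%:R^-1 * (\sum_(k < K1) Z1 (t + k%:Z) w ^+ 2) - q1.
  set X2 := fun w => K2%:R^-1 * (\sum_(k < K2) Z2 (t + K1%:Z + g%:Z + k%:Z) w ^+ 2) - q2.
  have i1 : L1 P X1 by exact: (L1_avg q1 K1 t iZ1).
  have i2 : L1 P X2 by exact: (L1_avg q2 K2 (t + K1%:Z + g%:Z) iZ2).
  have e1 : EE P (fun w => `|X1 w|) <= eta / (3 * (s2 + 1)) := hL1 _ LK1 t.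
  have e2 : EE P (fun w => `|X2 w|) <= eta / (3 * (s2 + 1)) := hL2 _ LK2 _.
  apply: (@le_trans _ _ (s2 / 2 * (EE P (fun w => `|X1 w|) + EE P (fun w => `|X2 w|)))).
    rewrite ler_wpM2l ?divr_ge0// -EED; [|exact: L1_norm..].
    apply: EE_le; last first.
    + move=> w; rewrite VE; apply: le_trans (ler_normD _ _).
      by rewrite le_eqVlt; apply/orP; left; apply/eqP; congr `|_|; rewrite /X1 /X2; ring.
    + by apply: L1D; exact: L1_norm.
    + apply: L1_norm; apply: L1B; last exact: L1_cst.
      by apply: L1_sum => k _; exact: (zL2 k).2.
  have : s2 / 2 * (EE P (fun w => `|X1 w|) + EE P (fun w => `|X2 w|)) <=
         s2 / 2 * (eta / (3 * (s2 + 1)) + eta / (3 * (s2 + 1))).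
    by rewrite ler_wpM2l ?divr_ge0// lerD.
  move=> /le_trans; apply.
  have -> : s2 / 2 * (eta / (3 * (s2 + 1)) + eta / (3 * (s2 + 1))) =
     (s2 / (s2 + 1)) * (eta / 3) by field; lra.
  rewrite ler_piMl//; first lra.
  by rewrite ler_pdivrMr ?mul1r; lra.
Qed.

End BlockCLT.

(** * Moving average expansion of the autoregression *)

Section SummableConvolution.
Variable C : numClosedFieldType.
Implicit Types (x : nat -> C) (q : {poly C}) (r : C).

Definition abs_summable (F : numDomainType) (x : nat -> F) :=
  exists M : F, forall N, \sum_(n < N) `|x n| <= M.

(** Coefficients of the product of the polynomial q with the formal power series of coefficients
    x. *)
Definition conv q x n : C := \sum_(k < n.+1) q`_k * x (n - k)%N.

Lemma conv1 x n : conv 1 x n = x n.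
Proof.
rewrite /conv big_ord_recl coef1 mul1r subn0 big1 ?addr0// => k _.
by rewrite coef1 /= mul0r.
Qed.

Lemma convZ c q x n : conv (c *: q) x n = c * conv q x n.
Proof.
by rewrite /conv mulr_sumr; apply: eq_bigr => k _; rewrite coefZ mulrA.
Qed.

Lemma conv_linear_factor r q x n :
  conv (('X - r%:P) * q) x n =
  (if n is n'.+1 then conv q x n' else 0) - r * conv q x n.
Proof.
rewrite /conv mulr_sumr; under eq_bigr => k _.
  rewrite mulrBl coefB coefXM coefCM mulrBl -mulrA.
  over.
rewrite sumrB; congr (_ - _).
rewrite big_ord_recl /= mul0r add0r.
case: n => [|n]; first by rewrite big_ord0.
by apply: eq_bigr => k _; rewrite /= subSS.
Qed.

(** Write c for the convolution with q and b for the one with (X - r) q. Then r c_n = c_(n-1) - b_n,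
    so |r| sum |c| <= sum |b| + sum |c|, and |r| > 1 lets the last sum be absorbed. Dividing out the
    roots one at a time treats multiple roots like simple ones. *)
Lemma abs_summable_linear_factor r q x : 1 < `|r| ->
  abs_summable (conv (('X - r%:P) * q) x) -> abs_summable (conv q x).
Proof.
move=> r1 [M hM]; exists (M / (`|r| - 1)) => N.
have r10 : 0 < `|r| - 1 by rewrite subr_gt0.
rewrite ler_pdivlMr//.
suff : \sum_(n < N) `|conv q x n| * `|r| <= M + \sum_(n < N) `|conv q x n|.
  by rewrite -mulr_suml mulrBr mulr1 lerBlDr.
apply: le_trans (lerD (hM N) (lexx _)).
case: N => [|N]; first by rewrite !big_ord0 addr0.
apply: (@le_trans _ _ (\sum_(n < N.+1) `|conv (('X - r%:P) * q) x n| +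
    \sum_(n < N.+1) `|if (n : nat) is n'.+1 then conv q x n' else 0|)).
  rewrite -big_split /=; apply: ler_sum => n _.
  rewrite mulrC -normrM conv_linear_factor.
  set u := (if _ is _.+1 then _ else _).
  rewrite [X in `|X| <= _](_ : _ = u - (u - r * conv q x n)); last by ring.
  by apply: le_trans (ler_normB _ _) _; rewrite addrC.
rewrite lerD2l big_ord_recl /= normr0 add0r [leRHS]big_ord_recr /=.
by rewrite lerDl.
Qed.

Lemma abs_summable_roots (rs : seq C) x : (forall r, r \in rs -> 1 < `|r|) ->
  abs_summable (conv (\prod_(r <- rs) ('X - r%:P)) x) -> abs_summable x.
Proof.
elim: rs => [|r rs IH] hr.
  rewrite big_nil => -[M hM]; exists M => N.
  by apply: le_trans (hM N); apply: ler_sum => n _; rewrite conv1.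
rewrite big_cons => h; apply: IH.
  by move=> s srs; apply: hr; rewrite inE srs orbT.
by apply: abs_summable_linear_factor h; apply: hr; rewrite inE eqxx.
Qed.

End SummableConvolution.

(** * The impulse response of a causal filter *)

Section ImpulseResponse.
Context (R : realType) (L : nat) (psi : 'rV[R]_L.+1).

Definition lag_coef (k : nat) : R := if (k <= L)%N then psi ord0 (inord k) else 0.

Lemma lag_coefE (k : 'I_L) : lag_coef k.+1 = psi ord0 (lift ord0 k).
Proof.
rewrite /lag_coef ltn_ord; congr (psi _ _); apply: val_inj.
by rewrite /= inordK// ltnS.
Qed.

(* After m substitutions of the recursion, Y_n is written in terms of the last
   m innovations and of Y_(n-m), Y_(n-m-1), ...: [lag_weight m i] is the
   coefficient of Y_(n-m-i), and [impulse m] that of the m-th innovation. *)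
Fixpoint lag_weight (m i : nat) : R :=
  if m is m'.+1 then lag_weight m' i.+1 + lag_weight m' 0 * lag_coef i.+1
  else (i == 0%N)%:R.

Definition impulse m := lag_weight m 0.

(** [0 < i] matters when L = 0, since the initial weight sits at i = 0; for the same reason the
    remainders below run over L + 1 indices. *)
Lemma lag_weight_eq0 m i : (L <= i)%N -> (0 < i)%N -> lag_weight m i = 0.
Proof.
elim: m i => [|m IH] i Li i0 /=; first by rewrite gtn_eqF.
rewrite IH//; last exact: leqW.
by rewrite /lag_coef ltnNge Li /= mulr0 addr0.
Qed.

(** The recursion lowers m and raises i, so it is solved along the lines where m + i is constant. *)
Lemma lag_weightE m i : lag_weight m i =
  (m + i == 0)%N%:R + \sum_(j < m) impulse j * lag_coef (m - j + i).
Proof.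
elim: m i => [|m IH] i /=; first by rewrite big_ord0 addr0.
rewrite IH addnS /= !add0r big_ord_recr /= subSnn add1n; congr (_ + _).
by apply: eq_bigr => j _; rewrite addnS subSn ?addSn// ltnW.
Qed.

Let p : {poly R[i]} := \poly_(k < L.+1)
  (if k == 0%N then 1 else - ((lag_coef k)%:C)%C).

(** At i = 0 [lag_weightE] is the recursion that makes the impulse response the inverse power series
    of 1 - sum psi_k z^k. *)
Lemma conv_impulse n : conv p (fun k => ((impulse k)%:C)%C) n = (n == 0%N)%:R.
Proof.
have pE k : p`_k = (if k == 0%N then 1 else - ((lag_coef k)%:C)%C).
  rewrite coef_poly; case: ltnP => // Lk; rewrite gtn_eqF ?(leq_ltn_trans _ Lk)//.
  by rewrite /lag_coef leqNgt Lk /= rmorph0 oppr0.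
rewrite /conv big_ord_recl pE /= mul1r subn0 /impulse lag_weightE addn0 rmorphD /=.
rewrite -addrA [X in _ + X](_ : _ = 0) ?addr0; first by case: eqP.
rewrite rmorph_sum /= (reindex_inj rev_ord_inj) /= -big_split /= big1// => j _.
rewrite pE /= /bump /= add1n addn0 rmorphM /=.
have -> : (n - (n - j.+1))%N = j.+1 by have := ltn_ord j; lia.
by rewrite mulNr mulrC subrr.
Qed.

Hypothesis causal : causal_filter psi.

(** Causality puts the roots of [p] outside the closed unit disc. Convolving the response with the
    product of the linear factors leaves a multiple of the unit series, and the factors are then
    divided out. *)
Lemma impulse_summable : abs_summable impulse.
Proof.
have p0 : p != 0.
  apply/negP => /eqP p0; have := coef_poly L.+1
    (fun k => if k == 0%N then 1 else - ((lag_coef k)%:C)%C : R[i]) 0.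
  by rewrite -/p p0 coef0 /= => /eqP; rewrite eq_sym oner_eq0.
have [rs prs] := closed_field_poly_normal p.
have lc0 : lead_coef p != 0 by rewrite lead_coef_eq0.
have rs1 r : r \in rs -> 1 < `|r|.
  move=> rrs; have pr : root p r.
    by rewrite prs rootZ// root_prod_XsubC.
  rewrite real_ltNge ?ger0_real//; apply/negP => /causal /eqP; apply.
  move/rootP: pr; rewrite horner_poly big_ord_recl /= mul1r expr0.
  move=> h; rewrite -[RHS]h; congr (_ + _); rewrite -sumrN; apply: eq_bigr => k _.
  by rewrite /= /bump /= add1n mulNr lag_coefE.
have [|M hM] := abs_summable_roots (x := fun k => ((impulse k)%:C)%C) rs1.
  exists `|(lead_coef p)^-1| => N.
  have cE n : conv (\prod_(z <- rs) ('X - z%:P)) (fun k => ((impulse k)%:C)%C) n =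
      (lead_coef p)^-1 * (n == 0%N)%:R.
    by rewrite -conv_impulse prs lead_coefZ lead_coef_prod_XsubC mulr1 convZ mulKf.
  case: N => [|N]; first by rewrite big_ord0.
  rewrite big_ord_recl cE eqxx mulr1 big1 ?addr0// => k _.
  by rewrite cE /= mulr0 normr0.
(* In the order of the complex numbers a real sum below M is below its real part. *)
exists (complex.Re M) => N.
have nE (x : R) : `|(x%:C)%C| = ((`|x|)%:C)%C :> R[i].
  by rewrite normc_def /= expr0n addr0 sqrtr_sqr.
have := hM N; under eq_bigr do rewrite nE.
rewrite -rmorph_sum /=.
by case: M {hM} => a b; rewrite lecE /= => /andP[].
Qed.

End ImpulseResponse.

Lemma cvgn_sum (R : realType) (I : Type) (s : seq I) (F : I -> nat -> R)
    (a : I -> R) : (forall i, F i n @[n --> \oo] --> a i) ->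
  \sum_(i <- s) F i n @[n --> \oo] --> \sum_(i <- s) a i.
Proof.
move=> Fa; elim: s => [|i s IH].
  by under eq_fun do rewrite big_nil; rewrite big_nil; exact: cvg_cst.
by under eq_fun do rewrite big_cons; rewrite big_cons; exact: cvgD.
Qed.

Section Recursion.
Context (R : realType) (L : nat) (psi : 'rV[R]_L.+1) (y e : int -> R).
Hypothesis ar : forall n, y n = dotrv (regressor L y n) psi + e n.
Let p0 := psi ord0 ord0.

Lemma dotrv_regressor n (u : 'rV[R]_L.+1) : dotrv (regressor L y n) u =
  u ord0 ord0 + \sum_(k < L) u ord0 (lift ord0 k) * y (n - 1 - (k : nat)%:Z).
Proof.
rewrite /dotrv big_ord_recl mxE /= mul1r; congr (_ + _).
apply: eq_bigr => k _; rewrite mxE /= mulrC; congr (_ * y _).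
by rewrite /bump /= add1n; lia.
Qed.

Lemma ar_unroll m n : y n =
  \sum_(j < m) impulse psi j * (p0 + e (n - j%:Z)) +
  \sum_(i < L.+1) lag_weight psi m i * y (n - m%:Z - i%:Z).
Proof.
elim: m => [|m IH].
  rewrite big_ord0 add0r big_ord_recl /= mul1r big1 ?addr0 => [|i _].
    by congr y; lia.
  by rewrite /= mul0r.
rewrite {1}IH [X in _ = X + _]big_ord_recr /= -!addrA; congr (_ + _).
(* Only the term i = 0, that is Y_(n-m), is replaced by the recursion; the others move down by one
   index. *)
rewrite [LHS]big_ord_recl [X in _ = _ + X]big_ord_recr /= subr0.
have -> : lag_weight psi m L.+1 = 0 by rewrite lag_weight_eq0.
rewrite add0r; have -> : lag_coef psi L.+1 = 0 by rewrite /lag_coef ltnn.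
rewrite mulr0 mul0r addr0 [in LHS]ar dotrv_regressor -/p0 -/(impulse psi m).
rewrite [in RHS](eq_bigr (fun i : 'I_L => lag_weight psi m i.+1 * y (n - m.+1%:Z - i%:Z) +
  impulse psi m * (psi ord0 (lift ord0 i) * y (n - m.+1%:Z - i%:Z)))); last first.
  by move=> i _; rewrite lag_coefE /impulse; ring.
rewrite big_split /= -mulr_sumr.
rewrite [X in _ * (_ + X + _) + _](eq_bigr (fun i : 'I_L =>
  psi ord0 (lift ord0 i) * y (n - m.+1%:Z - i%:Z))); last first.
  by move=> i _; congr (_ * y _); lia.
rewrite [X in _ + X = _](eq_bigr (fun i : 'I_L =>
  lag_weight psi m i.+1 * y (n - m.+1%:Z - i%:Z))); last first.
  by move=> i _; rewrite /bump /= add1n; congr (_ * y _); lia.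
ring.
Qed.

Definition ma_coef (u : 'rV[R]_L.+1) (l : nat) : R := \sum_(i < L)
  u ord0 (lift ord0 i) * (if (i <= l)%N then impulse psi (l - i) else 0).

Definition rest_coef (u : 'rV[R]_L.+1) (m i : nat) : R :=
  \sum_(k < L) u ord0 (lift ord0 k) * lag_weight psi (m - k) i.

(** The lag of index k is unrolled m - k times, so that all remainders start at the common time n -
    1 - m. *)
Lemma regressor_unroll (u : 'rV[R]_L.+1) m n : (L <= m)%N ->
  dotrv (regressor L y n) u =
  u ord0 ord0 + \sum_(l < m) ma_coef u l * (p0 + e (n - 1 - l%:Z)) +
  \sum_(i < L.+1) rest_coef u m i * y (n - 1 - m%:Z - i%:Z).
Proof.
move=> Lm; rewrite dotrv_regressor -addrA; congr (_ + _).
have shift (k : 'I_L) (F : nat -> R) :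
    \sum_(j < m - k) impulse psi j * F (k + j)%N =
    \sum_(l < m) (if (k <= l)%N then impulse psi (l - k) else 0) * F l.
  have km : (k <= m)%N by apply: leq_trans Lm; exact: ltnW.
  rewrite -(big_mkord xpredT (fun l => (if (k <= l)%N then impulse psi (l - k) else 0) * F l)).
  rewrite (big_cat_nat (leq0n k) km) /= big_nat [X in _ = X + _]big1 ?add0r; last first.
    by move=> l /andP[_ lk]; rewrite leqNgt lk /= mul0r.
  rewrite [RHS](big_addn 0 m k) big_mkord; apply: eq_bigr => j _.
  by rewrite leq_addl addnK addnC.
rewrite (eq_bigr (fun k : 'I_L => u ord0 (lift ord0 k) *
   (\sum_(l < m) (if (k <= l)%N then impulse psi (l - k) else 0) *
      (p0 + e (n - 1 - l%:Z))) + u ord0 (lift ord0 k) *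
   (\sum_(i < L.+1) lag_weight psi (m - k) i * y (n - 1 - m%:Z - i%:Z)))); last first.
  move=> k _; rewrite -mulrDr; congr (_ * _).
  rewrite -(shift k (fun l => p0 + e (n - 1 - l%:Z))) (ar_unroll (m - k)).
  have km : (k <= m)%N by apply: leq_trans Lm; exact: ltnW.
  congr (_ + _); apply: eq_bigr => j _.
    by congr (_ * (_ + e _)); lia.
  by congr (_ * y _); lia.
rewrite big_split /=; congr (_ + _).
  rewrite (eq_bigr (fun k : 'I_L => \sum_(l < m) u ord0 (lift ord0 k) *
   (if (k <= l)%N then impulse psi (l - k) else 0) * (p0 + e (n - 1 - l%:Z)))).
    by rewrite exchange_big /=; apply: eq_bigr => l _; rewrite /ma_coef mulr_suml.
  by move=> k _; rewrite mulr_sumr; apply: eq_bigr => l _; rewrite mulrA.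
rewrite (eq_bigr (fun k : 'I_L => \sum_(i < L.+1) u ord0 (lift ord0 k) *
   lag_weight psi (m - k) i * y (n - 1 - m%:Z - i%:Z))).
  by rewrite exchange_big /=; apply: eq_bigr => i _; rewrite /rest_coef mulr_suml.
by move=> k _; rewrite mulr_sumr; apply: eq_bigr => i _; rewrite mulrA.
Qed.

End Recursion.

Section CausalCoefficients.
Context (R : realType) (L : nat) (psi : 'rV[R]_L.+1).
Hypothesis causal : causal_filter psi.
Implicit Types u v : 'rV[R]_L.+1.

Lemma abs_summable_cvg (x : nat -> R) : abs_summable x -> cvgn (series (fun n => `|x n|)).
Proof.
move=> [M hM]; apply: nondecreasing_is_cvgn.
  by apply: nondecreasing_series => n _ _; exact: normr_ge0.
by exists M => _ [n _ <-]; rewrite /series /= big_mkord.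
Qed.

Lemma impulse_cvg0 : impulse psi m @[m --> \oo] --> 0.
Proof.
apply/norm_cvg0P; exact: cvg_series_cvg_0 (abs_summable_cvg (impulse_summable causal)).
Qed.

(** Downward induction on i from beyond L, where the weights vanish: the weight at i is the previous
    weight at i + 1 plus a multiple of the impulse response, which is summable and so tends to 0. *)
Lemma lag_weight_cvg0 i : lag_weight psi m i @[m --> \oo] --> 0.
Proof.
have base j : (L < j)%N -> lag_weight psi m j @[m --> \oo] --> 0.
  move=> Lj; under eq_fun do rewrite lag_weight_eq0 ?(ltnW Lj) ?(leq_ltn_trans _ Lj)//.
  exact: cvg_cst.
have [Li|iL] := ltnP L i; first exact: base.
have [j jE] : exists j, (i + j = L.+1)%N by exists (L.+1 - i)%N; rewrite subnKC// leqW.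
elim: j i iL jE => [|j IH] i iL jE; first by apply: base; lia.
have h : lag_weight psi m i.+1 @[m --> \oo] --> 0.
  have [Li|iL'] := ltnP L i.+1; first exact: base.
  by apply: IH => //; lia.
have : lag_weight psi m i.+1 + lag_weight psi m 0 * lag_coef psi i.+1 @[m --> \oo]
    --> 0 + 0 * lag_coef psi i.+1.
  by apply: cvgD => //; apply: cvgMl; exact: impulse_cvg0.
by rewrite mul0r addr0 => H; rewrite -cvg_shiftS.
Qed.

Lemma rest_coef_cvg0 u i : rest_coef psi u m i @[m --> \oo] --> 0.
Proof.
have h (k : 'I_L) : u ord0 (lift ord0 k) * lag_weight psi (m - k) i @[m --> \oo]
    --> u ord0 (lift ord0 k) * 0.
  apply: cvgMr; have /= -> := @cvg_centern (k : nat) R (fun m => lag_weight psi m i) (nbhs (0 : R)).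
  exact: lag_weight_cvg0.
have := cvgn_sum (s := index_enum _) h; rewrite big1 => [|k _]; last by rewrite mulr0.
exact.
Qed.

Lemma ma_coef_summable u : abs_summable (ma_coef psi u).
Proof.
have [M hM] := impulse_summable causal.
exists (\sum_(i < L) `|u ord0 (lift ord0 i)| * M) => N.
have h l : `|ma_coef psi u l| <= \sum_(i < L) `|u ord0 (lift ord0 i)| *
    `|if (i <= l)%N then impulse psi (l - i) else 0|.
  by apply: le_trans (ler_norm_sum _ _ _) _; apply: ler_sum => i _; rewrite normrM.
apply: (@le_trans _ _ (\sum_(l < N) \sum_(i < L) `|u ord0 (lift ord0 i)| *
    `|if (i <= l)%N then impulse psi (l - i) else 0|)).
  by apply: ler_sum => l _; exact: h.
rewrite exchange_big /=; apply: ler_sum => i _; rewrite -mulr_sumr ler_wpM2l//.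
have [Ni|iN] := leqP N i.
  rewrite big1; last by move=> l _; rewrite leqNgt (leq_trans (ltn_ord l) Ni) /= normr0.
  by apply: le_trans (hM 0%N); rewrite big_ord0.
rewrite -(big_mkord xpredT (fun l => `|if (i <= l)%N then impulse psi (l - i) else 0|)).
rewrite (big_cat_nat (leq0n i) (ltnW iN)) /= big_nat big1 ?add0r; last first.
  by move=> l /andP[_ li]; rewrite leqNgt li /= normr0.
rewrite (big_addn 0 N i) big_mkord; apply: le_trans (hM (N - i)%N).
by apply: ler_sum => j _; rewrite leq_addl addnK.
Qed.

(** Constant term of the approximating moving averages: each substitution of the recursion brings in
    the intercept psi_0 once. *)
Definition ma_const u := u ord0 ord0 +
  psi ord0 ord0 * limn (series (ma_coef psi u)).

Lemma ma_const_cvg u :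
  u ord0 ord0 + psi ord0 ord0 * \sum_(l < m) ma_coef psi u l @[m --> \oo] --> ma_const u.
Proof.
apply: cvgD; first exact: cvg_cst.
apply: cvgMr; under eq_fun do rewrite -(big_mkord xpredT (ma_coef psi u)).
exact: (normed_cvg (abs_summable_cvg (ma_coef_summable u))).
Qed.

End CausalCoefficients.

(** * Limit theorems for the regressors *)

Section TruncatedNorm.
Context d (T : measurableType d) (R : realType) (P : probability T R).
Implicit Types X Y : T -> R.

(* Metrizes convergence in probability to 0. *)
Definition d0 X := EE P (fun w => Num.min 1 `|X w|).

Lemma min1_ge0 (x : R) : 0 <= Num.min 1 `|x|.
Proof. by rewrite le_min ler01 normr_ge0. Qed.

Lemma min1D (x y : R) : Num.min 1 `|x + y| <= Num.min 1 `|x| + Num.min 1 `|y|.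
Proof.
have xy := ler_normD x y; have x0 := normr_ge0 x; have y0 := normr_ge0 y.
rewrite ge_min; have [x1|x1] := leP 1 `|x|.
  by apply/orP; left; rewrite lerDl min1_ge0.
have [y1|y1] := leP 1 `|y|; first by apply/orP; left; rewrite lerDr.
by apply/orP; right.
Qed.

Lemma L1_min1 X : measurable_fun setT X -> L1 P (fun w => Num.min 1 `|X w|).
Proof.
move=> mX; apply: (L1_bounded P (B := 1)).
  apply: measurable_minr; [exact: measurable_cst|exact: measurableT_comp].
by move=> w; rewrite ger0_norm ?min1_ge0// ge_min lexx.
Qed.

Lemma d0_ge0 X : 0 <= d0 X.
Proof. by apply: EE_ge0 => w; exact: min1_ge0. Qed.

Lemma d0_le X Y : measurable_fun setT X -> measurable_fun setT Y ->
  (forall w, `|X w| <= `|Y w|) -> d0 X <= d0 Y.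
Proof.
move=> mX mY XY; apply: EE_le; [exact: L1_min1..|].
move=> w; rewrite le_min; apply/andP; split; first by rewrite ge_min lexx.
by rewrite ge_min XY orbT.
Qed.

Lemma d0D X Y : measurable_fun setT X -> measurable_fun setT Y ->
  d0 (fun w => X w + Y w) <= d0 X + d0 Y.
Proof.
move=> mX mY; rewrite /d0 -EED; [|exact: L1_min1..].
apply: EE_le; [by apply: L1_min1; exact: measurable_funD|by apply: L1D; exact: L1_min1|].
by move=> w; exact: min1D.
Qed.

Lemma d0_EE X : L1 P X -> d0 X <= EE P (fun w => `|X w|).
Proof.
move=> iX; apply: EE_le; [exact: L1_min1 (L1_meas iX)|exact: L1_norm|].
by move=> w; rewrite ge_min lexx orbT.
Qed.

(** Either |y| >= B and the second term is 1, or |x y| <= B |x|. *)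
Lemma min1_mul (B x y : R) : 1 <= B ->
  Num.min 1 `|x * y| <= B * Num.min 1 `|x| + Num.min 1 `|B^-1 * y|.
Proof.
move=> B1; have B0 : 0 < B by lra.
have x0 := normr_ge0 x; have y0 := normr_ge0 y.
rewrite !normrM (gtr0_norm (x := B^-1)) ?invr_gt0//.
have [By|yB] := leP B `|y|.
  have -> : Num.min 1 (B^-1 * `|y|) = 1.
    by apply/min_idPl; rewrite mulrC ler_pdivlMr// mul1r.
  rewrite ge_min; apply/orP; left; rewrite lerDr.
  exact: mulr_ge0 (ltW B0) (min1_ge0 x).
have h : 0 <= Num.min 1 (B^-1 * `|y|).
  by rewrite le_min ler01 mulr_ge0// invr_ge0 ltW.
have [x1|x1] := leP 1 `|x|.
  by rewrite ge_min; apply/orP; left; lra.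
by rewrite ge_min; apply/orP; right; nra.
Qed.

Lemma d0M (B : R) X Y : 1 <= B -> measurable_fun setT X -> measurable_fun setT Y ->
  d0 (fun w => X w * Y w) <= B * d0 X + d0 (fun w => B^-1 * Y w).
Proof.
move=> B1 mX mY; have mBY : measurable_fun setT (fun w => B^-1 * Y w).
  exact: measurable_funM.
rewrite /d0 -EEZ; last exact: L1_min1.
rewrite -EED; [|exact/L1Z/L1_min1|exact: L1_min1].
apply: EE_le.
- by apply: L1_min1; exact: measurable_funM.
- by apply: L1D; [exact/L1Z/L1_min1|exact: L1_min1].
by move=> w; exact: min1_mul.
Qed.

Lemma d0_scale_cvg0 (b : nat -> R) X : measurable_fun setT X ->
  b m @[m --> \oo] --> 0 -> d0 (fun w => b m * X w) @[m --> \oo] --> 0.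
Proof.
move=> mX b0.
have <- : EE P (fun=> 0) = 0 by exact: EE_cst.
apply: (EE_dct (Y := fun=> 1)).
- move=> m; apply: measurable_minr; first exact: measurable_cst.
  by apply: measurableT_comp => //; exact: measurable_funM.
- exact: measurable_cst.
- exact: L1_cst.
- by move=> m w; rewrite ger0_norm ?min1_ge0// ge_min lexx.
- move=> w; apply: (@squeeze_cvgr _ _ _ _ (fun=> 0) (fun m => `|b m * X w|)).
  + by apply: nearW => m; rewrite min1_ge0/= ge_min lexx orbT.
  + exact: cvg_cst.
  + apply/norm_cvg0P; have : b m * X w @[m --> \oo] --> 0 * X w by exact: cvgMl.
    by rewrite mul0r.
Qed.

Definition cvg0 (X : nat -> T -> R) :=
  (forall m, measurable_fun setT (X m)) /\ d0 (X m) @[m --> \oo] --> 0.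

Lemma cvg0_le (X : nat -> T -> R) (B : nat -> R) : (forall m, measurable_fun setT (X m)) ->
  (forall m, d0 (X m) <= B m) -> B m @[m --> \oo] --> 0 -> cvg0 X.
Proof.
move=> mX XB B0; split => //.
apply: (@squeeze_cvgr _ _ _ _ (fun=> 0) B) => //; last exact: cvg_cst.
by apply: nearW => m; rewrite d0_ge0 XB.
Qed.

Lemma cvg0D (X Y : nat -> T -> R) : cvg0 X -> cvg0 Y -> cvg0 (fun m w => X m w + Y m w).
Proof.
move=> [mX hX] [mY hY]; apply: (@cvg0_le _ (fun m => d0 (X m) + d0 (Y m))).
- by move=> m; exact: measurable_funD.
- by move=> m; exact: d0D.
- by rewrite -(addr0 (0 : R)); exact: cvgD.
Qed.

(** A fixed real variable is bounded in probability: B is chosen first, for Y alone, and then m,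
    depending on B. *)
Lemma cvg0M (X : nat -> T -> R) Y : cvg0 X -> measurable_fun setT Y ->
  cvg0 (fun m w => X m w * Y w).
Proof.
move=> [mX hX] mY; split; first by move=> m; exact: measurable_funM.
have tY := d0_scale_cvg0 mY (@cvg_harmonic R).
apply/cvgrPdist_le => e e0; have e2 : 0 < e / 2 by lra.
move/cvgrPdist_le: tY => /(_ _ e2) [J _ /(_ J (leqnn J)) /= hJ].
rewrite sub0r normrN ger0_norm ?d0_ge0// in hJ.
have B1 : 1 <= J.+1%:R :> R by rewrite ler1n.
have eB : 0 < e / (2 * J.+1%:R) by rewrite divr_gt0// mulr_gt0.
move/cvgrPdist_le: hX => /(_ _ eB); apply: filterS => m.
rewrite !sub0r !normrN !ger0_norm ?d0_ge0// => hm.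
apply: (le_trans (d0M B1 (mX m) mY)).
have -> : e = J.+1%:R * (e / (2 * J.+1%:R)) + e / 2 by field.
by apply: lerD => //; rewrite ler_wpM2l.
Qed.

Lemma cvg0Z c (X : nat -> T -> R) : cvg0 X -> cvg0 (fun m w => c * X m w).
Proof.
move=> hX; have := cvg0M hX (measurable_cst c); congr cvg0.
by apply/funext => m; apply/funext => w; rewrite mulrC.
Qed.

Lemma cvg0_sqr (X : nat -> T -> R) : cvg0 X -> cvg0 (fun m w => X m w ^+ 2).
Proof.
move=> [mX hX]; apply: (@cvg0_le _ (fun m => d0 (X m))) => //.
- by move=> m; exact: measurable_funX.
- move=> m; apply: EE_le; [|exact: L1_min1|].
    by apply: L1_min1; exact: measurable_funX.
  move=> w; have x0 := normr_ge0 (X m w); rewrite normrX.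
  have [x1|x1] := leP 1 `|X m w|; first by rewrite ge_min lexx.
  by rewrite ge_min; apply/orP; right; rewrite expr2 ler_piMr// ltW.
Qed.

Lemma cvg0_cst (a : nat -> R) : a m @[m --> \oo] --> 0 -> cvg0 (fun m _ => a m).
Proof.
move=> a0; split; first by move=> m; exact: measurable_cst.
have -> : (fun m => d0 (fun=> a m)) = (fun m => d0 (fun w : T => a m * 1)).
  by apply/funext => m; congr d0; apply/funext => w; rewrite mulr1.
exact: d0_scale_cvg0 (@measurable_cst _ _ T R setT (1 : R)) a0.
Qed.

Lemma cvg0_sum (I : Type) (s : seq I) (X : I -> nat -> T -> R) :
  (forall i, cvg0 (X i)) -> cvg0 (fun m w => \sum_(i <- s) X i m w).
Proof.
move=> hX; elim: s => [|i s IH].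
  have z0 : (fun _ : nat => 0 : R) @ \oo --> 0 by exact: cvg_cst.
  have := cvg0_cst z0; congr cvg0.
  by apply/funext => m; apply/funext => w; rewrite big_nil.
have := cvg0D (hX i) IH; congr cvg0.
by apply/funext => m; apply/funext => w; rewrite big_cons.
Qed.

Lemma cvg0_shift (X X' : nat -> T -> R) N : cvg0 X' ->
  (forall m, measurable_fun setT (X m)) ->
  (forall m, (N <= m)%N -> X m = X' m) -> cvg0 X.
Proof.
move=> [_ h] mX E; split => //.
apply: cvg_trans h; apply: near_eq_cvg; exists N => // m /= Nm.
by rewrite E.
Qed.

End TruncatedNorm.

(** * The regressors as limits of moving averages *)

Section ARProcess.
Context d (Omega : measurableType d) (R : realType) (P : probability Omega R).
Context (L : nat) (psi : 'rV[R]_L.+1) (Y eps : int -> Omega -> R).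
Hypotheses (causal : causal_filter psi) (mY : forall n, measurable_fun setT (Y n)).
Hypothesis stat : strictly_stationary P Y.
Hypothesis ar : forall n w,
  Y n w = dotrv (regressor L (fun m => Y m w) n) psi + eps n w.
Hypothesis eiid : iid P eps.
Hypothesis eL2 : L2 P (eps 0).
Hypothesis e0 : EE P (eps 0) = 0.
Let s2 := EE P (fun w => eps 0 w ^+ 2).
Implicit Types u v : 'rV[R]_L.+1.

Definition lin_reg u (n : int) (w : Omega) : R :=
  dotrv (regressor L (fun m => Y m w) n) u.

Definition ma_reg u m := ma eps (ma_const psi u) (ma_coef psi u) m.

(** Limit of the second moments of the moving averages in direction u; it will be the quadratic form
    of Gamma. *)
Definition reg_var u := ma_const psi u ^+ 2 +
  s2 * limn (series (fun l => ma_coef psi u l ^+ 2)).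

Lemma lin_reg_meas u n : measurable_fun setT (lin_reg u n).
Proof.
rewrite /lin_reg (_ : (fun w => _) = fun w => u ord0 ord0 +
   \sum_(k < L) u ord0 (lift ord0 k) * Y (n - 1 - (k : nat)%:Z) w); last first.
  by apply/funext => w; exact: dotrv_regressor.
apply: measurable_funD; first exact: measurable_cst.
by apply: measurable_sum => k; exact: measurable_funM.
Qed.

Lemma stationary_law n (A : set R) : measurable A ->
  P (Y n @^-1` A) = P (Y 0 @^-1` A).
Proof.
move=> mA; have := @stat 1 (fun=> 0) (fun=> A) n (fun=> mA).
have -> : [set w | forall i : 'I_1, A (Y (0 + n) w)] = Y n @^-1` A.
  by rewrite add0r; apply/seteqP; split => w /=; [apply; exact: ord0|].
have -> // : [set w | forall i : 'I_1, A (Y 0 w)] = Y 0 @^-1` A.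
by apply/seteqP; split => w /=; [apply; exact: ord0|].
Qed.

(** The time may vary with m because [d0] sees only the law of Y_(n m), which is that of Y_0. This
    is how stationarity makes the remainders of the recursion vanish without moments. *)
Lemma cvg0_stationary (b : nat -> R) (n : nat -> int) :
  b m @[m --> \oo] --> 0 -> cvg0 P (fun m w => b m * Y (n m) w).
Proof.
move=> b0; apply: (cvg0_le (B := fun m => d0 P (fun w => b m * Y 0 w))).
- by move=> m; exact: measurable_funM.
- move=> m; rewrite le_eqVlt; apply/orP; left; apply/eqP.
  pose g x := Num.min 1 `|b m * x|.
  have mg : measurable_fun setT g.
    apply: measurable_minr; first exact: measurable_cst.
    by apply: measurableT_comp => //; exact: measurable_funM.
  apply: (EE_same_law (mY (n m)) (mY 0) (@stationary_law (n m)) mg).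
  by apply: L1_min1; exact: measurable_funM.
- exact: d0_scale_cvg0.
Qed.

Lemma ma_reg_L2 u m n : L2 P (ma_reg u m n).
Proof. exact: (ma_L2 eiid eL2). Qed.

Lemma ma_reg_meas u m n : measurable_fun setT (ma_reg u m n).
Proof. exact: L2_meas (ma_reg_L2 u m n). Qed.

(** Two errors: the tail of the series defining [ma_const], and the values of [Y] still present
    after m substitutions, whose weights tend to 0. *)
Lemma cvg0_rest u n : cvg0 P (fun m w => lin_reg u n w - ma_reg u m n w).
Proof.
pose p0 := psi ord0 ord0.
pose a m := (u ord0 ord0 + p0 * \sum_(l < m) ma_coef psi u l) - ma_const psi u.
have h1 : cvg0 P (fun m (_ : Omega) => a m).
  apply: cvg0_cst; rewrite -(subrr (ma_const psi u)).
  by apply: cvgB; [exact: ma_const_cvg|exact: cvg_cst].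
have h2 (i : 'I_L.+1) : cvg0 P (fun m w =>
    rest_coef psi u m i * Y (n - 1 - m%:Z - (i : nat)%:Z) w).
  by apply: cvg0_stationary; exact: rest_coef_cvg0.
have := cvg0D h1 (cvg0_sum (index_enum _) h2) => h3.
apply: (cvg0_shift (N := L) h3).
  by move=> m; apply: measurable_funB; [exact: lin_reg_meas|exact: ma_reg_meas].
move=> m Lm; apply/funext => w.
rewrite /lin_reg (regressor_unroll (fun k => ar k w) u n Lm) /ma_reg /ma /a -/p0.
rewrite (eq_bigr (fun l : 'I_m => p0 * ma_coef psi u l +
    ma_coef psi u l * eps (n - 1 - (l : nat)%:Z) w)); last first.
  by move=> l _; rewrite mulrDr [p0 * _]mulrC.
rewrite big_split /= -mulr_sumr; ring.
Qed.

Lemma sqr_summable (x : nat -> R) : abs_summable x -> cvgn (series (fun n => x n ^+ 2)).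
Proof.
move=> [M hM]; apply: nondecreasing_is_cvgn.
  by apply: nondecreasing_series => n _ _; exact: sqr_ge0.
have M0 : 0 <= M by apply: le_trans (hM 0%N); rewrite big_ord0.
have xM n : `|x n| <= M.
  by apply: le_trans (hM n.+1); rewrite big_ord_recr /= lerDr sumr_ge0.
exists (M * M) => _ [n _ <-]; rewrite /series /= big_mkord.
apply: (@le_trans _ _ (\sum_(i < n) M * `|x i|)).
  by apply: ler_sum => i _; rewrite -real_normK ?num_real// expr2 ler_wpM2r.
by rewrite -mulr_sumr ler_wpM2l.
Qed.

Let v_ u m := ma_var P eps (ma_const psi u) (ma_coef psi u) m.

Let s20 : 0 <= s2. Proof. by apply: EE_ge0 => w; exact: sqr_ge0. Qed.

Lemma ma_var_cvg u : v_ u m @[m --> \oo] --> reg_var u.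
Proof.
apply: cvgD; first exact: cvg_cst.
apply: cvgMr; under eq_fun do
  rewrite -(big_mkord xpredT (fun l => ma_coef psi u l ^+ 2)).
exact: (sqr_summable (ma_coef_summable causal u)).
Qed.

Lemma ma_var_nd u m M : (m <= M)%N -> v_ u m <= v_ u M.
Proof.
move=> mM; rewrite lerD2l ler_wpM2l//.
rewrite -!(big_mkord xpredT (fun l => ma_coef psi u l ^+ 2)).
rewrite [leRHS](big_cat_nat (leq0n m) mM) /= lerDl.
by apply: sumr_ge0 => l _; exact: sqr_ge0.
Qed.

Lemma ma_var_le u m : v_ u m <= reg_var u.
Proof.
rewrite -(cvg_lim (@Rhausdorff R) (@ma_var_cvg u)).
apply: limr_ge; first exact/cvgP/ma_var_cvg.
by exists m => // M /= mM; exact: ma_var_nd.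
Qed.

Lemma ma_var_ge0 u m : 0 <= v_ u m.
Proof.
by rewrite addr_ge0 ?sqr_ge0// mulr_ge0// sumr_ge0// => l _; exact: sqr_ge0.
Qed.

Lemma reg_var_ge0 u : 0 <= reg_var u.
Proof. exact: le_trans (ma_var_ge0 u 0) (ma_var_le u 0). Qed.

Lemma ma_var_near u eta : 0 < eta -> exists m, forall M, (m <= M)%N ->
  reg_var u - v_ u M <= eta.
Proof.
move=> eta0; have /cvgrPdist_le /(_ _ eta0) [m _ hm] := @ma_var_cvg u.
by exists m => M mM; apply: le_trans (ler_norm _) (hm M mM).
Qed.

Lemma EE_ma_reg_sqr u m n : EE P (fun w => ma_reg u m n w ^+ 2) = v_ u m.
Proof. exact: EE_ma_sqr. Qed.

Lemma EE_ma_reg_diff u m M n : (m <= M)%N ->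
  EE P (fun w => (ma_reg u M n w - ma_reg u m n w) ^+ 2) = v_ u M - v_ u m.
Proof. by move=> mM; exact: EE_ma_diff_sqr. Qed.

Definition avg (U : int -> Omega -> R) K t w :=
  K%:R^-1 * \sum_(k < K) U (t + k%:Z) w.

Lemma avg_meas U K t : (forall n, measurable_fun setT (U n)) ->
  measurable_fun setT (avg U K t).
Proof.
by move=> mU; apply: measurable_funM => //; exact: measurable_sum.
Qed.

Lemma cvg0_avg_sqr u K t : cvg0 P (fun m w =>
  avg (fun n w => lin_reg u n w ^+ 2) K t w - avg (fun n w => ma_reg u m n w ^+ 2) K t w).
Proof.
pose r n m w := lin_reg u n w - ma_reg u m n w.
have h n : cvg0 P (fun m w => r n m w * (2 * lin_reg u n w) + (-1) * r n m w ^+ 2).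
  apply: cvg0D.
    apply: cvg0M; first exact: cvg0_rest.
    by apply: measurable_funM => //; exact: lin_reg_meas.
  exact/cvg0Z/cvg0_sqr/cvg0_rest.
have := cvg0Z K%:R^-1 (cvg0_sum (index_enum _) (fun k : 'I_K => h (t + (k : nat)%:Z))).
congr cvg0; apply/funext => m; apply/funext => w.
rewrite /avg -mulrBr -sumrB; congr (_ * _); apply: eq_bigr => k _.
rewrite /r; ring.
Qed.

(** From x^2 - y^2 = (x - y)^2 + 2 (x - y) y, with the product split by the weights 1 / theta and
    theta. The bound depends on neither K nor t and, through v_M <= [reg_var], can be made uniform
    in M. *)
Lemma EE_avg_sqr_diff u m M K t (theta : R) : 0 < theta -> (0 < K)%N -> (m <= M)%N ->
  EE P (fun w => `|avg (fun n w => ma_reg u M n w ^+ 2) K t w -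
                  avg (fun n w => ma_reg u m n w ^+ 2) K t w|) <=
  (1 + theta^-1) * (v_ u M - v_ u m) + theta * v_ u m.
Proof.
move=> th0 K0 mM; have Kp : 0 < K%:R :> R by rewrite ltr0n.
have i1 m' n : L1 P (fun w => ma_reg u m' n w ^+ 2) := (ma_reg_L2 u m' n).2.
pose D n w := ma_reg u M n w - ma_reg u m n w.
have iD n : L2 P (D n) by apply: L2B; exact: ma_reg_L2.
have hn n : EE P (fun w => `|ma_reg u M n w ^+ 2 - ma_reg u m n w ^+ 2|) <=
    (1 + theta^-1) * (v_ u M - v_ u m) + theta * v_ u m.
  have i2 : L1 P (fun w => (ma_reg u M n w - ma_reg u m n w) ^+ 2) := (iD n).2.
  rewrite -(EE_ma_reg_diff u n mM) -(EE_ma_reg_sqr u m n).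
  rewrite -(EEZ _ i2) -(EEZ _ (i1 m n)) -EED; [|exact: L1Z i2|exact: L1Z].
  apply: EE_le; [exact/L1_norm/L1B|by apply: L1D; [exact: L1Z (iD n).2|exact: L1Z]|].
  move=> w; set x := ma_reg u M n w; set y := ma_reg u m n w.
  have -> : x ^+ 2 - y ^+ 2 = (x - y) ^+ 2 + 2 * (x - y) * y by ring.
  apply: le_trans (ler_normD _ _) _; rewrite ger0_norm ?sqr_ge0//.
  rewrite !normrM (ger0_norm (ler0n _ 2)).
  have h2 : 2 * `|x - y| * `|y| <= theta^-1 * (x - y) ^+ 2 + theta * y ^+ 2.
    rewrite -(real_normK (num_real (x - y))) -(real_normK (num_real y)).
    move: (`|x - y|) (`|y|) => a b.
    have -> : theta^-1 * a ^+ 2 + theta * b ^+ 2 =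
       2 * a * b + theta^-1 * (a - theta * b) ^+ 2 by field; lra.
    by rewrite lerDl mulr_ge0 ?sqr_ge0// invr_ge0 ltW.
  have -> : (1 + theta^-1) * (x - y) ^+ 2 = (x - y) ^+ 2 + theta^-1 * (x - y) ^+ 2.
    by ring.
  by rewrite -[leRHS]addrA; apply: lerD.
apply: (@le_trans _ _ (EE P (fun w => K%:R^-1 * \sum_(k < K)
   `|ma_reg u M (t + k%:Z) w ^+ 2 - ma_reg u m (t + k%:Z) w ^+ 2|))).
  apply: EE_le.
  - by apply: L1_norm; apply: L1B; apply: L1Z; exact: L1_sum.
  - by apply/L1Z/L1_sum => k _; exact/L1_norm/L1B.
  move=> w; rewrite /avg -mulrBr -sumrB normrM ger0_norm ?invr_ge0 ?ler0n//.
  by rewrite ler_wpM2l ?invr_ge0 ?ler0n//; exact: ler_norm_sum.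
rewrite EEZ; last by apply: L1_sum => k _; exact/L1_norm/L1B.
rewrite EE_sum; last by move=> k _; exact/L1_norm/L1B.
apply: (@le_trans _ _ (K%:R^-1 * \sum_(k < K)
   ((1 + theta^-1) * (v_ u M - v_ u m) + theta * v_ u m))).
  by rewrite ler_wpM2l ?invr_ge0 ?ler0n//; apply: ler_sum.
by rewrite sumr_const card_ord -(mulr_natl (_ + _) K) mulrA mulVf ?mul1r// gt_eqF.
Qed.

(** The device that removes the order M: a bound valid for all large M up to a term vanishing with M
    holds without that term. *)
Lemma ler_cvg0 (a b : R) (x : nat -> R) m : x M @[M --> \oo] --> 0 ->
  (forall M, (m <= M)%N -> a <= x M + b) -> a <= b.
Proof.
move=> x0 h; apply/ler_addgt0Pl => eta eta0.
move/cvgrPdist_le: x0 => /(_ _ eta0) [N _ hN].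
have := hN (maxn m N) (leq_maxr _ _); rewrite /= sub0r normrN => hx.
apply: le_trans (h _ (leq_maxl m N)) _; rewrite lerD2r.
exact: le_trans (ler_norm _) hx.
Qed.

(** The path goes from the regressor to the order M, from M to a fixed order m, and from m to the
    constant. The first passage has no uniform rate, but M tends to infinity with K and t fixed,
    after m and K0 have been chosen. *)
Lemma lln_reg_sqr u eta : 0 < eta -> exists K0 : nat, forall K, (K0 < K)%N ->
  forall t : int,
  d0 P (fun w => avg (fun n w => lin_reg u n w ^+ 2) K t w - reg_var u) <= eta.
Proof.
move=> eta0; pose q := reg_var u; have q0 : 0 <= q := reg_var_ge0 u.
(* Four errors of eta / 4: theta v_m, (1 + 1 / theta) e1, the law of large numbers at order m, and q
   - v_m <= e1. *)
pose theta := eta / (4 * (q + 1)).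
have th0 : 0 < theta by rewrite divr_gt0// mulr_gt0//; lra.
have thi : 0 < 1 + theta^-1 by rewrite addr_gt0// invr_gt0.
pose e1 := Num.min (eta / 4) (eta / (4 * (1 + theta^-1))).
have e10 : 0 < e1 by rewrite lt_min !divr_gt0// mulr_gt0.
have [m hm] := ma_var_near u e10.
have e4 : 0 < eta / 4 by lra.
have [iZ /(_ _ e4) [K0 hK0]] := LLN_ma_sqr eiid eL2 e0 (ma_const psi u) (ma_coef psi u) m.
exists K0 => K K0K t; have Kp : (0 < K)%N by exact: leq_ltn_trans K0K.
have [_ h0] := cvg0_avg_sqr u K t.
apply: (ler_cvg0 (m := m) h0) => M mM.
pose A w := avg (fun n w => lin_reg u n w ^+ 2) K t w.
pose B M w := avg (fun n w => ma_reg u M n w ^+ 2) K t w.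
have mA : measurable_fun setT A.
  by apply: avg_meas => n; apply: measurable_funX; exact: lin_reg_meas.
have iB M' : L1 P (B M').
  by apply/L1Z/L1_sum => k _; exact: (ma_reg_L2 u _ _).2.
have mB M' : measurable_fun setT (B M') := L1_meas (iB M').
rewrite (_ : (fun w => _) = fun w => (A w - B M w) +
   ((B M w - B m w) + ((B m w - v_ u m) + (v_ u m - q)))); last first.
  by apply/funext => w; rewrite /A /q; ring.
apply: le_trans (d0D P _ _) _; first exact: measurable_funB.
  apply: measurable_funD; first exact: measurable_funB.
  by apply: measurable_funD; [exact: measurable_funB|exact: measurable_cst].
rewrite lerD2l.
have i1 : L1 P (fun w => B M w - B m w) by exact: L1B.
have i2 : L1 P (fun w => B m w - v_ u m) by apply: L1B => //; exact: L1_cst.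
have i3 : L1 P (fun w => (B m w - v_ u m) + (v_ u m - q)).
  by apply: L1D => //; exact: L1_cst.
apply: le_trans (d0D P _ _) _; [exact: L1_meas i1|exact: L1_meas i3|].
apply: le_trans (lerD (d0_EE i1) (d0D P (L1_meas i2) (measurable_cst _))) _.
have b1 := EE_avg_sqr_diff u t th0 Kp mM.
have b2 := d0_EE i2; have b3 := hK0 K K0K t.
have b4 : d0 P (fun=> v_ u m - q) <= e1.
  apply: le_trans (d0_EE (L1_cst P _)) _; rewrite EE_cst distrC ger0_norm.
    exact: hm.
  by rewrite subr_ge0 ma_var_le.
have vM : v_ u M - v_ u m <= e1.
  by apply: le_trans (hm m (leqnn m)); rewrite lerB// ma_var_le.
have c1 : (1 + theta^-1) * (v_ u M - v_ u m) <= eta / 4.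
  apply: (@le_trans _ _ ((1 + theta^-1) * (eta / (4 * (1 + theta^-1))))).
    by rewrite ler_pM2l//; apply: le_trans vM _; rewrite ge_min lexx orbT.
  by rewrite le_eqVlt; apply/orP; left; apply/eqP; field; rewrite gt_eqF ?gt_eqF//; lra.
have c2 : theta * v_ u m <= eta / 4.
  apply: (@le_trans _ _ (theta * (q + 1))).
    by rewrite ler_pM2l//; apply: le_trans (ma_var_le u m) _; rewrite lerDl.
  by rewrite le_eqVlt; apply/orP; left; apply/eqP; rewrite /theta; field; lra.
have c3 : e1 <= eta / 4 by rewrite ge_min lexx.
lra.
Qed.

Lemma cvg0_block u K t : cvg0 P (fun m w =>
  block_sum eps (lin_reg u) K t w - block_sum eps (ma_reg u m) K t w).
Proof.
have h n : cvg0 P (fun m w => (lin_reg u n w - ma_reg u m n w) * eps n w).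
  by apply: cvg0M; [exact: cvg0_rest|exact: (eps_meas eiid)].
have := cvg0Z (Num.sqrt K%:R)^-1 (cvg0_sum (index_enum _)
  (fun k : 'I_K => h (t + (k : nat)%:Z))).
congr cvg0; apply/funext => m; apply/funext => w.
rewrite /block_sum -mulrBr -sumrB; congr (_ * _); apply: eq_bigr => k _.
by rewrite mulrBl.
Qed.

Lemma block_sum_L2 (H : int -> Omega -> R) (V : R) K t : (0 < K)%N ->
  (forall n, past_measurable eps n (H n)) -> (forall n, L2 P (H n)) ->
  (forall n, EE P (fun w => H n w ^+ 2) <= V) ->
  L2 P (block_sum eps H K t) /\
  EE P (fun w => block_sum eps H K t w ^+ 2) <= s2 * V.
Proof.
move=> K0 pH HL2 HV; have Kp : 0 < K%:R :> R by rewrite ltr0n.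
have mid : measurable_fun setT (id : R -> R) by exact: measurable_id.
have pH' k : past_measurable eps (t + k%:Z) (H (t + k%:Z)) by exact: pH.
have HL2' k : L2 P (H (t + k%:Z)) by exact: HL2.
have S2 := L2_mart_sum eiid mid eL2 pH' HL2' K.
have bE w : block_sum eps H K t w =
    (Num.sqrt K%:R)^-1 * mart_sum eps id t (fun k => H (t + k%:Z)) K w by [].
split; first exact: L2Z.
rewrite (EE_ext P (Y := fun w => K%:R^-1 *
  mart_sum eps id t (fun k => H (t + k%:Z)) K w ^+ 2)); last first.
  by move=> w; rewrite bE exprMn exprVn sqr_sqrtr// ltW.
rewrite EEZ; last exact: S2.2.
rewrite (EE_mart_sum_sqr eiid mid eL2 e0 pH' HL2') mulrCA -/s2 ler_wpM2l//.
rewrite mulrC ler_pdivrMr// mulr_natr -[X in _ *+ X](card_ord K) -sumr_const.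
by apply: ler_sum.
Qed.

Lemma block_sum_meas u K t : measurable_fun setT (block_sum eps (lin_reg u) K t).
Proof.
apply: measurable_funM => //; apply: measurable_sum => k.
by apply: measurable_funM; [exact: lin_reg_meas|exact: (eps_meas eiid)].
Qed.

Lemma block_sum_diff u m M K t (theta : R) : 0 < theta -> (0 < K)%N -> (m <= M)%N ->
  EE P (fun w => `|block_sum eps (ma_reg u M) K t w - block_sum eps (ma_reg u m) K t w|)
  <= theta / 2 + s2 * (v_ u M - v_ u m) / (2 * theta).
Proof.
move=> th0 K0 mM.
have [|||bL2 bV] := @block_sum_L2 (fun n w => ma_reg u M n w - ma_reg u m n w)
   (v_ u M - v_ u m) K t K0.
- move=> n; have p1 : past_measurable eps n (ma_reg u M n) by exact: past_ma.
  have p2 : past_measurable eps n (ma_reg u m n) by exact: past_ma.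
  have p3 : past_measurable eps n (fun=> -1) by exact: past_cst.
  have := pastD p1 (pastM p3 p2); congr past_measurable.
  by apply/funext => w; rewrite mulN1r.
- by move=> n; apply: L2B; exact: ma_reg_L2.
- by move=> n; rewrite EE_ma_reg_diff.
rewrite (EE_ext P (Y := fun w => `|block_sum eps (fun n w =>
  ma_reg u M n w - ma_reg u m n w) K t w|)); last first.
  move=> w; congr `|_|; rewrite /block_sum -mulrBr -sumrB; congr (_ * _).
  by apply: eq_bigr => k _; rewrite mulrBl.
apply: le_trans (EE_norm_le th0 bL2) _; rewrite lerD2l ler_wpM2r//.
by rewrite invr_ge0 mulr_ge0// ltW.
Qed.

(** For the moving averages E |W| <= (1 + E W^2) / 2, and E W^2 <= s2 [reg_var u] by orthogonality,
    for all K, t and M. *)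
Lemma block_sum_tight u K t (B : R) : (0 < K)%N -> 0 < B ->
  d0 P (fun w => B^-1 * block_sum eps (lin_reg u) K t w) <= B^-1 * (1 + s2 * reg_var u).
Proof.
move=> K0 B0; have [_ h] := cvg0Z B^-1 (cvg0_block u K t).
apply: (ler_cvg0 (m := 0%N) h) => M _.
have [|||bL2 bV] := @block_sum_L2 (ma_reg u M) (v_ u M) K t K0.
- by move=> n; exact: past_ma.
- by move=> n; exact: ma_reg_L2.
- by move=> n; rewrite EE_ma_reg_sqr.
rewrite (_ : (fun w => B^-1 * _) = fun w =>
  B^-1 * (block_sum eps (lin_reg u) K t w - block_sum eps (ma_reg u M) K t w) +
  B^-1 * block_sum eps (ma_reg u M) K t w); last by apply/funext => w; ring.
have mb := L2_meas bL2; have mu := block_sum_meas u K t.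
apply: le_trans (d0D P _ _) _.
- by apply: measurable_funM => //; exact: measurable_funB.
- exact: measurable_funM.
rewrite lerD2l; apply: le_trans (d0_EE (L1Z _ (L2_L1 bL2))) _.
rewrite (EE_ext P (Y := fun w => B^-1 * `|block_sum eps (ma_reg u M) K t w|)); last first.
  by move=> w; rewrite normrM gtr0_norm// invr_gt0.
rewrite EEZ; last exact/L1_norm/L2_L1.
rewrite ler_wpM2l ?invr_ge0 ?(ltW B0)//.
apply: le_trans (EE_norm_le ltr01 bL2) _.
have h1 : s2 * v_ u M <= s2 * reg_var u by rewrite ler_wpM2l// ma_var_le.
have h2 : 0 <= s2 * reg_var u by rewrite mulr_ge0// reg_var_ge0.
rewrite mulr1; lra.
Qed.

Lemma cos_lip (x y : R) : `|cos x - cos y| <= 2 * Num.min 1 `|x - y|.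
Proof.
have h : `|cos x - cos y| <= 2.
  have := cos_geN1 x; have := cos_le1 x; have := cos_geN1 y; have := cos_le1 y.
  by rewrite ler_norml => *; apply/andP; split; lra.
have [_|_] := leP 1 `|x - y|; first by rewrite mulr1.
have -> : cos x - cos y = - 2 * sin ((x + y) / 2) * sin ((x - y) / 2).
  set a := (x + y) / 2; set b := (x - y) / 2.
  have xE : x = a + b by rewrite /a /b; field.
  have yE : y = a - b by rewrite /a /b; field.
  by rewrite {1}xE {1}yE cosD cosB; ring.
rewrite !normrM normrN (ger0_norm (ler0n _ 2)) -mulrA ler_wpM2l//.
apply: (@le_trans _ _ (1 * `|(x - y) / 2|)).
  apply: ler_pM => //; last exact: normr_sin_le.
  by rewrite ler_norml sin_geN1 sin_le1.
by rewrite mul1r normrM (ger0_norm (x := 2^-1))//; have := normr_ge0 (x - y); lra.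
Qed.

Lemma EE_cos_lip (X X' : Omega -> R) : measurable_fun setT X -> measurable_fun setT X' ->
  `|EE P (fun w => cos (X w)) - EE P (fun w => cos (X' w))| <=
  2 * d0 P (fun w => X w - X' w).
Proof.
move=> mX mX'.
have ic (U : Omega -> R) : measurable_fun setT U -> L1 P (fun w => cos (U w)).
  move=> mU; apply: (L1_bounded P (B := 1)).
    by apply: measurableT_comp => //; exact: measurable_cosR.
  by move=> w; rewrite ler_norml cos_geN1 cos_le1.
have mD : measurable_fun setT (fun w => X w - X' w) by exact: measurable_funB.
rewrite -EEB; [|exact: ic..].
apply: le_trans (EE_abs _) _; first by apply: L1B; exact: ic.
rewrite /d0 -EEZ; last exact: L1_min1.
apply: EE_le; [by apply/L1_norm/L1B; exact: ic|exact/L1Z/L1_min1|].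
by move=> w; exact: cos_lip.
Qed.

Lemma clt_reg u v (c eta : R) : 0 < eta -> exists K0 : nat, forall K1 K2 g : nat,
  (K0 < K1)%N -> (K0 < K2)%N -> forall t : int,
  `|EE P (fun w => cos (block_sum eps (lin_reg u) K1 t w +
       block_sum eps (lin_reg v) K2 (t + K1%:Z + g%:Z) w + c)) -
    expR (- (s2 / 2 * (reg_var u + reg_var v))) * cos c| <= eta.
Proof.
move=> eta0.
pose theta := eta / 16; have th0 : 0 < theta by rewrite /theta; lra.
(* The first entry gives s2 e1 / (2 theta) <= eta / 16, for the passage from order M to m; the
   second gives s2 e1 <= eta / 4, for the difference of the two limiting exponentials. *)
pose e1 := Num.min (eta ^+ 2 / (128 * (s2 + 1))) (eta / (4 * (s2 + 1))).
have e10 : 0 < e1 by rewrite lt_min !divr_gt0// ?exprn_gt0// mulr_gt0// ltr_wpDl.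
have [mu hmu] := ma_var_near u e10; have [mv hmv] := ma_var_near v e10.
pose m := maxn mu mv.
have hu M : (m <= M)%N -> reg_var u - v_ u M <= e1.
  by move=> mM; apply: hmu; apply: leq_trans mM; exact: leq_maxl.
have hv M : (m <= M)%N -> reg_var v - v_ v M <= e1.
  by move=> mM; apply: hmv; apply: leq_trans mM; exact: leq_maxr.
have e4 : 0 < eta / 4 by lra.
have [K0 hK0] := block_clt eiid eL2 e0 (ma_const psi u) (ma_const psi v)
  (ma_coef psi u) (ma_coef psi v) m c e4.
exists K0 => K1 K2 g K01 K02 t.
have Kp1 : (0 < K1)%N by exact: leq_ltn_trans K01.
have Kp2 : (0 < K2)%N by exact: leq_ltn_trans K02.
set t2 := t + K1%:Z + g%:Z.
pose X w := block_sum eps (lin_reg u) K1 t w + block_sum eps (lin_reg v) K2 t2 w + c.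
pose XM M w := block_sum eps (ma_reg u M) K1 t w + block_sum eps (ma_reg v M) K2 t2 w + c.
have hX := cvg0D (cvg0_block u K1 t) (cvg0_block v K2 t2).
have [_ h0] := cvg0Z 2 hX.
have [mh0 _] := hX.
have [_ {}h0] := hX.
have h2 : 2 * d0 P (fun w => (block_sum eps (lin_reg u) K1 t w -
    block_sum eps (ma_reg u M) K1 t w) + (block_sum eps (lin_reg v) K2 t2 w -
    block_sum eps (ma_reg v M) K2 t2 w)) @[M --> \oo] --> 0.
  by rewrite -(mulr0 (2 : R)); exact: cvgMr.
apply: (ler_cvg0 (m := m) h2) => M mM.
have bL2 u' M' K t' : L2 P (block_sum eps (ma_reg u' M') K t').
  have mid : measurable_fun setT (id : R -> R) by exact: measurable_id.
  apply: L2Z; apply: L2_sum => k.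
  have pk : past_measurable eps (t' + k%:Z) (ma_reg u' M' (t' + k%:Z)).
    exact: past_ma.
  exact: (L2_mart_step eiid mid eL2 pk (ma_reg_L2 _ _ _)).
have ibu M' : L2 P (block_sum eps (ma_reg u M') K1 t) by exact: bL2.
have ibv M' : L2 P (block_sum eps (ma_reg v M') K2 t2) by exact: bL2.
have mX : measurable_fun setT X.
  apply: measurable_funD; last exact: measurable_cst.
  by apply: measurable_funD; exact: block_sum_meas.
have mXM M' : measurable_fun setT (XM M').
  apply: measurable_funD; last exact: measurable_cst.
  by apply: measurable_funD; [exact: L2_meas (ibu _)|exact: L2_meas (ibv _)].
have s1 := EE_cos_lip mX (mXM M).
have s2' := EE_cos_lip (mXM M) (mXM m).
have s3 := hK0 K1 K2 g K01 K02 t; rewrite -/t2 in s3.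
pose E0 := expR (- (s2 / 2 * (reg_var u + reg_var v))) * cos c.
pose Em := expR (- (s2 / 2 * (v_ u m + v_ v m))) * cos c.
have -> : EE P (fun w => cos (X w)) - E0 =
  (EE P (fun w => cos (X w)) - EE P (fun w => cos (XM M w))) +
  ((EE P (fun w => cos (XM M w)) - EE P (fun w => cos (XM m w))) +
  ((EE P (fun w => cos (XM m w)) - Em) + (Em - E0))) by ring.
apply: le_trans (ler_normD _ _) _; apply: lerD.
  apply: le_trans s1 _; rewrite ler_wpM2l// le_eqVlt; apply/orP; left; apply/eqP.
  by congr d0; apply/funext => w; rewrite /X /XM; ring.
have -> : eta = eta / 2 + (eta / 4 + eta / 4) by field.
apply: le_trans (ler_normD _ _) _; apply: lerD.
  apply: le_trans s2' _.
  have i1 : L1 P (fun w => block_sum eps (ma_reg u M) K1 t w -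
      block_sum eps (ma_reg u m) K1 t w) by apply: L1B; exact: L2_L1.
  have i2 : L1 P (fun w => block_sum eps (ma_reg v M) K2 t2 w -
      block_sum eps (ma_reg v m) K2 t2 w) by apply: L1B; exact: L2_L1.
  rewrite (_ : (fun w => XM M w - XM m w) = fun w =>
    (block_sum eps (ma_reg u M) K1 t w - block_sum eps (ma_reg u m) K1 t w) +
    (block_sum eps (ma_reg v M) K2 t2 w - block_sum eps (ma_reg v m) K2 t2 w)); last first.
    by apply/funext => w; rewrite /XM; ring.
  have b1 := le_trans (d0_EE i1) (block_sum_diff u t th0 Kp1 mM).
  have b2 := le_trans (d0_EE i2) (block_sum_diff v t2 th0 Kp2 mM).
  have bb := d0D P (L1_meas i1) (L1_meas i2).
  have vu : v_ u M - v_ u m <= e1.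
    by apply: le_trans (hu m (leqnn m)); rewrite lerB// ma_var_le.
  have vv : v_ v M - v_ v m <= e1.
    by apply: le_trans (hv m (leqnn m)); rewrite lerB// ma_var_le.
  have se : s2 * e1 <= eta ^+ 2 / 128.
    apply: (@le_trans _ _ (s2 * (eta ^+ 2 / (128 * (s2 + 1))))).
      by rewrite ler_wpM2l// ge_min lexx.
    rewrite mulrA ler_pdivrMr ?mulr_gt0 ?ltr_wpDl//.
    have e2 := sqr_ge0 eta.
    have -> : eta ^+ 2 / 128 * (128 * (s2 + 1)) = s2 * eta ^+ 2 + eta ^+ 2 by field.
    lra.
  have bnd x : x <= e1 -> s2 * x / (2 * theta) <= eta / 16.
    move=> xe; rewrite ler_pdivrMr ?mulr_gt0//.
    have : s2 * x <= s2 * e1 by rewrite ler_wpM2l.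
    have -> : eta / 16 * (2 * theta) = eta ^+ 2 / 128 by rewrite /theta; field.
    lra.
  have := bnd _ vu; have := bnd _ vv.
  have : theta = eta / 16 by [].
  lra.
apply: le_trans (ler_normD _ _) _; apply: lerD; first exact: s3.
rewrite /Em /E0 -mulrBl normrM.
apply: (@le_trans _ _ `|expR (- (s2 / 2 * (v_ u m + v_ v m))) -
    expR (- (s2 / 2 * (reg_var u + reg_var v)))|).
  by rewrite ler_piMr// ler_norml cos_geN1 cos_le1.
have vu0 := ma_var_ge0 u m; have vv0 := ma_var_ge0 v m.
have ru0 := reg_var_ge0 u; have rv0 := reg_var_ge0 v.
apply: le_trans (expRN_lip _ _) _.
- by rewrite mulr_ge0 ?divr_ge0// addr_ge0.
- by rewrite mulr_ge0 ?divr_ge0// addr_ge0.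
have hum := hu m (leqnn m); have hvm := hv m (leqnn m).
have vu1 := ma_var_le u m; have vv1 := ma_var_le v m.
rewrite -mulrBr normrM ger0_norm ?divr_ge0// distrC ger0_norm; last by lra.
apply: (@le_trans _ _ (s2 / 2 * (2 * e1))).
  by rewrite ler_wpM2l ?divr_ge0//; lra.
have -> : s2 / 2 * (2 * e1) = s2 * e1 by field.
apply: (@le_trans _ _ (s2 * (eta / (4 * (s2 + 1))))).
  by rewrite ler_wpM2l// ge_min lexx orbT.
rewrite mulrA ler_pdivrMr ?mulr_gt0 ?ltr_wpDl//.
have -> : eta / 4 * (4 * (s2 + 1)) = s2 * eta + eta by field.
lra.
Qed.

End ARProcess.

(** * Trigonometric approximation and weak convergence *)

Section CosineKernel.
Context (R : realType).
Implicit Types x y z c : R.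

(** Sums over n equidistant points of the circle take the place of integrals; they are exact for
    trigonometric polynomials of degree below n. *)
Definition node (n j : nat) : R := 2 * pi * j%:R / n%:R - pi.

Definition half_cos (x : R) : R := (1 + cos x) / 2.

Lemma half_cos_ge0 x : 0 <= half_cos x.
Proof. by rewrite /half_cos; have := cos_geN1 x; lra. Qed.

(** Multiplied by 2 sin (pi k / n), which is positive for 0 < k < n, the sum telescopes, and its two
    end values differ by k full periods. *)
Lemma sum_cos_nodes (n k : nat) c : (0 < k < n)%N ->
  \sum_(j < n) cos (k%:R * - node n j + c) = 0.
Proof.
move=> /andP[k0 kn]; have nn := ltn_trans k0 kn.
have n0 : 0 < n%:R :> R by rewrite ltr0n.
pose th : R := pi * k%:R / n%:R.
have sth : 0 < sin th.
  apply: sin_gt0_pi; rewrite /th divr_gt0 ?mulr_gt0 ?pi_gt0 ?ltr0n//=.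
  by rewrite ltr_pdivrMr// ltr_pM2l ?pi_gt0// ltr_nat.
pose a : R := k%:R * pi + c.
pose S (j : nat) : R := sin (a + th - 2 * th * j%:R).
have step j : 2 * sin th * cos (k%:R * - node n j + c) = S j - S j.+1.
  have -> : k%:R * - node n j + c = a - 2 * th * j%:R.
    by rewrite /node /a /th; field; rewrite gt_eqF.
  rewrite /S; set b := a - 2 * th * j%:R.
  have -> : a + th - 2 * th * j%:R = b + th by rewrite /b; ring.
  have -> : a + th - 2 * th * j.+1%:R = b - th by rewrite /b -natr1; ring.
  by rewrite sinD sinB; ring.
have : \sum_(j < n) (2 * sin th * cos (k%:R * - node n j + c)) = 0.
  under eq_bigr do rewrite step.
  rewrite -(big_mkord xpredT (fun j => S j - S j.+1)).
  rewrite (@telescope_sumr_eq _ _ _ (fun j => - S j)) //; last first.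
    by move=> j _; rewrite opprK addrC.
  have e : a + th = (a + th - 2 * th * n%:R) + pi *+ 2 *+ k.
    by rewrite -(mulr_natr _ k) -(mulr_natr pi 2) /th; field; rewrite gt_eqF.
  have -> : S 0 = S n by rewrite /S mulr0 subr0 {1}e periodicn//; exact: sinD2pi.
  by rewrite subrr.
rewrite -mulr_sumr => /eqP; rewrite mulf_eq0 => /orP[|/eqP //].
by rewrite mulf_eq0 pnatr_eq0 (gt_eqF sth).
Qed.

Definition half_cos_sum (n m k : nat) c x : R :=
  \sum_(j < n) half_cos (x - node n j) ^+ m * cos (k%:R * (x - node n j) + c).

(** Each factor [half_cos] spreads a frequency k over k - 1, k and k + 1, so all frequencies stay at
    most m + k, hence below n, and only frequency 0 survives the sum. *)
Lemma half_cos_sum_const n m k c x y : (m + k < n)%N ->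
  half_cos_sum n m k c x = half_cos_sum n m k c y.
Proof.
elim: m k c => [|m IH] k c mkn.
  suff h z : half_cos_sum n 0 k c z = (k == 0%N)%:R * (n%:R * cos c) by rewrite !h.
  rewrite /half_cos_sum; case: (posnP k) => [->|k0].
    rewrite mul1r (eq_bigr (fun=> cos c)); last by move=> j _; rewrite expr0 !mul0r add0r mul1r.
    by rewrite sumr_const card_ord mulr_natl.
  rewrite mul0r -[RHS](@sum_cos_nodes n k (k%:R * z + c)); last by rewrite k0.
  by apply: eq_bigr => j _; rewrite expr0 mul1r; congr cos; ring.
(* For k = 0 the frequency -1 is written as frequency 1 with phase - c. *)
have step z : half_cos_sum n m.+1 k c z = 2^-1 * half_cos_sum n m k c z +
    4^-1 * half_cos_sum n m k.+1 c z +
    4^-1 * (if k is k'.+1 then half_cos_sum n m k' c z else half_cos_sum n m 1 (- c) z).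
  rewrite /half_cos_sum; case: k mkn => [|k] mkn; rewrite !mulr_sumr -!big_split /=;
    apply: eq_bigr => j _; set t := z - node n j; rewrite exprSr; set p := _ ^+ m.
    rewrite mulr0n mulr1n !mul0r !add0r !mul1r /half_cos (cosD t c) (cosB t c).
    by field.
  have -> : k.+2%:R * t + c = (k.+1%:R * t + c) + t by rewrite -[k.+2%:R]natr1; ring.
  have -> : k%:R * t + c = (k.+1%:R * t + c) - t by rewrite -[k.+1%:R]natr1; ring.
  by rewrite /half_cos (cosD (k.+1%:R * t + c) t) (cosB (k.+1%:R * t + c) t); field.
rewrite !step; congr (_ + _ + _).
- by congr (_ * _); apply: IH; lia.
- by congr (_ * _); apply: IH; lia.
- by congr (_ * _); case: k mkn {step} => [|k] mkn; apply: IH; lia.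
Qed.

Definition kernel_mass n m : R := \sum_(j < n) half_cos (- node n j) ^+ m.

Lemma half_cos_sumE n m x : (m < n)%N ->
  \sum_(j < n) half_cos (x - node n j) ^+ m = kernel_mass n m.
Proof.
move=> mn; have := @half_cos_sum_const n m 0 0 x 0.
rewrite addn0 => /(_ mn); rewrite /half_cos_sum /kernel_mass.
under eq_bigr do rewrite mul0r addr0 cos0 mulr1.
by under [X in _ = X -> _]eq_bigr do rewrite mul0r addr0 cos0 mulr1 sub0r.
Qed.

Lemma kernel_mass_gt0 n m : (m < n)%N -> 0 < kernel_mass n m.
Proof.
move=> mn; have n0 : (0 < n)%N by exact: leq_ltn_trans mn.
rewrite -(half_cos_sumE (node n 0) mn) (bigD1 (Ordinal n0)) //= subrr.
rewrite {1}/half_cos cos0 divff ?expr1n //.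
rewrite ltr_wpDr//; apply: sumr_ge0 => j _; apply: exprn_ge0; exact: half_cos_ge0.
Qed.

(* The sum of sin * half_cos^m over the nodes does not depend on x, so the sum
   of its derivatives vanishes. *)
Lemma kernel_mass_recr n m : (m.+1 < n)%N ->
  (2 * m%:R + 2) * kernel_mass n m.+1 = (2 * m%:R + 1) * kernel_mass n m.
Proof.
move=> mn; pose F (x : R) := \sum_(j < n) sin (x - node n j) * half_cos (x - node n j) ^+ m.
have Fc x : F x = F 0.
  (* The sine is the frequency 1 with phase - pi / 2. *)
  have := @half_cos_sum_const n m 1 (- (pi / 2)) x 0; rewrite addn1 => /(_ mn).
  rewrite /half_cos_sum /F => h.
  have e y : \sum_(j < n) sin (y - node n j) * half_cos (y - node n j) ^+ m =
     \sum_(j < n) half_cos (y - node n j) ^+ m * cos (1%:R * (y - node n j) + - (pi / 2)).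
    by apply: eq_bigr => j _; rewrite mul1r cosBpihalf mulrC.
  by rewrite !e.
have dF x : is_derive x (1 : R) F (\sum_(j < n)
    ((2 * m%:R + 2) * half_cos (x - node n j) ^+ m.+1 -
     (2 * m%:R + 1) * half_cos (x - node n j) ^+ m)).
  pose G (j : 'I_n) : R -> R :=
    (sin \o shift (- node n j)) * (half_cos \o shift (- node n j)) ^+ m.
  have -> : F = \sum_(j < n) G j.
    apply/funext => y; rewrite fct_sumE; apply: eq_bigr => j _.
    by rewrite /G /= -[RHS]/(_ * _) exprfctE.
  apply: is_derive_sum => j.
  have dhc (z : R) : is_derive z (1 : R) half_cos (- sin z / 2).
    have -> : half_cos = 2^-1 \*: (cst 1 + cos) :> (R -> R).
      by apply/funext => y; rewrite /half_cos /= -[RHS]/(_ * (1 + cos y)) mulrC.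
    by apply: is_derive_eq; rewrite add0r -[LHS]/(_ * _) mulrC.
  have d1 := is_derive1_comp (is_derive_sin (shift (- node n j) x))
    (is_derive_shift x (1 : R) (- node n j)).
  have d2 := is_derive1_comp (dhc (shift (- node n j) x))
    (is_derive_shift x (1 : R) (- node n j)).
  apply: (is_derive_eq (is_deriveM d1 (is_deriveX m d2))).
  rewrite -![_ *: _]/(_ * _) exprfctE /= !mulr1; move: (x - node n j) => t.
  have -> : cos t = 2 * half_cos t - 1 by rewrite /half_cos; field.
  have s2 : sin t ^+ 2 = 4 * half_cos t * (1 - half_cos t).
    by rewrite sin2cos2 /half_cos; field.
  move: s2; clear; case: m => [|m'] s2; first by rewrite mul0r mul0r mulr0 expr0 expr1; ring.
  rewrite /= !exprSr -natr1.
  set h := half_cos t in s2 *; set q := h ^+ m'.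
  have -> : sin t * ((m'%:R + 1) * q * (- sin t / 2)) =
    - (sin t ^+ 2) * ((m'%:R + 1) * q / 2) by field.
  by rewrite s2; field.
have Fcst : F = cst (F 0) by apply/funext => y; exact: Fc.
have d0 : 'D_1 F 0 = 0 by rewrite Fcst derive_cst.
have := @derive_val _ _ _ _ _ _ _ (dF 0); rewrite d0 => /esym.
rewrite sumrB -!mulr_sumr (half_cos_sumE _ mn) (half_cos_sumE _ (ltnW mn)) => /eqP.
by rewrite subr_eq0 => /eqP.
Qed.

End CosineKernel.

Section TrigPoly.
Context (R : realType) (d : nat).
Implicit Types (g h : 'rV[R]_d -> R) (w x y : 'rV[R]_d).

(** The phase c accounts for the sines, so that the class is closed under products by the
    product-to-sum formula. *)
Inductive trig_poly : ('rV[R]_d -> R) -> Prop :=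
| trig_cos w (c : R) : trig_poly (fun x => cos (dotrv w x + c))
| trig_add g h : trig_poly g -> trig_poly h -> trig_poly (fun x => g x + h x)
| trig_scale (a : R) g : trig_poly g -> trig_poly (fun x => a * g x).

Lemma dotrv0 x : dotrv 0 x = 0.
Proof. by rewrite /dotrv big1// => i _; rewrite mxE mul0r. Qed.

Lemma dotrvDl w w' x : dotrv (w + w') x = dotrv w x + dotrv w' x.
Proof.
by rewrite /dotrv -big_split /=; apply: eq_bigr => i _; rewrite mxE mulrDl.
Qed.

Lemma dotrvZl a w x : dotrv (a *: w) x = a * dotrv w x.
Proof.
by rewrite /dotrv mulr_sumr; apply: eq_bigr => i _; rewrite mxE mulrA.
Qed.

Lemma dotrv_delta (i : 'I_d) x : dotrv (delta_mx ord0 i) x = x ord0 i.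
Proof.
rewrite /dotrv (bigD1 i)//= mxE !eqxx mul1r big1 ?addr0// => j ji.
by rewrite mxE (negbTE ji) andbF mul0r.
Qed.

Lemma trig_ext g h : g =1 h -> trig_poly g -> trig_poly h.
Proof. by move=> /funext ->. Qed.

Lemma trig_cst a : trig_poly (fun=> a).
Proof.
apply: trig_ext (trig_scale a (trig_cos 0 0)) => x.
by rewrite dotrv0 addr0 cos0 mulr1.
Qed.

Lemma trig_mul g h : trig_poly g -> trig_poly h -> trig_poly (fun x => g x * h x).
Proof.
move=> tg; elim: tg h => [w c|g1 g2 t1 IH1 t2 IH2|a g1 t1 IH1] h th.
- elim: th => [w' c'|h1 h2 t1 IH1 t2 IH2|a h1 t1 IH1].
  + have := trig_add (trig_scale 2^-1 (trig_cos (w + w') (c + c')))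
      (trig_scale 2^-1 (trig_cos (w + (-1) *: w') (c - c'))).
    apply: trig_ext => x; rewrite !dotrvDl dotrvZl.
    have -> : dotrv w x + dotrv w' x + (c + c') = (dotrv w x + c) + (dotrv w' x + c').
      by ring.
    have -> : dotrv w x + -1 * dotrv w' x + (c - c') = (dotrv w x + c) - (dotrv w' x + c').
      by ring.
    rewrite (cosD (dotrv w x + c) (dotrv w' x + c')).
    by rewrite (cosB (dotrv w x + c) (dotrv w' x + c')); field.
  + by apply: trig_ext (trig_add IH1 IH2) => x; rewrite mulrDr.
  + by apply: trig_ext (trig_scale a IH1) => x; ring.
- by apply: trig_ext (trig_add (IH1 h th) (IH2 h th)) => x; rewrite mulrDl.
- by apply: trig_ext (trig_scale a (IH1 h th)) => x; ring.
Qed.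

Lemma trig_sum (I : Type) (s : seq I) (F : I -> 'rV[R]_d -> R) :
  (forall i, trig_poly (F i)) -> trig_poly (fun x => \sum_(i <- s) F i x).
Proof.
move=> tF; elim: s => [|i s IH].
  by apply: trig_ext (trig_cst 0) => x; rewrite big_nil.
by apply: trig_ext (trig_add (tF i) IH) => x; rewrite big_cons.
Qed.

Lemma trig_prod (I : Type) (s : seq I) (F : I -> 'rV[R]_d -> R) :
  (forall i, trig_poly (F i)) -> trig_poly (fun x => \prod_(i <- s) F i x).
Proof.
move=> tF; elim: s => [|i s IH].
  by apply: trig_ext (trig_cst 1) => x; rewrite big_nil.
by apply: trig_ext (trig_mul (tF i) IH) => x; rewrite big_cons.
Qed.

Lemma trig_exp g m : trig_poly g -> trig_poly (fun x => g x ^+ m).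
Proof.
move=> tg; elim: m => [|m IH].
  by apply: trig_ext (trig_cst 1) => x; rewrite expr0.
by apply: trig_ext (trig_mul tg IH) => x; rewrite exprS.
Qed.

(** Only x is confined to the box: y will be an interpolation node, which may lie outside it. *)
Lemma unif_cont_box (f : 'rV[R]_d -> R) (B eta : R) : continuous f -> 0 < eta ->
  exists2 delta : R, 0 < delta & forall x y, (forall i, `|x ord0 i| <= B) ->
    (forall i, `|x ord0 i - y ord0 i| < delta) -> `|f x - f y| <= eta.
Proof.
move=> cf eta0.
have cpt : compact [set x : 'rV[R]_d | forall i, `[(- B), B]%classic (x ord0 i)].
  by apply: (@rV_compact R d (fun=> `[(- B), B]%classic)) => i; exact: segment_compact.
have cov := proj1 (compact_near_coveringP _) cpt.
pose Q (delta : R) x := forall y, (forall i, `|x ord0 i - y ord0 i| < delta) ->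
  `|f x - f y| <= eta.
have : \forall delta \near (0 : R)^'+,
    [set x : 'rV[R]_d | forall i, `[(- B), B]%classic (x ord0 i)] `<=` Q delta.
  apply: cov => x _.
  have e2 : 0 < eta / 2 by lra.
  have /cvgrPdist_lt /(_ _ e2) := cf x => /nbhs_ballP[r /= r0 hr].
  have r2 : 0 < r / 2 by lra.
  exists (ball x (r / 2), [set delta | 0 < delta < r / 2]) => /=.
    split; first by apply: nbhsx_ballx.
    near=> delta; apply/andP; split; near: delta; first exact: nbhs_right_gt.
    exact: nbhs_right_lt.
  move=> [x' delta] /= [xx' /andP[d0 dr]] y x'y.
  have bx' : `|f x - f x'| < eta / 2.
    by apply: hr; apply: le_ball xx'; lra.
  have by' : `|f x - f y| < eta / 2.
    apply: hr; split => // i j; have [_ /(_ i j)] := xx'.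
    rewrite /ball /= !ord1 => h1.
    have := x'y j; rewrite -(ltrD2l `|x ord0 j - x' ord0 j|) => h2.
    have := ler_normD (x ord0 j - x' ord0 j) (x' ord0 j - y ord0 j).
    have -> : x ord0 j - x' ord0 j + (x' ord0 j - y ord0 j) = x ord0 j - y ord0 j.
      by ring.
    lra.
  have -> : f x' - f y = (f x - f y) - (f x - f x') by ring.
  by apply: le_trans (ler_normB _ _) _; lra.
move=> h; have hI : \forall delta \near (0 : R)^'+, 0 < delta /\
    [set x : 'rV[R]_d | forall i, `[(- B), B]%classic (x ord0 i)] `<=` Q delta.
  near=> delta; split; first by near: delta; exact: nbhs_right_gt.
  by near: delta.
have [delta [d0 hd]] := filter_ex hI.
exists delta => // x y xB xy; apply: hd => // i /=.
by rewrite in_itv /= -ler_norml.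
Unshelve. all: by end_near. Qed.

End TrigPoly.

Section TrigApprox.
Context (R : realType) (d : nat).

(** Up to 3 pi / 2 the point z is still at distance at least pi / 2, hence at least delta, from the
    next period. *)
Lemma cos_far (delta z : R) : 0 < delta <= pi / 2 -> delta <= `|z| <= 3 * pi / 2 ->
  1 - cos delta <= 1 - cos z.
Proof.
move=> /andP[d0 dpi] /andP[dz zpi]; have p0 := pi_gt0 R.
rewrite lerD2l lerN2.
have -> : cos z = cos `|z| by case: (ger0P z) => // _; rewrite cosN.
have [zp|zp] := leP `|z| pi.
  move: dz; rewrite le_eqVlt => /predU1P[<- //|dz].
  by rewrite ltW// ltr_cos// in_itv/=; apply/andP; split; lra.
apply: (@le_trans _ _ 0); last first.
  by apply: cos_ge0_pihalf; apply/andP; split; lra.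
have -> : `|z| = (`|z| - pi) + pi by ring.
rewrite cosDpi oppr_le0; apply: cos_ge0_pihalf; apply/andP; split; lra.
Qed.

Lemma one_sub_cos_gt0 (delta : R) : 0 < delta <= pi / 2 -> 0 < 1 - cos delta.
Proof.
move=> /andP[d0 dpi]; have p0 := pi_gt0 R.
rewrite subr_gt0 -[ltRHS]cos0 ltr_cos// in_itv/=; apply/andP; split; lra.
Qed.

Lemma sum_prod_weights (n : nat) (kap : 'I_d -> 'I_n -> R) :
  (forall i, \sum_(j < n) kap i j = 1) ->
  \sum_(J : {ffun 'I_d -> 'I_n}) \prod_i kap i (J i) = 1.
Proof. by move=> k1; rewrite -bigA_distr_bigA big1. Qed.

(** The products of the [kap] are the weights of a product probability, and a function of one index
    sees only its marginal. *)
Lemma sum_prod_marginal (n : nat) (kap : 'I_d -> 'I_n -> R) (i0 : 'I_d) (phi : 'I_n -> R) :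
  (forall i, \sum_(j < n) kap i j = 1) ->
  \sum_(J : {ffun 'I_d -> 'I_n}) (\prod_i kap i (J i)) * phi (J i0) =
  \sum_(j < n) kap i0 j * phi j.
Proof.
move=> k1; pose k' i j := if i == i0 then kap i j * phi j else kap i j.
rewrite (eq_bigr (fun J : {ffun 'I_d -> 'I_n} => \prod_i k' i (J i))); last first.
  move=> J _; rewrite (bigD1 i0)//= [in RHS](bigD1 i0)//= /k' eqxx mulrAC.
  by congr (_ * _); apply: eq_bigr => i ii0; rewrite (negbTE ii0).
rewrite -bigA_distr_bigA (bigD1 i0)//= [X in _ * X]big1 ?mulr1.
  by apply: eq_bigr => j _; rewrite /k' eqxx.
by move=> i ii0; rewrite -[RHS](k1 i); apply: eq_bigr => j _; rewrite /k' (negbTE ii0).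
Qed.

(* The approximant is the sum of f over the nodes against the product of the
   kernels ((1 + cos)/2)^m, a discrete version of de la Vallee Poussin's. *)
Lemma trig_approx (f : 'rV[R]_d -> R) (M B eta : R) : continuous f ->
  (forall x, `|f x| <= M) -> 0 < B -> 0 < eta ->
  exists g, [/\ trig_poly g, forall x : 'rV[R]_d, `|g x| <= M &
    forall x : 'rV[R]_d, (forall i, `|x ord0 i| <= B) -> `|f x - g x| <= eta].
Proof.
move=> cf fM B0 eta0; have p0 := pi_gt0 R.
have M0 : 0 <= M by apply: le_trans (fM 0); exact: normr_ge0.
have e2 : 0 < eta / 2 by lra.
have [delta0 d00 hd] := unif_cont_box B cf e2.
(* The box becomes half a period, [- pi / 2, pi / 2]; its distance to a node in [- pi, pi] is then
   at most 3 pi / 2, as [cos_far] requires. *)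
pose s := pi / (2 * B); have s0 : 0 < s by rewrite divr_gt0// mulr_gt0.
pose delta := Num.min (s * delta0) (pi / 2).
have dpi : 0 < delta <= pi / 2.
  by rewrite lt_min mulr_gt0//= divr_gt0//= ge_min lexx orbT.
have c0 := one_sub_cos_gt0 dpi.
(* Chebyshev: if a node is far from x in some coordinate, the error 2 M = C (1 - cos delta) is at
   most C times 1 - cos there. Summed over d coordinates against the weights, this gives C d / (m +
   1). *)
pose C := 2 * M / (1 - cos delta).
have C0 : 0 <= C by rewrite divr_ge0 ?mulr_ge0// ltW.
have [m hm] : exists m : nat, C * d%:R / m.+1%:R <= eta / 2.
  exists (Num.bound (C * d%:R / (eta / 2))).
  rewrite ler_pdivrMr// [leRHS]mulrC -ler_pdivrMr//.
  have h0 : 0 <= C * d%:R / (eta / 2) by rewrite divr_ge0 ?mulr_ge0// ltW.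
  by apply: (le_trans (ltW (archi_boundP h0))); rewrite ler_nat.
pose n := m.+2; have mn : (m.+1 < n)%N by [].
have K0 := kernel_mass_gt0 R (ltnW mn).
pose kap (y : R) (j : 'I_n) := half_cos (y - node R n j) ^+ m / kernel_mass R n m.
have kap0 y j : 0 <= kap y j.
  by rewrite divr_ge0 ?(ltW K0)// exprn_ge0// half_cos_ge0.
have kap1 y : \sum_(j < n) kap y j = 1.
  by rewrite -mulr_suml (half_cos_sumE _ (ltnW mn)) divff// gt_eqF.
(* 1 - cos = 2 (1 - [half_cos]), so the mean is 2 (1 - (2 m + 1) / (2 m + 2)) by the recurrence of
   the kernel masses. *)
have kapc y : \sum_(j < n) kap y j * (1 - cos (y - node R n j)) = m.+1%:R^-1.
  rewrite (eq_bigr (fun j : 'I_n => 2 / kernel_mass R n m *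
    (half_cos (y - node R n j) ^+ m - half_cos (y - node R n j) ^+ m.+1))); last first.
    move=> j _; rewrite /kap exprSr {2}/half_cos; set p := _ ^+ m; rewrite {1}/half_cos.
    by field; rewrite gt_eqF.
  rewrite -mulr_sumr sumrB (half_cos_sumE _ (ltnW mn)) (half_cos_sumE _ mn).
  have rec := kernel_mass_recr R mn.
  have m0 : 0 <= m%:R :> R by [].
  have -> : kernel_mass R n m.+1 = (2 * m%:R + 1) / (2 * m%:R + 2) * kernel_mass R n m.
    apply: (mulfI (x := 2 * m%:R + 2)); first by rewrite gt_eqF//; lra.
    by rewrite rec; field; rewrite gt_eqF//; lra.
  rewrite -natr1; field; rewrite gt_eqF//=; apply/andP; split; rewrite gt_eqF//; lra.
pose pt (J : {ffun 'I_d -> 'I_n}) : 'rV[R]_d := \row_i (node R n (J i) / s).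
pose g (x : 'rV[R]_d) := \sum_(J : {ffun 'I_d -> 'I_n}) f (pt J) *
  \prod_i kap (s * x ord0 i) (J i).
have w0 x (J : {ffun 'I_d -> 'I_n}) : 0 <= \prod_i kap (s * x ord0 i) (J i).
  by apply: prodr_ge0.
have w1 (x : 'rV[R]_d) : \sum_(J : {ffun 'I_d -> 'I_n}) \prod_i kap (s * x ord0 i) (J i) = 1.
  by apply: (sum_prod_weights (kap := fun i => kap (s * x ord0 i))).
exists g; split.
- apply: trig_sum => J; apply: trig_scale; apply: trig_prod => i.
  rewrite /kap; apply: trig_ext (trig_scale (kernel_mass R n m)^-1
    (trig_exp m (trig_add (trig_cst _ 2^-1) (trig_scale 2^-1
      (trig_cos (s *: delta_mx ord0 i) (- node R n (J i))))))) => x.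
  by rewrite dotrvZl dotrv_delta mulrC /half_cos; congr (_ ^+ _ / _); field.
- move=> x; apply: le_trans (ler_norm_sum _ _ _) _.
  rewrite [leRHS](_ : _ = M * \sum_(J : {ffun 'I_d -> 'I_n})
    \prod_i kap (s * x ord0 i) (J i)); last by rewrite w1 mulr1.
  rewrite mulr_sumr; apply: ler_sum => J _.
  rewrite normrM [X in _ * X <= _]ger0_norm//; by rewrite ler_wpM2r.
move=> x xB.
have -> : f x - g x = \sum_(J : {ffun 'I_d -> 'I_n})
    (f x - f (pt J)) * \prod_i kap (s * x ord0 i) (J i).
  under eq_bigr do rewrite mulrBl.
  by rewrite sumrB -mulr_sumr w1 mulr1.
have bnd (J : {ffun 'I_d -> 'I_n}) : `|f x - f (pt J)| <=
    eta / 2 + C * \sum_i (1 - cos (s * x ord0 i - node R n (J i))).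
  have cc z : 0 <= 1 - cos z :> R by rewrite subr_ge0 cos_le1.
  case: (pselect (forall i, `|x ord0 i - pt J ord0 i| < delta0)) => [near|far].
    apply: le_trans (hd _ _ xB near) _; rewrite lerDl mulr_ge0// sumr_ge0//.
  have [i /negP] : exists i, ~ (`|x ord0 i - pt J ord0 i| < delta0).
    by apply/existsNP.
  rewrite -leNgt mxE => far_i.
  apply: (@le_trans _ _ (2 * M)).
    apply: le_trans (ler_normB _ _) _; have := fM x; have := fM (pt J); lra.
  have -> : 2 * M = C * (1 - cos delta) by rewrite /C divfK// gt_eqF.
  apply: (@le_trans _ _ (C * (1 - cos (s * x ord0 i - node R n (J i))))); last first.
    rewrite (bigD1 i)//= [C * (_ + \sum_(_ | _) _)]mulrDr [leRHS]addrCA lerDl addr_ge0 ?(ltW e2)// mulr_ge0//.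
    by rewrite sumr_ge0.
  rewrite ler_wpM2l//; apply: cos_far => //; apply/andP; split.
    rewrite ge_min; apply/orP; left.
    have -> : s * x ord0 i - node R n (J i) = s * (x ord0 i - node R n (J i) / s).
      by rewrite mulrBr mulrCA divff ?mulr1// gt_eqF.
    by rewrite normrM (gtr0_norm s0) ler_pM2l.
  apply: le_trans (ler_normB _ _) _.
  have h1 : `|s * x ord0 i| <= pi / 2.
    rewrite normrM (gtr0_norm s0) /s; have := xB i.
    have -> : pi / 2 = pi / (2 * B) * B by field; rewrite gt_eqF.
    by move=> ?; rewrite ler_pM2l// divr_gt0// mulr_gt0.
  have h2 : `|node R n (J i)| <= pi.
    have j0 : 0 <= (J i)%:R / n%:R :> R by rewrite divr_ge0.
    have j1 : (J i)%:R / n%:R <= 1 :> R.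
      by rewrite ler_pdivrMr// mul1r ler_nat ltnW.
    rewrite /node -[2 * pi * _ / _]mulrA ler_norml; apply/andP; split; nra.
  lra.
apply: le_trans (ler_norm_sum _ _ _) _.
apply: (@le_trans _ _ (\sum_(J : {ffun 'I_d -> 'I_n})
   (eta / 2 + C * \sum_i (1 - cos (s * x ord0 i - node R n (J i)))) *
   \prod_i kap (s * x ord0 i) (J i))).
  apply: ler_sum => J _; rewrite normrM [X in _ * X <= _]ger0_norm//.
  by rewrite ler_wpM2r.
under eq_bigr do rewrite mulrDl.
rewrite big_split /= -mulr_sumr w1 mulr1.
have -> : \sum_(J : {ffun 'I_d -> 'I_n}) C * (\sum_i (1 - cos (s * x ord0 i - node R n (J i)))) *
   (\prod_i kap (s * x ord0 i) (J i)) = C * d%:R / m.+1%:R.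
  under eq_bigr do rewrite -mulrA mulr_suml.
  rewrite -mulr_sumr exchange_big /= -mulrA; congr (_ * _).
  rewrite (eq_bigr (fun=> m.+1%:R^-1)); last first.
    move=> i _; rewrite -(kapc (s * x ord0 i)).
    rewrite -(sum_prod_marginal (kap := fun i => kap (s * x ord0 i)) i
      (fun j => 1 - cos (s * x ord0 i - node R n j)))//.
    by apply: eq_bigr => J _; rewrite mulrC.
  by rewrite sumr_const card_ord mulr_natl.
by rewrite [leRHS](_ : eta = eta / 2 + eta / 2) ?lerD2l//; field.
Qed.

End TrigApprox.

(** * Weak convergence from convergence of cosine transforms *)

Section WeakConvergence.
Context (R : realType) (k : nat).
Implicit Types (f g : 'rV[R]_k -> R).

Definition coord_measurable dT (T : measurableType dT) (X : T -> 'rV[R]_k) :=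
  forall i, measurable_fun setT (fun w => X w ord0 i).

Section Measurability.
Context dT (T : measurableType dT) (P : probability T R).
Variables (X : T -> 'rV[R]_k) (mX : coord_measurable X).

Lemma dotrv_measurable w : measurable_fun setT (fun t => dotrv w (X t)).
Proof. by apply: measurable_sum => i; exact: measurable_funM. Qed.

Lemma trig_measurable g : trig_poly g -> measurable_fun setT (fun w => g (X w)).
Proof.
elim=> [w c|g1 g2 _ m1 _ m2|a g1 _ m1].
- apply: measurableT_comp; first exact: measurable_cosR.
  by apply: measurable_funD; [exact: dotrv_measurable|exact: measurable_cst].
- exact: measurable_funD.
- exact: measurable_funM.
Qed.

(** f(X) is the pointwise limit of trigonometric polynomials in X, taken within 1 / (n + 1) of f on
    boxes of side growing with n; measurability of the coordinates thus suffices. *)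
Lemma continuous_measurable f (M : R) : continuous f -> (forall x : 'rV[R]_k, `|f x| <= M) ->
  measurable_fun setT (fun w => f (X w)).
Proof.
move=> cf fM.
have /choice[g hg] : forall n : nat, exists g, [/\ trig_poly g, forall x : 'rV[R]_k, `|g x| <= M &
    forall x : 'rV[R]_k, (forall i, `|x ord0 i| <= n.+1%:R) -> `|f x - g x| <= n.+1%:R^-1].
  by move=> n; apply: trig_approx => //; rewrite invr_gt0.
apply: (measurable_fun_cvg (h := fun n w => g n (X w))).
  by move=> n; apply: trig_measurable; have [] := hg n.
move=> w _; apply/cvgrPdist_le => e e0.
have [B hB] : exists B : nat, forall i, `|X w ord0 i| <= B%:R.
  exists (\max_i Num.bound `|X w ord0 i|) => i.
  apply: (le_trans (ltW (archi_boundP (normr_ge0 _)))).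
  by rewrite ler_nat; exact: (leq_bigmax i).
have [N hN] : exists N : nat, e^-1 <= N%:R.
  by exists (Num.bound e^-1); apply/ltW/archi_boundP; rewrite invr_ge0 ltW.
exists (maxn B N) => // n /=; rewrite geq_max => /andP[Bn Nn].
have [_ _ h] := hg n; apply: le_trans (h _ _) _.
  by move=> i; apply: le_trans (hB i) _; rewrite ler_nat leqW.
rewrite invf_ple ?posrE//; apply: le_trans hN _; rewrite ler_nat leqW//.
Qed.

(** Bounds the probability of leaving the box of radius B, since min (1, |x| / B) is 1 outside
    it. *)
Definition coord_tail (B : R) := \sum_(i < k) d0 P (fun w => B^-1 * X w ord0 i).

Lemma EE_trig_approx f g (M B eta : R) : continuous f -> 0 < B -> 0 <= eta ->
  (forall x : 'rV[R]_k, `|f x| <= M) -> trig_poly g -> (forall x : 'rV[R]_k, `|g x| <= M) ->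
  (forall x : 'rV[R]_k, (forall i, `|x ord0 i| <= B) -> `|f x - g x| <= eta) ->
  `|EE P (fun w => f (X w)) - EE P (fun w => g (X w))| <= eta + 2 * M * coord_tail B.
Proof.
move=> cf B0 eta0 fM tg gM fg.
have M0 : 0 <= M by apply: le_trans (fM 0); exact: normr_ge0.
have if_ : L1 P (fun w => f (X w)).
  by apply: (L1_bounded P (B := M)) => //; exact: continuous_measurable cf fM.
have ig : L1 P (fun w => g (X w)).
  by apply: (L1_bounded P (B := M)) => //; exact: trig_measurable.
have im i : L1 P (fun w => Num.min 1 `|B^-1 * X w ord0 i|).
  by apply: L1_min1; exact: measurable_funM.
have is_ : L1 P (fun w => \sum_(i < k) Num.min 1 `|B^-1 * X w ord0 i|).
  exact: L1_sum.
rewrite -EEB//; apply: le_trans (EE_abs _) _; first exact: L1B.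
rewrite /coord_tail /d0 -EE_sum// -EEZ// -[X in X + _](EE_cst P).
rewrite -EED; [|exact: L1_cst|exact: L1Z].
apply: EE_le; [exact/L1_norm/L1B|by apply: L1D; [exact: L1_cst|exact: L1Z]|].
move=> w; have s0 : 0 <= \sum_(i < k) Num.min 1 `|B^-1 * X w ord0 i|.
  by apply: sumr_ge0 => i _; exact: min1_ge0.
case: (pselect (forall i, `|X w ord0 i| <= B)) => [/fg h|/existsNP [i /negP]].
  by apply: le_trans h _; rewrite lerDl mulr_ge0// mulr_ge0.
rewrite -ltNge => Xi.
apply: (@le_trans _ _ (2 * M)).
  by apply: le_trans (ler_normB _ _) _; have := fM (X w); have := gM (X w); lra.
rewrite -[leLHS]add0r; apply: lerD => //; rewrite ler_peMr ?mulr_ge0//.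
rewrite (bigD1 i)//= -[leLHS]addr0; apply: lerD.
  rewrite le_min lexx/= normrM (gtr0_norm (x := B^-1)) ?invr_gt0// mulrC.
  by rewrite ler_pdivlMr// mul1r ltW.
by apply: sumr_ge0 => j _; exact: min1_ge0.
Qed.

(** [B] is asked to exceed a given [B1] because in [weak_cvg] the same box must serve the sequence
    and its limit. *)
Lemma coord_tail_small (B1 eta : R) : 0 < eta ->
  exists2 B, B1 <= B & coord_tail B <= eta.
Proof.
move=> eta0.
have cv : \sum_(i < k) d0 P (fun w => j.+1%:R^-1 * X w ord0 i) @[j --> \oo] -->
    \sum_(i < k) (0 : R).
  by apply: cvgn_sum => i; apply: d0_scale_cvg0 => //; exact: cvg_harmonic.
rewrite big1 in cv => //; move/cvgrPdist_le: cv => /(_ _ eta0) [J _ hJ].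
pose J' := maxn J (Num.bound B1).
exists J'.+1%:R.
  have [B10|/ltW B10] := leP 0 B1; last exact: le_trans B10 _.
  apply: (le_trans (ltW (archi_boundP B10))).
  by rewrite ler_nat leqW// leq_maxr.
have := hJ J' (leq_maxl _ _); rewrite /= sub0r normrN; apply: le_trans.
exact: ler_norm.
Qed.

End Measurability.

(** On a box carrying most of every law involved, f is within e / 8 of a trigonometric polynomial
    bounded by the same M; outside the box the error is at most 2 M times the tail. *)
Lemma weak_cvg dT dT' (T : measurableType dT) (T' : measurableType dT')
    (P : probability T R) (Q : probability T' R)
    (X : nat -> T -> 'rV[R]_k) (G : T' -> 'rV[R]_k) :
  (forall N, coord_measurable (X N)) -> coord_measurable G ->
  (forall (w : 'rV[R]_k) (c : R), EE P (fun t => cos (dotrv w (X N t) + c)) @[N --> \oo] -->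
     EE Q (fun t => cos (dotrv w (G t) + c))) ->
  (forall eta : R, 0 < eta -> exists2 B : R, 0 < B &
     \forall N \near \oo, coord_tail P (X N) B <= eta) ->
  forall f (M : R), continuous f -> (forall x : 'rV[R]_k, `|f x| <= M) ->
  EE P (fun t => f (X N t)) @[N --> \oo] --> EE Q (fun t => f (G t)).
Proof.
move=> mX mG hcos tight f M cf fM.
have M0 : 0 <= M by apply: le_trans (fM 0); exact: normr_ge0.
have htrig g : trig_poly g ->
    EE P (fun t => g (X N t)) @[N --> \oo] --> EE Q (fun t => g (G t)).
  have it dS (S : measurableType dS) (P' : probability S R) (X' : S -> 'rV[R]_k) g' :
      coord_measurable X' -> trig_poly g' -> L1 P' (fun t => g' (X' t)).
    move=> mX' tg; have [B gB] : exists B : R, forall x : 'rV[R]_k, `|g' x| <= B.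
      elim: tg => [w c|g1 g2 _ [B1 h1] _ [B2 h2]|a g1 _ [B1 h1]].
      - by exists 1 => x; rewrite ler_norml cos_geN1 cos_le1.
      - by exists (B1 + B2) => x; apply: le_trans (ler_normD _ _) _; exact: lerD.
      - by exists (`|a| * B1) => x; rewrite normrM ler_wpM2l.
    by apply: (L1_bounded P' (B := B)) => //; exact: trig_measurable.
  elim=> [w c|g1 g2 t1 h1 t2 h2|a g1 t1 h1].
  - exact: hcos.
  - rewrite EED; [|exact: it..].
    under eq_fun do (rewrite EED; [|exact: it..]).
    exact: cvgD.
  - rewrite EEZ; last exact: it.
    under eq_fun do (rewrite EEZ; last exact: it).
    exact: cvgMr.
apply/cvgrPdist_le => e e0.
have e8 : 0 < e / (8 * (M + 1)) by rewrite divr_gt0// mulr_gt0// ltr_wpDl.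
have [B1 B10 hB1] := tight _ e8.
have [B2 B2B1 hB2] := coord_tail_small Q mG B1 e8.
have B20 : 0 < B2 by exact: lt_le_trans B2B1.
have e4 : 0 < e / 8 by lra.
have [g [tg gM fg]] := trig_approx cf fM B20 e4.
have hG := EE_trig_approx Q mG cf B20 (ltW e4) fM tg gM fg.
have hg := htrig g tg; move/cvgrPdist_le: hg => /(_ _ e4) hg.
near=> N.
have hX := EE_trig_approx P (mX N) cf B20 (ltW e4) fM tg gM fg.
have tX : coord_tail P (X N) B2 <= e / (8 * (M + 1)).
  apply: (@le_trans _ _ (coord_tail P (X N) B1)); last by near: N.
  apply: ler_sum => i _; apply: d0_le => [||w].
  - by apply: measurable_funM => //; exact: mX.
  - by apply: measurable_funM => //; exact: mX.
  - rewrite !normrM ler_wpM2r// !ger0_norm ?invr_ge0 ?(ltW B10) ?(ltW B20)//.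
    by rewrite lef_pV2 ?posrE.
have gN : `|EE Q (fun t => g (G t)) - EE P (fun t => g (X N t))| <= e / 8 by near: N.
have eM : 2 * M * (e / (8 * (M + 1))) <= e / 4.
  have -> : 2 * M * (e / (8 * (M + 1))) = M / (M + 1) * (e / 4) by field; lra.
  by rewrite ler_piMl//; [lra|rewrite ler_pdivrMr ?mul1r; lra].
have tX' : 2 * M * coord_tail P (X N) B2 <= e / 4.
  by apply: le_trans eM; rewrite ler_wpM2l// mulr_ge0.
have tG' : 2 * M * coord_tail Q G B2 <= e / 4.
  by apply: le_trans eM; rewrite ler_wpM2l// mulr_ge0.
have -> : EE Q (fun t => f (G t)) - EE P (fun t => f (X N t)) =
  (EE Q (fun t => f (G t)) - EE Q (fun t => g (G t))) +
  ((EE Q (fun t => g (G t)) - EE P (fun t => g (X N t))) -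
  (EE P (fun t => f (X N t)) - EE P (fun t => g (X N t)))) by ring.
apply: le_trans (ler_normD _ _) _; apply: le_trans (lerD (lexx _) (ler_normB _ _)) _.
lra.
Unshelve. all: by end_near. Qed.

End WeakConvergence.

(** * Gaussian vectors *)

Lemma Rintegral_derivative_eq0 (R : realType) (F f : R -> R) :
  (forall x : R, is_derive x (1 : R) F (f x)) -> continuous f ->
  (@lebesgue_measure R).-integrable setT (EFin \o f) ->
  F n%:R - F (- n%:R) @[n --> \oo] --> 0 ->
  \int[@lebesgue_measure R]_x f x = 0.
Proof.
move=> dF cf if_ F0; pose mu : {measure set _ -> \bar R} := @lebesgue_measure R.
have dF1 x : derivable F x 1 by have [] := dF x.
have cF : continuous F by move=> x; exact/differentiable_continuous/derivable1_diffP.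
have mf : measurable_fun setT f by apply/measurable_EFinP; exact: measurable_int if_.
(* n + 1 keeps the interval nondegenerate for the fundamental theorem of calculus. *)
pose A (n : nat) : set R := `[- n.+1%:R, n.+1%:R]%classic.
have h1 : (\int[mu]_(x in A n) (f x)%:E)%E @[n --> \oo] --> (\int[mu]_x (f x)%:E)%E.
  under eq_fun do rewrite integral_mkcond.
  apply: (@dominated_cvg _ _ _ mu setT measurableT _ _ (fun x => `|(f x)%:E|%E)) => //.
  - move=> n; apply/(measurable_restrictT _ _).1 => //; first exact: measurable_itv.
    by apply: measurable_funTS; exact/measurable_EFinP.
  - move=> x _; apply: (@cvg_near_cst _ _ _ _ _ _) .
    exists (Num.bound `|x|) => // n /= nx; rewrite patchE mem_set//.
    rewrite /A /= in_itv/= -ler_norml; apply: (le_trans (ltW (archi_boundP (normr_ge0 x)))).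
    by rewrite ler_nat leqW.
  - exact: integrable_abse.
  - by move=> n x _; rewrite patchE; case: ifP => // _; rewrite abse0.
have h2 : (\int[mu]_(x in A n) (f x)%:E)%E @[n --> \oo] --> 0%E.
  rewrite (_ : (fun n => _) = (fun n => (F n.+1%:R - F (- n.+1%:R))%:E)); last first.
    apply/funext => n; rewrite (continuous_FTC2 (F := F))//.
    - by rewrite gtrN.
    - exact: continuous_subspaceT.
    - by split=> [x _ //||]; [exact/cvg_at_right_filter/cF|exact/cvg_at_left_filter/cF].
    - by move=> x _; rewrite derive1E; exact: derive_val.
  apply: cvg_EFin; first exact: nearW.
  by rewrite (cvg_shiftS (fun n => F n%:R - F (- n%:R))).
by rewrite /Rintegral (cvg_unique (@ereal_hausdorff R) h1 h2).
Qed.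

Section NormalTransform.
Context (R : realType) (s : R).
Hypothesis s0 : 0 < s.
Let mu : {measure set _ -> \bar R} := @lebesgue_measure R.
Let p : R -> R := normal_pdf 0 s.
Let s'0 : s != 0. Proof. by rewrite gt_eqF. Qed.

Let pE x : p x = normal_peak s * expR (- x ^+ 2 / (2 * s ^+ 2)).
Proof. by rewrite /p normal_pdfE// /normal_fun subr0 -[s ^+ 2 *+ 2]mulr_natl. Qed.

Let p_ge0 x : 0 <= p x. Proof. exact: normal_pdf_ge0. Qed.

Let mp : measurable_fun setT p. Proof. exact: measurable_normal_pdf. Qed.

Let dp (x : R) : is_derive x (1 : R) p (- (x / s ^+ 2) * p x).
Proof.
have -> : p = (fun x => normal_peak s * expR ((- (2 * s ^+ 2)^-1) * x ^+ 2)).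
  by apply/funext => y; rewrite pE; congr (_ * expR _); field.
apply: is_derive_eq; rewrite /GRing.scale/=.
by field.
Qed.

(** The variance is doubled: half of the exponent of [p] pays for the factor |x|, by |x| <= s (1 +
    y) <= s exp y with y = x^2 / (4 s^2). The density [q] of deviation [r] then dominates the
    integrand under differentiation in t. *)
Let r := Num.sqrt 2 * s.
Let q := normal_pdf 0 r.
Let C := s * (normal_peak s / normal_peak r).

Let r0 : r != 0. Proof. by rewrite mulf_neq0// gt_eqF// sqrtr_gt0. Qed.

Let abs_p_le x : `|x| * p x <= C * q x.
Proof.
have r2 : r ^+ 2 = 2 * s ^+ 2 by rewrite exprMn sqr_sqrtr.
have pr := normal_peak_gt0 r0; have ps := normal_peak_gt0 s'0.
rewrite pE /q normal_pdfE// /normal_fun subr0 -[r ^+ 2 *+ 2]mulr_natl r2 /C.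
have -> : s * (normal_peak s / normal_peak r) *
    (normal_peak r * expR (- x ^+ 2 / (2 * (2 * s ^+ 2)))) =
    normal_peak s * (s * expR (- x ^+ 2 / (2 * (2 * s ^+ 2)))) by field; rewrite gt_eqF.
rewrite mulrCA ler_pM2l//.
set y := x ^+ 2 / (4 * s ^+ 2).
have -> : - x ^+ 2 / (2 * s ^+ 2) = - y + - y by rewrite /y; field.
have -> : - x ^+ 2 / (2 * (2 * s ^+ 2)) = - y by rewrite /y; field.
rewrite expRD mulrA ler_pM2r ?expR_gt0// expRN ler_pdivrMr ?expR_gt0//.
apply: (@le_trans _ _ (s * (1 + y))); last by rewrite ler_pM2l// expR_ge1Dx.
have -> : s * (1 + y) = `|x| + s * (`|x| / (2 * s) - 1) ^+ 2.
  have -> : y = `|x| ^+ 2 / (4 * s ^+ 2) by rewrite /y real_normK// num_real.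
  by field.
by rewrite lerDl mulr_ge0 ?sqr_ge0// ltW.
Qed.

Let ip : mu.-integrable setT (EFin \o p). Proof. exact: integrable_normal_pdf. Qed.

Let C0 : 0 <= C. Proof. by rewrite mulr_ge0 ?divr_ge0 ?normal_peak_ge0// ltW. Qed.

Let iq : mu.-integrable setT (EFin \o (fun x => C * q x)).
Proof.
rewrite (_ : _ \o _ = (fun x => C%:E * (q x)%:E)%E); last by apply/funext.
exact/integrableZl/integrable_normal_pdf.
Qed.

Let bounded_integrable (f : R -> R) : measurable_fun setT f -> (forall x, `|f x| <= 1) ->
  mu.-integrable setT (EFin \o (fun x => f x * p x)).
Proof.
move=> mf f1; apply: (le_integrable _ _ _ ip) => //.
  by apply/measurable_EFinP; exact: measurable_funM.
by move=> x _ /=; rewrite lee_fin normrM ler_piMl.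
Qed.

Let linear_integrable (f : R -> R) : measurable_fun setT f -> (forall x, `|f x| <= `|x|) ->
  mu.-integrable setT (EFin \o (fun x => f x * p x)).
Proof.
move=> mf f1; apply: (le_integrable _ _ _ iq) => //.
  by apply/measurable_EFinP; exact: measurable_funM.
move=> x _ /=; rewrite lee_fin normrM (ger0_norm (p_ge0 x)).
apply: le_trans (ler_norm _); apply: le_trans (abs_p_le x).
by rewrite ler_wpM2r.
Qed.

Let mcos t c : measurable_fun setT (fun x : R => cos (t * x + c)).
Proof. by apply: measurableT_comp; [exact: measurable_cosR|exact: measurable_funD]. Qed.

Let msin t c : measurable_fun setT (fun x : R => sin (t * x + c)).
Proof. by apply: measurableT_comp; [exact: measurable_sinR|exact: measurable_funD]. Qed.

Let msin' t c : measurable_fun setT (fun x : R => - x * sin (t * x + c)).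
Proof. by apply: measurable_funM; [exact: measurable_funN|exact: msin]. Qed.

Let J c t := \int[mu]_x (cos (t * x + c) * p x).

Let dJ (c t : R) : is_derive t (1 : R) (J c) (\int[mu]_x (- x * sin (t * x + c) * p x)).
Proof.
have d1 (u x : R) : is_derive u (1 : R) (fun u : R => cos (u * x + c) * p x)
    (- x * sin (u * x + c) * p x).
  by apply: is_derive_eq; rewrite /GRing.scale/=; ring.
have d1E : partial1of2 (fun u x : R => cos (u * x + c) * p x) =
    (fun u x : R => - x * sin (u * x + c) * p x).
  by apply/funext => u; apply/funext => x; rewrite partial1of2E; exact: derive_val.
have It : `]t - 1, t + 1[%classic t by rewrite /= in_itv/=; apply/andP; split; lra.
have cv : h^-1 *: (J c (h + t) - J c t) @[h --> 0^'] -->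
    \int[mu]_x (- x * sin (t * x + c) * p x).
  have := @cvg_differentiation_under_integral R _ _ mu
    (fun u x : R => cos (u * x + c) * p x) setT measurableT t (t - 1) (t + 1) It _ _
    (fun x => C * q x) _ iq.
  rewrite d1E; apply.
  - move=> u _; apply: bounded_integrable => // x; exact: cos_max.
  - by move=> u x _ _; exact: ex_derive.
  - by move=> x; rewrite mulr_ge0// normal_pdf_ge0.
  - move=> u x _ _; rewrite normrM (ger0_norm (p_ge0 x)).
    apply: le_trans (abs_p_le x); rewrite ler_wpM2r// normrM normrN.
    by rewrite ler_piMr// sin_max.
apply: DeriveDef.
  by apply/cvg_ex; eexists; rewrite /=; under eq_fun do rewrite scaler1; exact: cv.
by rewrite -derive1E; apply/cvg_lim.
Qed.

Let p_cvg0 : p n%:R @[n --> \oo] --> 0.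
Proof.
have pb (n : nat) : p n.+1%:R <= C * normal_peak r / n.+1%:R.
  rewrite ler_pdivlMr// mulrC -[X in X * _](normr_nat R).
  by apply: le_trans (abs_p_le _) _; rewrite ler_wpM2l// normal_pdf_ub.
rewrite -(cvg_shiftS (fun n => p n%:R)).
apply: (@squeeze_cvgr _ _ _ _ (cst 0) (fun n => C * normal_peak r * n.+1%:R^-1)).
- by apply: nearW => n; rewrite p_ge0 pb.
- exact: cvg_cst.
- rewrite -(mulr0 (C * normal_peak r)); apply: cvgMr; exact: cvg_harmonic.
Qed.

(** Integration by parts, using p' = - x p / s^2: the derivative of p(x) sin (t x + c) has integral
    0. *)
Let J_ode c t : \int[mu]_x (- x * sin (t * x + c) * p x) = - s ^+ 2 * t * J c t.
Proof.
have dF (x : R) : is_derive x (1 : R) (fun x : R => p x * sin (t * x + c))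
    (s ^- 2 * (- x * sin (t * x + c) * p x) + t * (cos (t * x + c) * p x)).
  have dpx := dp x; apply: is_derive_eq; rewrite /GRing.scale/=; field.
  by rewrite s'0.
have i1 : mu.-integrable setT (EFin \o (fun x => - x * sin (t * x + c) * p x)).
  by apply: linear_integrable => // x; rewrite normrM normrN ler_piMr// sin_max.
have i2 : mu.-integrable setT (EFin \o (fun x => cos (t * x + c) * p x)).
  by apply: bounded_integrable => // x; exact: cos_max.
have i1' : mu.-integrable setT (EFin \o (fun x => s ^- 2 * (- x * sin (t * x + c) * p x))).
  exact: integrableZl i1.
have i2' : mu.-integrable setT (EFin \o (fun x => t * (cos (t * x + c) * p x))).
  exact: integrableZl i2.
have cf : continuous (fun x : R => s ^- 2 * (- x * sin (t * x + c) * p x) + t * (cos (t * x + c) * p x)).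
  move=> x; have dpx := dp x; apply/differentiable_continuous/derivable1_diffP.
  exact: ex_derive.
have if_ : mu.-integrable setT (EFin \o (fun x => s ^- 2 * (- x * sin (t * x + c) * p x) +
    t * (cos (t * x + c) * p x))).
  by rewrite (_ : _ \o _ = (fun x => (s ^- 2 * (- x * sin (t * x + c) * p x))%:E +
    (t * (cos (t * x + c) * p x))%:E)%E); [exact: integrableD|apply/funext].
have F0 : p n%:R * sin (t * n%:R + c) - p (- n%:R) * sin (t * - n%:R + c) @[n --> \oo] --> 0.
  have pN x : p (- x) = p x by rewrite !pE sqrrN.
  under eq_fun do rewrite pN -mulrBr.
  apply/cvgr0Pnorm_le => e e0; move/cvgr0Pnorm_le : p_cvg0 => /(_ (e / 2)).
  rewrite divr_gt0// => /(_ isT); apply: filterS => n hn.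
  rewrite normrM; apply: (@le_trans _ _ (e / 2 * 2)); last by rewrite divfK.
  apply: ler_pM => //; apply: le_trans (ler_normB _ _) _.
  by apply: lerD; exact: sin_max.
have := Rintegral_derivative_eq0 dF cf if_ F0.
rewrite RintegralD// !RintegralZl// -/(J c t).
move/(congr1 (fun z => s ^+ 2 * z)); rewrite mulr0 mulrDr mulrA divff ?expf_eq0// mul1r.
by move/eqP; rewrite addr_eq0 => /eqP ->; rewrite !mulNr mulrA.
Qed.

Lemma EE_normal_bounded (f : R -> R) : measurable_fun setT f -> (forall x, `|f x| <= 1) ->
  EE (normal_prob 0 s) f = \int[mu]_x (f x * p x).
Proof.
move=> mf f1; congr fine.
have dom := normal_prob_dominates 0 s : normal_prob 0 s `<< mu.
have if_ : L1 (normal_prob 0 s) f by apply: (L1_bounded (normal_prob 0 s) (B := 1)).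
rewrite -(Radon_Nikodym_change_of_variables dom measurableT if_).
have RNi : mu.-integrable setT (Radon_Nikodym (charge_of_finite_measure (normal_prob 0 s)) mu).
  exact: Radon_Nikodym_integrable.
apply: ae_eq_integral => //.
- apply: emeasurable_funM; last exact: measurable_int RNi.
  exact/measurable_EFinP.
- by apply/measurable_EFinP; exact: measurable_funM.
under [in X in ae_eq _ _ _ X]eq_fun do rewrite EFinM.
apply: ae_eqe_mul2l; apply: integral_ae_eq => //; first exact/measurable_EFinP.
move=> E _ mE; rewrite -Radon_Nikodym_integral//.
Qed.

(** By [J_ode] the product of [J] with exp (s^2 t^2 / 2) has zero derivative, and at t = 0 it is cos
    c. *)
Lemma EE_normal_cos c t :
  EE (normal_prob 0 s) (fun x => cos (t * x + c)) = expR (- (s ^+ 2 * t ^+ 2 / 2)) * cos c.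
Proof.
rewrite EE_normal_bounded//; last by move=> x; exact: cos_max.
rewrite -/(J c t) expRN -[LHS](mulfK (x := expR (s ^+ 2 * t ^+ 2 / 2))) ?expR_eq0//.
rewrite mulrC; congr (_ * _).
pose K (u : R) := J c u * expR (s ^+ 2 / 2 * u ^+ 2).
have -> : J c t * expR (s ^+ 2 * t ^+ 2 / 2) = K t by rewrite /K; congr (_ * expR _); field.
have dK (u : R) : is_derive u (1 : R) K 0.
  have := dJ c u; rewrite J_ode => dJu.
  by apply: is_derive_eq; rewrite /GRing.scale/=; field.
rewrite (@is_derive_0_is_cst _ K t 0)// /K expr0n mulr0 expR0 mulr1 /J.
under eq_Rintegral do rewrite mul0r add0r.
by rewrite RintegralZl// /Rintegral integral_normal_pdf mulr1.
Qed.

End NormalTransform.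

(** * A law is determined by its cosine transform *)

Section LawUniqueness.
Context (R : realType) dT dT' (T : measurableType dT) (T' : measurableType dT')
  (P : probability T R) (Q : probability T' R).
Variables (X : T -> R) (X' : T' -> R).
Hypotheses (mX : measurable_fun setT X) (mX' : measurable_fun setT X').
Hypothesis XX' : forall t c, EE P (fun w => cos (t * X w + c)) =
  EE Q (fun w => cos (t * X' w + c)).

(** [weak_cvg] for the constant sequence [X], seen as vectors of length 1: a constant sequence
    equals its limit. *)
Let EE_continuous (f : R -> R) (M : R) : continuous f -> (forall x, `|f x| <= M) ->
  EE P (f \o X) = EE Q (f \o X').
Proof.
move=> cf fM; pose V dS (S : measurableType dS) (Z : S -> R) w : 'rV[R]_1 := const_mx (Z w).
have mV dS (S : measurableType dS) (Z : S -> R) :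
    measurable_fun setT Z -> coord_measurable (V _ _ Z).
  by move=> mZ i; under eq_fun do rewrite mxE.
pose F (x : 'rV[R]_1) := f (x ord0 ord0).
have cF : continuous F.
  by move=> x; apply: continuous_comp; [exact: coord_continuous|exact: cf].
have FE dS (S : measurableType dS) (Z : S -> R) : (fun w => F (V _ _ Z w)) = f \o Z.
  by apply/funext => w; rewrite /F mxE.
have dV dS (S : measurableType dS) (Z : S -> R) (u : 'rV_1) w :
    dotrv u (V _ _ Z w) = u ord0 ord0 * Z w.
  by rewrite /dotrv big_ord1 mxE.
have hcos (u : 'rV[R]_1) (c : R) : EE P (fun t => cos (dotrv u (V _ _ X t) + c)) @[N --> \oo] -->
    EE Q (fun t => cos (dotrv u (V _ _ X' t) + c)).
  rewrite (_ : (fun t => cos (dotrv u (V _ _ X t) + c)) =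
    (fun t => cos (u ord0 ord0 * X t + c))); last by apply/funext => w; rewrite dV.
  rewrite XX' (_ : (fun t => cos (dotrv u (V _ _ X' t) + c)) =
    (fun t => cos (u ord0 ord0 * X' t + c))); last by apply/funext => w; rewrite dV.
  exact: cvg_cst.
have tight (eta : R) : 0 < eta -> exists2 B : R, 0 < B &
    \forall N \near \oo, coord_tail P (V _ _ X) B <= eta.
  move=> eta0; have [B B1 hB] := coord_tail_small P (mV _ _ _ mX) 1 eta0.
  by exists B; [exact: lt_le_trans B1|exact: nearW].
have := weak_cvg (fun _ : nat => mV _ _ _ mX) (mV _ _ _ mX') hcos tight cF
  (fun x => fM _).
by rewrite !FE; apply: (cvg_unique (@Rhausdorff R) (cvg_cst _)).
Qed.

Lemma cos_law_unique A : measurable A -> P (X @^-1` A) = Q (X' @^-1` A).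
Proof.
pose lX : {mfun T >-> R} := HB.pack X (isMeasurableFun.Build _ _ _ _ _ mX).
pose lX' : {mfun T' >-> R} := HB.pack X' (isMeasurableFun.Build _ _ _ _ _ mX').
move=> mA; suff : distribution P lX A = distribution Q lX' A by [].
have ray (a : R) : P (X @^-1` `]a, +oo[) = Q (X' @^-1` `]a, +oo[).
  (* Continuous functions converging pointwise to the indicator of the open ray, with value 0 at a
     itself. *)
  pose f (n : nat) (x : R) := Num.min 1 (n%:R * Num.max 0 (x - a)).
  have f0 n x : 0 <= f n x by rewrite le_min ler01 mulr_ge0// le_max lexx.
  have f1 n x : `|f n x| <= 1 by rewrite ger0_norm// ge_min lexx.
  have cf n : continuous (f n).
    move=> x; apply: (@continuous_min _ _ (cst 1) (fun x => n%:R * Num.max 0 (x - a))).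
      exact: cvg_cst.
    apply: cvgMr; apply: (@continuous_max _ _ (cst 0) (fun x => x - a)).
      exact: cvg_cst.
    by apply: cvgB; [exact: cvg_id|exact: cvg_cst].
  have mf n : measurable_fun setT (f n) by exact: continuous_measurable_fun.
  have fcv x : f n x @[n --> \oo] --> (\1_(`]a, +oo[) x : R).
    rewrite indicE /= mem_setE/= in_itv/= andbT.
    have [ax|xa] := ltP a x; last first.
      rewrite (_ : (fun n => f n x) = cst 0); first exact: cvg_cst.
      by apply/funext => n; rewrite /f max_l ?subr_le0// mulr0 min_r.
    apply: cvg_near_cst; exists (Num.bound (x - a)^-1) => // n /= nx.
    rewrite /f max_r ?subr_ge0 1?ltW// min_l//.
    rewrite -ler_pdivrMr ?subr_gt0// mul1r.
    apply: (le_trans (ltW (archi_boundP _))); first by rewrite invr_ge0 subr_ge0 ltW.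
    by rewrite ler_nat.
  have fcvg dS (S : measurableType dS) (P' : probability S R) (Z : S -> R) :
      measurable_fun setT Z -> EE P' (f n \o Z) @[n --> \oo] --> fine (P' (Z @^-1` `]a, +oo[)).
    move=> mZ; have mB : measurable (Z @^-1` `]a, +oo[).
      by rewrite -[X in measurable X]setTI; exact: mZ.
    have -> : fine (P' (Z @^-1` `]a, +oo[)) = EE P' (\1_(`]a, +oo[) \o Z).
      rewrite /EE /Rintegral; congr fine.
      rewrite (_ : (fun x => _) = (fun x => (\1_(Z @^-1` `]a, +oo[) x)%:E)).
        by rewrite integral_indic// setIT.
      by apply/funext => w; rewrite /= !indicE.
    apply: (EE_dct (P := P') (Y := cst 1)).
    - by move=> n; exact: measurableT_comp.
    - by apply: measurableT_comp => //; exact: measurable_indic.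
    - exact: L1_cst.
    - by move=> n w; exact: f1.
    - by move=> w; exact: fcv.
  have h1 := fcvg _ _ P X mX; have h2 := fcvg _ _ Q X' mX'.
  have e12 : (fun n => EE P (f n \o X)) = (fun n => EE Q (f n \o X')).
    by apply/funext => n; exact: EE_continuous (cf n) (f1 n).
  rewrite e12 in h1.
  have e : fine (P (X @^-1` `]a, +oo[)) = fine (Q (X' @^-1` `]a, +oo[)).
    exact: (cvg_unique (@Rhausdorff R) h1 h2).
  have pre dS (S : measurableType dS) (Z : S -> R) :
    measurable_fun setT Z -> measurable (Z @^-1` `]a, +oo[).
    by move=> mZ; rewrite -[X in measurable X]setTI; exact: mZ.
  have p1 := pre _ _ X mX; have p2 := pre _ _ X' mX'.
  by rewrite -[LHS]fineK ?fin_num_measure// e fineK ?fin_num_measure.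
apply: (g_sigma_algebra_measure_unique_trace (@RGenOInfty.G R) setT) => //.
- by move=> _ [[x ->] _]; exact: measurable_itv.
- move=> _ _ [[x ->] _] [[y ->] _]; split => //.
  exists (Num.max x y); apply/seteqP; split => z /=; rewrite !in_itv/= !andbT gt_max.
    by move=> [-> ->].
  by move=> /andP.
- exact: (etrans (probability_setT (distribution P lX)) (esym (probability_setT (distribution Q lX')))).
- by move=> _ [[x ->] _]; exact: ray.
- by rewrite -ge0_fin_numE// fin_num_measure.
have -> : [set X | RGenOInfty.G X /\ X `<=` [set: R]] = @RGenOInfty.G R.
  by apply/seteqP; split => [B []|B cB].
have := congr1 (fun F => F A) (RGenOInfty.measurableE R).
by move=> e; have : (@ocitv R).-sigma.-measurable A := mA; rewrite e.
Qed.

End LawUniqueness.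

Section ProductCos.
Context (R : realType) d1 d2 (T1 : measurableType d1) (T2 : measurableType d2).
Variables (Q1 : probability T1 R) (Q2 : probability T2 R).

Let prod_setT : (Q1 \x Q2)%E setT = 1%E.
Proof.
rewrite -setXTT; transitivity (Q1 setT * Q2 setT)%E; first exact: product_measure1E.
by rewrite !probability_setT mule1.
Qed.

Definition prod_prob : probability (T1 * T2)%type R :=
  HB.pack (Q1 \x Q2)%E (Measure_isProbability.Build _ _ _ _ prod_setT).

Lemma prod_probE A B : measurable A -> measurable B ->
  prod_prob (A `*` B) = (Q1 A * Q2 B)%E.
Proof. exact: product_measure1E. Qed.

Lemma prod_prob_fst A : measurable A -> prod_prob (fst @^-1` A) = Q1 A.
Proof.
move=> mA; have -> : fst @^-1` A = A `*` [set: T2] by apply/seteqP; split=> z //= [].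
by rewrite prod_probE// probability_setT mule1.
Qed.

Lemma prod_prob_snd A : measurable A -> prod_prob (snd @^-1` A) = Q2 A.
Proof.
move=> mA; have -> : snd @^-1` A = [set: T1] `*` A by apply/seteqP; split=> z //= [].
by rewrite prod_probE// probability_setT mul1e.
Qed.

Variables (X1 : T1 -> R) (X2 : T2 -> R) (a1 a2 : R).
Hypotheses (mX1 : measurable_fun setT X1) (mX2 : measurable_fun setT X2).
Hypothesis X1E : forall c, EE Q1 (fun w => cos (X1 w + c)) = a1 * cos c.
Hypothesis X2E : forall c, EE Q2 (fun w => cos (X2 w + c)) = a2 * cos c.

(** [X1E] for every phase says that E cos X1 = a1 and E sin X1 = 0. Then the addition formula and
    the independence of the two coordinates apply, the sine being a cosine with phase - pi / 2. *)
Lemma EE_prod_cos c :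
  EE prod_prob (fun z => cos (X1 z.1 + X2 z.2 + c)) = a1 * a2 * cos c.
Proof.
have mc b : measurable_fun setT (fun x : R => cos (x + b)).
  by apply: measurableT_comp; [exact: measurable_cosR|exact: measurable_funD].
have L1c d (T : measurableType d) (P : probability T R) (Z : T -> R) b :
    measurable_fun setT Z -> L1 P (fun w => cos (Z w + b)).
  move=> mZ; apply: (L1_bounded P (B := 1)); last by move=> w; exact: cos_max.
  by apply: (measurableT_comp (mc b)).
have mY1 : measurable_fun setT (fun z : T1 * T2 => X1 z.1).
  by apply: (measurableT_comp mX1); exact: measurable_fst.
have mY2 : measurable_fun setT (fun z : T1 * T2 => X2 z.2).
  by apply: (measurableT_comp mX2); exact: measurable_snd.
have E1 b : EE prod_prob (fun z => cos (X1 z.1 + b)) = a1 * cos b.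
  rewrite -X1E; apply: (EE_same_law mY1 mX1 _ (g := fun x => cos (x + b))) => //.
    move=> A mA; rewrite -(prod_prob_fst (A := X1 @^-1` A))//.
    by rewrite -[X in measurable X]setTI; exact: mX1.
  exact: L1c.
have E2 b : EE prod_prob (fun z => cos (X2 z.2 + b)) = a2 * cos b.
  rewrite -X2E; apply: (EE_same_law mY2 mX2 _ (g := fun x => cos (x + b))) => //.
    move=> A mA; rewrite -(prod_prob_snd (A := X2 @^-1` A))//.
    by rewrite -[X in measurable X]setTI; exact: mX2.
  exact: L1c.
have ind A B : measurable A -> measurable B ->
    prod_prob ((fun z => X1 z.1) @^-1` A `&` (fun z => X2 z.2) @^-1` B) =
    (prod_prob ((fun z => X1 z.1) @^-1` A) * prod_prob ((fun z => X2 z.2) @^-1` B))%E.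
  move=> mA mB.
  have mA' : measurable (X1 @^-1` A) by rewrite -[X in measurable X]setTI; exact: mX1.
  have mB' : measurable (X2 @^-1` B) by rewrite -[X in measurable X]setTI; exact: mX2.
  by rewrite [in RHS](prod_prob_fst mA') (prod_prob_snd mB') -prod_probE.
have sinE (x : R) : sin x = cos (x - pi / 2) by rewrite cosBpihalf.
rewrite (_ : (fun z => _) = (fun z => cos (X1 z.1 + c) * cos (X2 z.2 + 0) -
    cos (X1 z.1 + (c - pi / 2)) * cos (X2 z.2 + (0 - pi / 2)))); last first.
  apply/funext => z; rewrite [X1 z.1 + (c - _)]addrA [X2 z.2 + (0 - _)]addrA -!sinE.
  by rewrite !addr0 addrAC [LHS]cosD.
have Im b b' : L1 prod_prob (fun z => cos (X1 z.1 + b) * cos (X2 z.2 + b')).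
  exact: (L1_indep_mul mY1 mY2 ind (mc b) (mc b') (L1c _ _ _ _ _ mY1) (L1c _ _ _ _ _ mY2)).
rewrite EEB//.
have Em b b' : EE prod_prob (fun z => cos (X1 z.1 + b) * cos (X2 z.2 + b')) =
    a1 * cos b * (a2 * cos b').
  rewrite -E1 -E2.
  exact: (EE_indep_mul mY1 mY2 ind (mc b) (mc b') (L1c _ _ _ _ _ mY1) (L1c _ _ _ _ _ mY2)).
by rewrite !Em -[cos (0 - _)]sinE sin0 cos0; ring.
Qed.

End ProductCos.

Section GaussianSpace.
Context (R : realType).

Lemma gauss_space n : exists (d : measure_display) (T : measurableType d)
  (Q : probability T R) (xi : T -> 'rV[R]_n), coord_measurable xi /\
  forall u c, EE Q (fun w => cos (dotrv u (xi w) + c)) = expR (- (dotrv u u / 2)) * cos c.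
Proof.
elim: n => [|n [d [T [Q [xi [mxi xiE]]]]]].
  exists _, _, (normal_prob (0 : R) 1), (fun _ => 0); split=> [i //|u c].
  have dz (a b : 'rV[R]_0) : dotrv a b = 0 by rewrite /dotrv big_ord0.
  rewrite [dotrv u u]dz mul0r oppr0 expR0 mul1r.
  rewrite (_ : (fun=> _) = cst (cos c)) ?EE_cst//.
  by apply/funext => w; rewrite dz add0r.
pose xi' (z : T * R) : 'rV[R]_n.+1 :=
  \row_i (if unlift ord0 i is Some j then xi z.1 ord0 j else z.2).
exists _, _, (prod_prob Q (normal_prob (0 : R) 1)), xi'; split=> [i|u c].
  rewrite /xi'; under eq_fun do rewrite mxE.
  case: (unlift ord0 i) => [j|]; last exact: measurable_snd.
  by apply: (measurableT_comp (mxi j)); exact: measurable_fst.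
pose u' : 'rV[R]_n := \row_j u ord0 (lift ord0 j).
have dE z : dotrv u (xi' z) = dotrv u' (xi z.1) + u ord0 ord0 * z.2.
  rewrite /dotrv big_ord_recl mxE unlift_none addrC; congr (_ + _).
  by apply: eq_bigr => j _; rewrite !mxE liftK.
have uE : dotrv u u = dotrv u' u' + u ord0 ord0 ^+ 2.
  rewrite /dotrv big_ord_recl addrC -expr2; congr (_ + _).
  by apply: eq_bigr => j _; rewrite !mxE.
under [fun w => _]eq_fun do rewrite dE.
have -> : expR (- (dotrv u u / 2)) =
    expR (- (dotrv u' u' / 2)) * expR (- (1 ^+ 2 * u ord0 ord0 ^+ 2 / 2)).
  by rewrite -expRD uE; congr expR; field.
have := @EE_prod_cos R _ _ T _ Q (normal_prob (0 : R) 1) (fun w => dotrv u' (xi w))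
  (fun x : R => u ord0 ord0 * x) (expR (- (dotrv u' u' / 2)))
  (expR (- (1 ^+ 2 * u ord0 ord0 ^+ 2 / 2))).
apply.
- exact: dotrv_measurable.
- exact: measurable_funM.
- by move=> b; exact: xiE.
- by move=> b; exact: EE_normal_cos.
Qed.

(** A linear image of a standard Gaussian vector, taken on both factors of the product of its space
    with itself; independence is then the product rule on boxes. *)
Lemma gauss_pair k (B : 'M[R]_k) (q := fun u : 'rV[R]_k => dotrv (u *m B) (u *m B)) :
  exists (d : measure_display) (T : measurableType d) (Q : probability T R)
    (G1 G2 : T -> 'rV[R]_k),
  [/\ gaussian_vector Q G1, gaussian_vector Q G2, indep_vectors Q G1 G2 &
   forall u v c, EE Q (fun w => cos (dotrv u (G1 w) + dotrv v (G2 w) + c)) =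
     expR (- ((q u + q v) / 2)) * cos c].
Proof.
have [d [T [Q [xi [mxi xiE]]]]] := gauss_space k.
pose G w := xi w *m B^T.
have dG u w : dotrv u (G w) = dotrv (u *m B) (xi w).
  have dm (a b : 'rV[R]_k) : dotrv a b = (a *m b^T) ord0 ord0.
    by rewrite mxE; apply: eq_bigr => i _; rewrite mxE.
  by rewrite !dm /G trmx_mul trmxK mulmxA.
have mG : coord_measurable G.
  move=> i; rewrite /G; under eq_fun do rewrite mxE.
  by apply: measurable_sum => j; apply: measurable_funM => //; exact: mxi.
have q0 u : 0 <= q u by apply: sumr_ge0 => i _; rewrite -expr2 sqr_ge0.
have GE u c : EE Q (fun w => cos (dotrv u (G w) + c)) = expR (- (q u / 2)) * cos c.
  by under [fun w => _]eq_fun do rewrite dG; exact: xiE.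
have gauss dS (S : measurableType dS) (P : probability S R) (H : S -> 'rV[R]_k) :
    coord_measurable H ->
    (forall u c, EE P (fun w => cos (dotrv u (H w) + c)) = expR (- (q u / 2)) * cos c) ->
    gaussian_vector P H.
  move=> mH HE; split=> // u; exists 0, (q u); split=> // A mA.
  have HuE t c : EE P (fun w => cos (t * dotrv u (H w) + c)) =
      expR (- (q u * t ^+ 2 / 2)) * cos c.
    under [fun w => _]eq_fun do rewrite -dotrvZl.
    have -> : q u * t ^+ 2 = q (t *: u).
      rewrite /q -scalemxAl /dotrv mulr_suml; apply: eq_bigr => i _.
      by rewrite [in RHS]mxE; ring.
    exact: HE.
  have mu' : measurable_fun setT (fun w => dotrv u (H w)) by exact: dotrv_measurable.
  (* For zero variance [normal_law] is the point mass at the mean. *)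
  case: eqP => [qu0|/eqP qu0].
    transitivity (P ((fun _ => 0 : R) @^-1` A)).
      apply: (cos_law_unique mu' _ _ mA) => // t c.
      rewrite HuE qu0 mul0r mul0r oppr0 expR0 mul1r.
      rewrite (_ : (fun=> _) = cst (cos c)) ?EE_cst//.
      by apply/funext => w; rewrite /= mulr0 add0r.
    rewrite -[fun _ => 0]/(cst 0) preimage_cst indicE.
    by case: ifP; rewrite ?probability_setT ?measure0.
  transitivity (normal_prob 0 (Num.sqrt (q u)) ((fun x : R => x) @^-1` A)); last by [].
  apply: (cos_law_unique (Q := normal_prob 0 (Num.sqrt (q u))) mu' _ _ mA) => // t c.
  by rewrite HuE EE_normal_cos ?sqr_sqrtr// sqrtr_gt0 lt0r qu0 q0.
pose QQ := prod_prob Q Q.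
have m1 : coord_measurable (fun z : T * T => G z.1).
  by move=> i; apply: (measurableT_comp (mG i)); exact: measurable_fst.
have m2 : coord_measurable (fun z : T * T => G z.2).
  by move=> i; apply: (measurableT_comp (mG i)); exact: measurable_snd.
have E12 u v c : EE QQ (fun z => cos (dotrv u (G z.1) + dotrv v (G z.2) + c)) =
    expR (- ((q u + q v) / 2)) * cos c.
  have -> : expR (- ((q u + q v) / 2)) = expR (- (q u / 2)) * expR (- (q v / 2)).
    by rewrite -expRD; congr expR; field.
  by apply: (EE_prod_cos (X1 := fun w => dotrv u (G w)) (X2 := fun w => dotrv v (G w)));
    [exact: dotrv_measurable..|exact: GE|exact: GE].
have qq0 : q 0 = 0 by rewrite /q mul0mx dotrv0.
exists _, (T * T)%type, QQ, (fun z => G z.1), (fun z => G z.2); split=> //.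
- apply: gauss => // u c; rewrite -[X in expR (- (X / 2))]addr0 -qq0 -E12.
  by congr EE; apply/funext => z; rewrite dotrv0 addr0.
- apply: gauss => // u c; rewrite -[X in expR (- (X / 2))]add0r -qq0 -E12.
  by congr EE; apply/funext => z; rewrite dotrv0 add0r.
- move=> A A' mA mA'.
  have mbox (C : 'I_k -> set R) : (forall i, measurable (C i)) ->
      measurable [set w | forall i, C i (G w ord0 i)].
    move=> mC; rewrite (_ : [set w | _] = \bigcap_(i in [set: 'I_k]) (fun w => G w ord0 i) @^-1` C i).
      apply: fin_bigcap_measurable => // i _.
      by rewrite -[X in measurable X]setTI; exact: mG.
    by apply/seteqP; split=> w h i; [move=> _; exact: h|exact: h].
  have mA1 := mbox A mA; have mB1 := mbox A' mA'.
  rewrite [in RHS](prod_prob_fst Q Q mA1) (prod_prob_snd Q Q mB1) -prod_probE//.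
Qed.

End GaussianSpace.

(** * Quadratic forms and normal equations *)

Section PositiveDefinite.
Context (R : rcfType).

Definition pos_def k (S : 'M[R]_k) :=
  S^T = S /\ forall u : 'rV_k, u != 0 -> 0 < (u *m S *m u^T) ord0 ord0.

(** Cholesky factorization by the Schur complement of the first entry a. The complement is positive
    definite because its value at v is that of S at (x, v) with x = - v b^T / a. *)
Lemma pos_def_factor k (S : 'M[R]_k) : pos_def S ->
  exists B : 'M[R]_k, S = B *m B^T.
Proof.
elim: k S => [|k IH] S [symS posS]; first by exists 0; apply/matrixP => - [].
change k.+1 with (1 + k)%N in S, symS, posS |- *.
pose a := S ord0 ord0; pose b := ursubmx S; pose D := drsubmx S.
have ulS : ulsubmx S = a%:M.
  by rewrite [LHS]mx11_scalar !mxE; congr (S _ _)%:M; apply: val_inj.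
have dlS : dlsubmx S = b^T by rewrite -{1}symS -trmx_ursub.
have SE : S = block_mx a%:M b b^T D by rewrite -ulS -dlS submxK.
have symD : D^T = D by rewrite /D trmx_drsub symS.
have a0 : 0 < a.
  have d0 : delta_mx ord0 ord0 != 0 :> 'rV[R]_(1 + k).
    by apply/eqP => /rowP /(_ ord0); rewrite !mxE eqxx; exact/eqP/oner_neq0.
  by have := posS _ d0; rewrite -rowE trmx_delta -colE !mxE.
have a0' : a != 0 by rewrite gt_eqF.
have [|B' BE] := IH (D - a^-1 *: (b^T *m b)).
  split=> [|v v0].
    by rewrite linearB linearZ /= trmx_mul trmxK symD.
  pose x := - a^-1 *: (v *m b^T).
  have w0 : row_mx x v != 0 by rewrite row_mx_eq0 negb_and v0 orbT.
  have := posS _ w0; rewrite SE mul_row_block tr_row_mx mul_row_col.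
  rewrite mul_mx_scalar scalerA mulrN divff// scaleN1r addNr mul0mx add0r.
  suff -> : x *m b + v *m D = v *m (D - a^-1 *: (b^T *m b)) by [].
  by rewrite mulmxBr /x -scalemxAl -scalemxAr mulmxA scaleNr addrC.
pose r := Num.sqrt a.
have r0 : r != 0 by rewrite gt_eqF// sqrtr_gt0.
have rr : r * r = a by rewrite -expr2 sqr_sqrtr// ltW.
exists (block_mx r%:M 0 (r^-1 *: b^T) B').
rewrite tr_block_mx mulmx_block !tr_scalar_mx !trmx0 !mulmx0 !mul0mx !addr0.
rewrite SE; congr block_mx.
- by rewrite -scalar_mxM rr.
- by rewrite linearZ /= trmxK mul_scalar_mx scalerA divff// scale1r.
- by rewrite mul_mx_scalar scalerA divff// scale1r.
- rewrite linearZ /= trmxK -scalemxAl -scalemxAr scalerA -invfM rr -BE.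
  by rewrite addrC subrK.
Qed.

Lemma pos_def_unitmx k (S : 'M[R]_k) : pos_def S -> S \in unitmx.
Proof.
move=> [_ posS]; rewrite -row_free_unit; apply: inj_row_free => v vS.
apply/eqP/negPn/negP => /posS; by rewrite vS mul0mx mxE ltxx.
Qed.

Lemma pos_def_inv k (S : 'M[R]_k) : pos_def S -> pos_def (invmx S).
Proof.
move=> pS; have uS := pos_def_unitmx pS; have [symS posS] := pS; split.
  by rewrite trmx_inv symS.
move=> u u0; have v0 : u *m invmx S != 0.
  by apply: contra u0 => /eqP h; rewrite -(mulmxKV uS u) h mul0mx.
by have := posS _ v0; rewrite mulmxKV// trmx_mul trmx_inv symS mulmxA.
Qed.

Lemma pos_defZ k a (S : 'M[R]_k) : 0 < a -> pos_def S -> pos_def (a *: S).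
Proof.
move=> a0 [symS posS]; split; first by rewrite linearZ /= symS.
by move=> u /posS h; rewrite -scalemxAr -scalemxAl mxE mulr_gt0.
Qed.

End PositiveDefinite.

Section QuadraticForms.
Context (R : realType) (k : nat).
Implicit Types (q : 'rV[R]_k -> R) (u v a : 'rV[R]_k).

Lemma dotrvDr u v a : dotrv u (v + a) = dotrv u v + dotrv u a.
Proof. by rewrite /dotrv -big_split; apply: eq_bigr => i _; rewrite mxE mulrDr. Qed.

Lemma dotrvZr c u v : dotrv u (c *: v) = c * dotrv u v.
Proof. by rewrite /dotrv mulr_sumr; apply: eq_bigr => i _; rewrite mxE mulrCA. Qed.

Lemma dotrvC u v : dotrv u v = dotrv v u.
Proof. by apply: eq_bigr => i _; rewrite mulrC. Qed.

Lemma dotrv_mx u v : dotrv u v = (u *m v^T) ord0 ord0.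
Proof. by rewrite mxE; apply: eq_bigr => i _; rewrite mxE. Qed.

Definition polar q (i j : 'I_k) : R :=
  (q (delta_mx ord0 i + delta_mx ord0 j) - q (delta_mx ord0 i - delta_mx ord0 j)) / 4.

(** For each u a linear identity between finitely many values of q, hence stable under sums and
    pointwise limits. This is how [reg_var], defined as a limit, is found to come from a matrix. *)
Definition quadratic q := forall u, q u = \sum_i \sum_j u ord0 i * u ord0 j * polar q i j.

Lemma quadratic_sqr a : quadratic (fun u => dotrv u a ^+ 2).
Proof.
move=> u; rewrite expr2 {1}/dotrv mulr_suml; apply: eq_bigr => i _.
rewrite {1}/dotrv mulr_sumr; apply: eq_bigr => j _.
by rewrite /polar -[- delta_mx _ _]scaleN1r !dotrvDl dotrvZl !dotrv_delta; field.
Qed.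

Lemma quadraticD q q' : quadratic q -> quadratic q' -> quadratic (fun u => q u + q' u).
Proof.
move=> hq hq' u; rewrite hq hq' -big_split; apply: eq_bigr => i _ /=.
by rewrite -big_split; apply: eq_bigr => j _ /=; rewrite /polar; field.
Qed.

Lemma quadraticZ c q : quadratic q -> quadratic (fun u => c * q u).
Proof.
move=> hq u; rewrite hq mulr_sumr; apply: eq_bigr => i _.
by rewrite mulr_sumr; apply: eq_bigr => j _; rewrite /polar; field.
Qed.

Lemma quadratic_sum n (q : 'I_n -> 'rV[R]_k -> R) : (forall l, quadratic (q l)) ->
  quadratic (fun u => \sum_(l < n) q l u).
Proof.
elim: n q => [|n IH] q hq.
  move=> u; rewrite big_ord0 big1// => i _; rewrite big1// => j _.
  by rewrite /polar !big_ord0 subrr mul0r mulr0.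
have -> : (fun u => \sum_(l < n.+1) q l u) =
    (fun u => q ord0 u + \sum_(l < n) q (lift ord0 l) u).
  by apply/funext => u; rewrite big_ord_recl.
by apply: quadraticD => //; exact: IH.
Qed.

Lemma quadratic_cvg (q : nat -> 'rV[R]_k -> R) q' : (forall m, quadratic (q m)) ->
  (forall u, q m u @[m --> \oo] --> q' u) -> quadratic q'.
Proof.
move=> hq qq' u; apply: (cvg_unique (@Rhausdorff R) (qq' u)).
have -> : (fun m => q m u) =
    (fun m => \sum_i \sum_j u ord0 i * u ord0 j * polar (q m) i j).
  by apply/funext => m; exact: hq.
apply: cvgn_sum => i; apply: cvgn_sum => j; apply: cvgMr.
by apply: cvgMl; apply: cvgB; exact: qq'.
Qed.

End QuadraticForms.

(** * Normal equations *)

Section LeastSquares.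
Context (R : realType) (L : nat).
Implicit Types (phi psi : 'rV[R]_L.+1) (y e : int -> R).

(** h = a / (b + 1) gives the value - a^2 (b + 2) / (b + 1)^2; the denominator b + 1 covers the case
    b = 0. *)
Lemma linear_term_eq0 (a b : R) : 0 <= b ->
  (forall h, 0 <= - (2 * h * a) + h ^+ 2 * b) -> a = 0.
Proof.
move=> b0 /(_ (a / (b + 1))) h.
have b1 : 0 < b + 1 by lra.
have e : - (2 * (a / (b + 1)) * a) + (a / (b + 1)) ^+ 2 * b =
    - (a ^+ 2 * ((b + 2) / (b + 1) ^+ 2)) by field; rewrite gt_eqF.
move: h; rewrite e oppr_ge0 pmulr_lle0 ?divr_gt0 ?exprn_gt0//; last by lra.
by move=> h; apply/eqP; rewrite -sqrf_eq0 eq_le h sqr_ge0.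
Qed.

Lemma ls_normal_equations y a b phi (i : 'I_L.+1) : is_ls_estimate L y a b phi ->
  \sum_(a + L <= n < b.+1) (y n%:Z - dotrv (regressor L y n%:Z) phi) *
    regressor L y n%:Z ord0 i = 0.
Proof.
move=> ls; pose x (n : nat) := regressor L y n%:Z ord0 i.
pose r (n : nat) := y n%:Z - dotrv (regressor L y n%:Z) phi.
apply: (@linear_term_eq0 _ (\sum_(a + L <= n < b.+1) x n ^+ 2)).
  by apply: sumr_ge0 => n _; exact: sqr_ge0.
move=> h; have := ls (phi + h *: delta_mx ord0 i).
rewrite /ls_objective -subr_ge0 -sumrB; move/le_trans; apply; rewrite le_eqVlt.
apply/orP; left; apply/eqP; rewrite !mulr_sumr -sumrN -big_split; apply: eq_bigr => n _ /=.
rewrite dotrvDr dotrvZr [dotrv _ (delta_mx _ _)]dotrvC dotrv_delta -/(x n).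
by rewrite -[y n%:Z - _ in RHS]/(r n) opprD addrA -/(r n); ring.
Qed.

Lemma ls_normal_ar psi y e a b phi (i : 'I_L.+1) :
  (forall n, y n = dotrv (regressor L y n) psi + e n) -> is_ls_estimate L y a b phi ->
  \sum_j (phi - psi) ord0 j * (\sum_(a + L <= n < b.+1)
    regressor L y n%:Z ord0 j * regressor L y n%:Z ord0 i) =
  \sum_(a + L <= n < b.+1) regressor L y n%:Z ord0 i * e n%:Z.
Proof.
move=> ar /(ls_normal_equations i) ne.
under eq_bigr do rewrite mulr_sumr; rewrite exchange_big /=.
apply/eqP; rewrite eq_sym -subr_eq0 -sumrB; apply/eqP; rewrite -[RHS]ne.
apply: eq_bigr => n _; rewrite ar.
have -> : \sum_(j < L.+1) (phi - psi) ord0 j * (regressor L y n ord0 j * regressor L y n ord0 i) =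
    (dotrv (regressor L y n) phi - dotrv (regressor L y n) psi) * regressor L y n ord0 i.
  rewrite /dotrv -sumrB mulr_suml; apply: eq_bigr => j _; rewrite !mxE; ring.
ring.
Qed.

End LeastSquares.

Lemma quadraticN (R : realType) k (q : 'rV[R]_k -> R) u : quadratic q -> q (- u) = q u.
Proof.
move=> hq; rewrite hq [RHS]hq; apply: eq_bigr => i _; apply: eq_bigr => j _.
by rewrite !mxE mulrNN.
Qed.

(** * The limit Gram matrix and the sample Gram matrix *)

Section GramMatrix.
Context d (Omega : measurableType d) (R : realType) (P : probability Omega R).
Context (L : nat) (psi : 'rV[R]_L.+1) (Y eps : int -> Omega -> R).
Hypotheses (causal : causal_filter psi) (mY : forall n, measurable_fun setT (Y n)).
Hypothesis stat : strictly_stationary P Y.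
Hypothesis ar : forall n w,
  Y n w = dotrv (regressor L (fun m => Y m w) n) psi + eps n w.
Hypothesis eiid : iid P eps.
Hypothesis eL2 : L2 P (eps 0).
Hypothesis e0 : EE P (eps 0) = 0.
Let s2 := EE P (fun w => eps 0 w ^+ 2).
Hypothesis s2_gt0 : 0 < s2.
Notation rv := (reg_var P psi eps).

Let ma_coef_dotrv l : exists a, forall u : 'rV[R]_L.+1, ma_coef psi u l = dotrv u a.
Proof.
exists (\row_j (if unlift ord0 j is Some i then
  if (i <= l)%N then impulse psi (l - i) else 0 else 0)) => u.
rewrite /dotrv big_ord_recl mxE unlift_none mulr0 add0r.
by apply: eq_bigr => i _; rewrite mxE liftK.
Qed.

Lemma reg_var_quadratic : quadratic rv.
Proof.
apply: (quadratic_cvg (q := fun m u =>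
  (u ord0 ord0 + psi ord0 ord0 * \sum_(l < m) ma_coef psi u l) ^+ 2 +
  s2 * \sum_(l < m) ma_coef psi u l ^+ 2)).
  have /choice[a ha] := ma_coef_dotrv.
  move=> m; apply: quadraticD.
    rewrite (_ : (fun u => _) = (fun u => dotrv u (delta_mx ord0 ord0 +
      psi ord0 ord0 *: \sum_(l < m) a l) ^+ 2)); first exact: quadratic_sqr.
    apply/funext => u; rewrite dotrvDr dotrvZr [dotrv _ (delta_mx _ _)]dotrvC dotrv_delta.
    congr ((_ + _ * _) ^+ 2); rewrite (eq_bigr (fun l : 'I_m => dotrv u (a l))) => [|l _].
      rewrite /dotrv exchange_big; apply: eq_bigr => j _.
      by rewrite summxE mulr_sumr.
    exact: ha.
  apply: quadraticZ; apply: quadratic_sum => l.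
  rewrite (_ : (fun u => _) = (fun u => dotrv u (a l) ^+ 2)); first exact: quadratic_sqr.
  by apply/funext => u; rewrite ha.
move=> u; have c1 := @ma_const_cvg _ _ _ causal u.
have c2 := @ma_var_cvg _ _ _ P _ _ eps causal u.
rewrite (_ : rv u = ma_const psi u ^+ 2 + (rv u - ma_const psi u ^+ 2)); last by ring.
apply: cvgD; first by rewrite !expr2; exact: cvgM.
rewrite (_ : (fun m => _) = (fun m => ma_var P eps (ma_const psi u) (ma_coef psi u) m -
  ma_const psi u ^+ 2)); first by apply: cvgB => //; exact: cvg_cst.
by apply/funext => m; rewrite /ma_var -/s2; ring.
Qed.

(** If the form vanishes, so do all coefficients [ma_coef]. They depend on the lag part of u through
    a triangular system with diagonal [impulse 0] = 1, so the lag part is 0; the constant term then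
    gives the intercept part. *)
Lemma reg_var_gt0 u : u != 0 -> 0 < rv u.
Proof.
move=> u0; rewrite lt_neqAle reg_var_ge0 // andbT; apply: contra u0 => /eqP rv0.
have le0 m : ma_const psi u ^+ 2 + s2 * \sum_(l < m) ma_coef psi u l ^+ 2 <= 0.
  by have := ma_var_le P eps causal u m; rewrite -rv0.
have S0 m : 0 <= s2 * \sum_(l < m) ma_coef psi u l ^+ 2.
  by rewrite mulr_ge0 ?(ltW s2_gt0)// sumr_ge0// => l _; exact: sqr_ge0.
have al0 l : ma_coef psi u l = 0.
  apply/eqP; rewrite -sqrf_eq0 eq_le sqr_ge0 andbT -(pmulr_rle0 _ s2_gt0).
  have := le0 l.+1; rewrite big_ord_recr /= mulrDr => h.
  have := S0 l; have := sqr_ge0 (ma_const psi u); lra.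
have c0 : ma_const psi u = 0.
  apply/eqP; rewrite -sqrf_eq0 eq_le sqr_ge0 andbT.
  by have := le0 0%N; rewrite big_ord0 mulr0 addr0.
have ui (i : 'I_L) : u ord0 (lift ord0 i) = 0.
  have [n] := ubnP i; elim: n i => // n IH i; rewrite ltnS => ni.
  have := al0 i; rewrite /ma_coef (bigD1 i)//= leqnn subnn mulr1 big1 ?addr0// => j ji.
  have [ij|ij] := leqP j i; last by rewrite mulr0.
  by rewrite IH ?mul0r//; apply: leq_trans ni; rewrite ltn_neqAle ij andbT.
have u00 : u ord0 ord0 = 0.
  rewrite -c0 /ma_const (_ : series _ = cst 0) ?lim_cst ?mulr0 ?addr0//.
  by apply/funext => m; rewrite /series /= big1// => l _; exact: al0.
apply/eqP/rowP => j; rewrite mxE.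
by have [i ->|->] := unliftP ord0 j.
Qed.

Definition gram : 'M[R]_L.+1 := \matrix_(i, j) polar rv i j.

Lemma gramE u : (u *m gram *m u^T) ord0 ord0 = rv u.
Proof.
rewrite [RHS]reg_var_quadratic -mulmxA mxE; apply: eq_bigr => i _.
rewrite mxE mulr_sumr; apply: eq_bigr => j _; rewrite !mxE; ring.
Qed.

Lemma gram_pos_def : pos_def gram.
Proof.
split=> [|u /reg_var_gt0]; last by rewrite gramE.
apply/matrixP => i j; rewrite !mxE /polar [delta_mx _ j + _]addrC.
by rewrite -[delta_mx _ j - _]opprB (quadraticN _ reg_var_quadratic).
Qed.

Definition sample_gram K t w : 'M[R]_L.+1 := \matrix_(i, j)
  avg (fun n w => lin_reg Y (delta_mx ord0 i) n w * lin_reg Y (delta_mx ord0 j) n w) K t w.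

Definition score K t w : 'rV[R]_L.+1 := \row_i block_sum eps (lin_reg Y (delta_mx ord0 i)) K t w.

(** Polarization: an entry is a quarter of the difference of two averaged squares, in the directions
    u + v and u - v. *)
Lemma sample_gram_cvg eta : 0 < eta -> exists K0 : nat, forall K, (K0 < K)%N ->
  forall t i j, d0 P (fun w => sample_gram K t w i j - gram i j) <= eta.
Proof.
move=> eta0; have eta2 : 0 < eta / 2 by lra.
have /choice[K0 hK] : forall p : 'I_L.+1 * 'I_L.+1, exists K0 : nat, forall K, (K0 < K)%N ->
    forall t, d0 P (fun w => sample_gram K t w p.1 p.2 - gram p.1 p.2) <= eta.
  move=> [i j]; set u := delta_mx ord0 i : 'rV[R]_L.+1; set v := delta_mx ord0 j : 'rV[R]_L.+1.
  have [K1 h1] := lln_reg_sqr causal mY stat ar eiid eL2 e0 (u + v) eta2.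
  have [K2 h2] := lln_reg_sqr causal mY stat ar eiid eL2 e0 (u - v) eta2.
  exists (maxn K1 K2) => K; rewrite gtn_max => /andP[K1K K2K] t /=.
  pose D z w := avg (fun n w => lin_reg Y z n w ^+ 2) K t w - rv z.
  have mD z : measurable_fun setT (D z).
    apply: measurable_funB => //; apply: avg_meas => n; apply: measurable_funX.
    exact: lin_reg_meas.
  have m4 c z : measurable_fun setT (fun w => c * D z w) by exact: measurable_funM.
  have lrD z z' n w : lin_reg Y (z + z') n w = lin_reg Y z n w + lin_reg Y z' n w.
    by rewrite /lin_reg dotrvDr.
  have lrN z n w : lin_reg Y (- z) n w = - lin_reg Y z n w.
    by rewrite /lin_reg -scaleN1r dotrvZr mulN1r.
  have -> : (fun w => sample_gram K t w i j - gram i j) =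
      (fun w => 4^-1 * D (u + v) w + - 4^-1 * D (u - v) w).
    apply/funext => w; rewrite !mxE /polar -/u -/v /D /avg.
    set s1 := \sum_(k < K) _; set s3 := \sum_(k < K) _; set s4 := \sum_(k < K) _.
    have -> : s1 = 4^-1 * s3 - 4^-1 * s4.
      rewrite /s1 /s3 /s4 !mulr_sumr -sumrB; apply: eq_bigr => k _.
      by rewrite !lrD lrN; field.
    field; rewrite pnatr_eq0; lia.
  apply: le_trans (d0D _ _ _) _ => //.
  rewrite (_ : eta = eta / 2 + eta / 2); last by field.
  apply: lerD.
    apply: le_trans (h1 K K1K t); apply: d0_le; [exact: m4|exact: mD|move=> w].
    by rewrite normrM ler_piMl// ger0_norm// invf_le1//; lra.
  apply: le_trans (h2 K K2K t); apply: d0_le; [exact: m4|exact: mD|move=> w].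
  by rewrite normrM ler_piMl// normrN ger0_norm// invf_le1//; lra.
exists (\max_p K0 p) => K hKK t i j; apply: (hK (i, j)).
by apply: leq_ltn_trans hKK; exact: (leq_bigmax (i, j)).
Qed.

(** The normal equations divided by sqrt K; [K] counts the terms of the objective, L fewer than the
    length of the stretch. *)
Lemma ls_score a b (phi : Omega -> 'rV[R]_L.+1) (K := (b.+1 - (a + L))%N) w : (0 < K)%N ->
  is_ls_estimate L (fun m => Y m w) a b (phi w) ->
  (Num.sqrt K%:R *: (phi w - psi)) *m sample_gram K (a + L)%:Z w = score K (a + L)%:Z w.
Proof.
move=> K0 /(ls_normal_ar) => /(_ psi (fun n => eps n w)) ne.
have shift (F : int -> R) : \sum_(a + L <= n < b.+1) F n%:Z =
    \sum_(k < K) F ((a + L)%:Z + k%:Z).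
  rewrite -{1}[(a + L)%N]add0n big_addn big_mkord; apply: eq_bigr => k _.
  by rewrite PoszD addrC.
have reg i n : regressor L (fun m => Y m w) n ord0 i = lin_reg Y (delta_mx ord0 i) n w.
  by rewrite /lin_reg dotrvC dotrv_delta.
have K0' : 0 < K%:R :> R by rewrite ltr0n.
apply/rowP => i; rewrite !mxE /block_sum.
have := ne i (ar^~ w).
rewrite (shift (fun n => regressor L (fun m => Y m w) n ord0 i * eps n w)) => ne'.
under [in RHS]eq_bigr do rewrite -reg.
rewrite -ne' mulr_sumr; apply: eq_bigr => j _; rewrite !mxE /avg.
rewrite (shift (fun n => regressor L (fun m => Y m w) n ord0 j *
  regressor L (fun m => Y m w) n ord0 i)).
under [in RHS]eq_bigr do rewrite !reg.
have s0 : Num.sqrt K%:R != 0 :> R by rewrite gt_eqF// sqrtr_gt0.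
by rewrite -{2}(sqr_sqrtr (ltW K0')); field.
Qed.

End GramMatrix.

(** * The least squares estimates *)

Section TruncatedNormSums.
Context d (T : measurableType d) (R : realType) (P : probability T R).

Lemma d0Z (c : R) (X : T -> R) : measurable_fun setT X ->
  d0 P (fun w => c * X w) <= (1 + `|c|) * d0 P X.
Proof.
move=> mX; rewrite /d0 -EEZ; last exact: L1_min1.
apply: EE_le; [by apply: L1_min1; exact: measurable_funM|exact/L1Z/L1_min1|].
move=> w; rewrite normrM; have c0 := normr_ge0 c; have x0 := normr_ge0 (X w).
have [x1|x1] := leP 1 `|X w|; rewrite ?mulr1 ge_min; apply/orP; [left|right]; nra.
Qed.

Lemma d0_sum n (X : 'I_n -> T -> R) : (forall i, measurable_fun setT (X i)) ->
  d0 P (fun w => \sum_(i < n) X i w) <= \sum_(i < n) d0 P (X i).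
Proof.
elim: n X => [|n IH] X mX.
  rewrite big_ord0 /d0 (_ : (fun w => _) = cst 0) ?EE_cst//.
  by apply/funext => w; rewrite big_ord0 normr0 min_r.
rewrite big_ord_recl (_ : (fun w => _) =
  (fun w => X ord0 w + \sum_(i < n) X (lift ord0 i) w)); last first.
  by apply/funext => w; rewrite big_ord_recl.
apply: le_trans (d0D _ _ _) _ => //; first exact: measurable_sum.
by rewrite lerD2l; apply: IH.
Qed.

Lemma d0_norm (X : T -> R) : d0 P (fun w => `|X w|) = d0 P X.
Proof. by rewrite /d0; congr EE; apply/funext => w; rewrite normr_id. Qed.

End TruncatedNormSums.

Section Perturbation.
Context (R : realFieldType).

Definition norm1 m n (M : 'M[R]_(m, n)) := \sum_i \sum_j `|M i j|.

Lemma norm1_ge0 m n (M : 'M[R]_(m, n)) : 0 <= norm1 M.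
Proof. by apply: sumr_ge0 => i _; exact: sumr_ge0. Qed.

Lemma norm1_mul m n p (M : 'M[R]_(m, n)) (N : 'M[R]_(n, p)) :
  norm1 (M *m N) <= norm1 M * norm1 N.
Proof.
rewrite /norm1 mulr_suml; apply: ler_sum => i _.
apply: (@le_trans _ _ (\sum_j \sum_k `|M i k| * `|N k j|)).
  apply: ler_sum => j _; rewrite mxE; apply: le_trans (ler_norm_sum _ _ _) _.
  by apply: ler_sum => k _; rewrite normrM.
rewrite exchange_big mulr_suml; apply: ler_sum => k _ /=.
rewrite -mulr_sumr ler_wpM2l// (bigD1 k)//= lerDl.
by apply: sumr_ge0 => l _; exact: sumr_ge0.
Qed.

Lemma norm1D m n (M N : 'M[R]_(m, n)) : norm1 (M + N) <= norm1 M + norm1 N.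
Proof.
rewrite /norm1 -big_split; apply: ler_sum => i _ /=.
by rewrite -big_split; apply: ler_sum => j _ /=; rewrite mxE; exact: ler_normD.
Qed.

Lemma norm1N m n (M : 'M[R]_(m, n)) : norm1 (- M) = norm1 M.
Proof. by apply: eq_bigr => i _; apply: eq_bigr => j _; rewrite mxE normrN. Qed.

Lemma le_norm1 m n (M : 'M[R]_(m, n)) i j : `|M i j| <= norm1 M.
Proof.
rewrite /norm1 (bigD1 i)//= (bigD1 j)//= -addrA lerDl addr_ge0//.
  exact: sumr_ge0.
by apply: sumr_ge0 => l _; exact: sumr_ge0.
Qed.

(* If [theta <= 1/2] the equation [x S = y] can be solved for [x - y G^-1] by
   absorption; otherwise the first term alone is at least 1. *)
Lemma perturbed_solution k (S G : 'M[R]_k) (x y : 'rV_k) (B : R) i : G \in unitmx ->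
  1 <= B -> x *m S = y ->
  Num.min 1 `|(x - y *m invmx G) ord0 i| <=
  (2 + 2 * B) * Num.min 1 (norm1 (invmx G) * norm1 (S - G)) +
  Num.min 1 (B^-1 * norm1 (y *m invmx G)).
Proof.
move=> uG B1 xS; set D := x - _; set v := y *m _.
set theta := _ * norm1 (S - G).
have theta0 : 0 <= theta by rewrite mulr_ge0// norm1_ge0.
have v0 : 0 <= norm1 v by exact: norm1_ge0.
have DE : D = - (x *m (S - G) *m invmx G).
  by rewrite /D -xS mulmxBr mulmxBl -[x *m G *m _]mulmxA mulmxV// mulmx1 opprB.
have Dle : norm1 D <= theta * (norm1 D + norm1 v).
  rewrite {1}DE norm1N; apply: le_trans (norm1_mul _ _) _.
  apply: (@le_trans _ _ (norm1 x * norm1 (S - G) * norm1 (invmx G))).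
    by rewrite ler_wpM2r ?norm1_ge0// norm1_mul.
  rewrite -mulrA mulrC [_ * norm1 (invmx G)]mulrC ler_wpM2l//.
  by rewrite -{1}(subrK v x) norm1D.
have Di := le_norm1 D ord0 i; have D0 := norm1_ge0 D.
have m0 : 0 <= Num.min 1 (B^-1 * norm1 v).
  by rewrite le_min ler01 mulr_ge0// invr_ge0; lra.
have [th|th] := ltP 2^-1 theta.
  apply: (@le_trans _ _ 1); first by rewrite ge_min lexx.
  have : 2^-1 <= Num.min 1 theta by rewrite le_min (ltW th) andbT; lra.
  nra.
rewrite [Num.min 1 theta]min_r; last by lra.
have Dv : norm1 D <= 2 * theta * norm1 v by nra.
have [vB|vB] := leP (norm1 v) B.
  rewrite ge_min; apply/orP; right; nra.
apply: (@le_trans _ _ 1); first by rewrite ge_min lexx.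
rewrite [X in _ <= _ + X]min_l; last by rewrite mulrC ler_pdivlMr ?mul1r ?ltW//; lra.
by rewrite lerDr mulr_ge0//; lra.
Qed.

End Perturbation.

(** * From the score to the estimates *)

Section Slutsky.
Context d (Omega : measurableType d) (R : realType) (P : probability Omega R).
Context (L : nat) (psi : 'rV[R]_L.+1) (Y eps : int -> Omega -> R).
Hypotheses (causal : causal_filter psi) (mY : forall n, measurable_fun setT (Y n)).
Hypothesis stat : strictly_stationary P Y.
Hypothesis ar : forall n w,
  Y n w = dotrv (regressor L (fun m => Y m w) n) psi + eps n w.
Hypothesis eiid : iid P eps.
Hypothesis eL2 : L2 P (eps 0).
Hypothesis e0 : EE P (eps 0) = 0.
Let s2 := EE P (fun w => eps 0 w ^+ 2).
Hypothesis s2_gt0 : 0 < s2.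
Let rv := reg_var P psi eps.
Let G := gram P psi eps.
Let pG : pos_def G := gram_pos_def causal s2_gt0.
Let uG : G \in unitmx := pos_def_unitmx pG.

Definition limit_score K t w : 'rV[R]_L.+1 := score L Y eps K t w *m invmx G.

Lemma dotrv_score u K t w : dotrv u (score L Y eps K t w) = block_sum eps (lin_reg Y u) K t w.
Proof.
rewrite /dotrv /block_sum mulr_sumr; under eq_bigr do rewrite mxE /block_sum mulrCA !mulr_sumr.
rewrite exchange_big; apply: eq_bigr => k _ /=.
rewrite {2}/lin_reg /dotrv mulr_suml mulr_sumr; apply: eq_bigr => i _.
rewrite /lin_reg [dotrv _ (delta_mx _ _)]dotrvC dotrv_delta; ring.
Qed.

Lemma dotrv_limit_score u K t w :
  dotrv u (limit_score K t w) = block_sum eps (lin_reg Y (u *m invmx G)) K t w.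
Proof.
rewrite -dotrv_score !dotrv_mx /limit_score trmx_mul trmx_inv.
by have [-> _] := pG; rewrite mulmxA.
Qed.

Let limit_score_coord K t w i :
  limit_score K t w ord0 i = block_sum eps (lin_reg Y (delta_mx ord0 i *m invmx G)) K t w.
Proof. by rewrite -dotrv_limit_score dotrv_delta. Qed.

Lemma limit_score_meas K t : coord_measurable (limit_score K t).
Proof.
move=> i; rewrite (_ : (fun w => _) =
  block_sum eps (lin_reg Y (delta_mx ord0 i *m invmx G)) K t).
  exact: (block_sum_meas mY eiid).
by apply/funext => w; exact: limit_score_coord.
Qed.

Lemma sample_gram_meas K t i j : measurable_fun setT (fun w => sample_gram L Y K t w i j).
Proof.
under eq_fun do rewrite mxE; apply: avg_meas => n.
by apply: measurable_funM; exact: lin_reg_meas.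
Qed.

Lemma limit_score_tight eta : 0 < eta -> exists2 B : R, 1 <= B &
  forall K t, (0 < K)%N -> \sum_i d0 P (fun w => B^-1 * limit_score K t w ord0 i) <= eta.
Proof.
move=> eta0; pose c := \sum_i (1 + s2 * rv (delta_mx ord0 i *m invmx G)).
have c0 : 0 <= c.
  apply: sumr_ge0 => i _; rewrite addr_ge0// mulr_ge0 ?(ltW s2_gt0)//.
  exact: reg_var_ge0.
(* [block_sum_tight] bounds the sum by c / B, and c / (1 + c / eta) <= eta. *)
exists (1 + c / eta) => [|K t K0]; first by rewrite lerDl divr_ge0// ltW.
have B0 : 0 < 1 + c / eta by rewrite ltr_wpDr// divr_ge0// ltW.
apply: (@le_trans _ _ ((1 + c / eta)^-1 * c)).
  rewrite mulr_sumr; apply: ler_sum => i _.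
  under eq_fun do rewrite limit_score_coord.
  exact: (block_sum_tight causal mY stat ar eiid eL2 e0).
by rewrite mulrC ler_pdivrMr// mulrDr mulr1 mulrCA divff ?gt_eqF// mulr1 lerDr ltW.
Qed.

Lemma estimate_close eta : 0 < eta -> exists K0 : nat, forall K, (K0 < K)%N ->
  forall t (X : Omega -> 'rV[R]_L.+1), coord_measurable X ->
  (forall w, X w *m sample_gram L Y K t w = score L Y eps K t w) ->
  forall i, d0 P (fun w => X w ord0 i - limit_score K t w ord0 i) <= eta.
Proof.
move=> eta0; have eta2 : 0 < eta / 2 by lra.
have [B B1 hB] := limit_score_tight eta2.
pose lam := norm1 (invmx G); have lam0 : 0 <= lam := norm1_ge0 _.
(* The factors come from [perturbed_solution], from [d0Z] applied to the norm of the inverse, and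
   from the number of matrix entries. *)
pose C := (2 + 2 * B) * ((1 + lam) * (L.+1%:R * L.+1%:R)).
have C0 : 0 < C by rewrite !mulr_gt0//; lra.
have etaC : 0 < eta / 2 / C by rewrite divr_gt0.
have [K0 hK] := sample_gram_cvg causal mY stat ar eiid eL2 e0 s2_gt0 etaC.
exists K0 => K K0K t X mX XS i.
pose E w := norm1 (sample_gram L Y K t w - G).
have mE' i' j' : measurable_fun setT (fun w => sample_gram L Y K t w i' j' - G i' j').
  by apply: measurable_funB => //; exact: sample_gram_meas.
have EE_ w : E w = \sum_i' \sum_j' `|sample_gram L Y K t w i' j' - G i' j'|.
  by apply: eq_bigr => i' _; apply: eq_bigr => j' _; rewrite !mxE.
have mEn i' j' : measurable_fun setT (fun w => `|sample_gram L Y K t w i' j' - G i' j'|).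
  exact: measurableT_comp.
have mE : measurable_fun setT E.
  rewrite (_ : E = fun w => \sum_i' \sum_j' `|sample_gram L Y K t w i' j' - G i' j'|).
    by apply: measurable_sum => i'; exact: measurable_sum.
  by apply/funext.
have mV i' : measurable_fun setT (fun w => B^-1 * limit_score K t w ord0 i').
  by apply: measurable_funM => //; exact: limit_score_meas.
pose v w := B^-1 * norm1 (limit_score K t w).
have vE : v = fun w => \sum_i' `|B^-1 * limit_score K t w ord0 i'|.
  apply/funext => w; rewrite /v /norm1 big_ord1 mulr_sumr; apply: eq_bigr => i' _.
  by rewrite normrM ger0_norm// invr_ge0; lra.
have mVn i' : measurable_fun setT (fun w => `|B^-1 * limit_score K t w ord0 i'|).
  exact: measurableT_comp.
have mv : measurable_fun setT v by rewrite vE; exact: measurable_sum.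
have mlE : measurable_fun setT (fun w => lam * E w) by exact: measurable_funM.
apply: (@le_trans _ _ ((2 + 2 * B) * d0 P (fun w => lam * E w) + d0 P v)).
  rewrite /d0 -EEZ -?EED; [|exact/L1Z/L1_min1|exact: L1_min1|exact: L1_min1].
  apply: EE_le.
  - by apply: L1_min1; apply: measurable_funB => //; exact: limit_score_meas.
  - by apply: L1D; [exact/L1Z/L1_min1|exact: L1_min1].
  - move=> w; have := perturbed_solution i uG B1 (XS w).
    have -> : (X w - score L Y eps K t w *m invmx G) ord0 i =
        X w ord0 i - limit_score K t w ord0 i by rewrite !mxE.
    move=> h; apply: le_trans h _; rewrite -/lam -/(E w) -/(v w).
    by rewrite [`|lam * E w|]ger0_norm ?[`|v w|]ger0_norm// mulr_ge0 ?norm1_ge0 ?invr_ge0//; lra.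
rewrite (_ : eta = eta / 2 + eta / 2); last by field.
apply: lerD; last first.
  rewrite vE; apply: le_trans (d0_sum _ _) _ => //.
  under eq_bigr do rewrite d0_norm.
  by apply: hB; exact: leq_ltn_trans K0K.
have -> : eta / 2 = C * (eta / 2 / C) by rewrite [RHS]mulrC divfK ?gt_eqF.
rewrite {1}/C -[leRHS]mulrA; apply: ler_wpM2l; first by lra.
set q := eta / 2 / C in hK *.
apply: le_trans (d0Z _ _ _) _ => //; rewrite ger0_norm// -[leRHS]mulrA.
apply: ler_wpM2l; first by lra.
rewrite (_ : E = fun w => \sum_i' \sum_j' `|sample_gram L Y K t w i' j' - G i' j'|); last exact/funext.
apply: le_trans (d0_sum _ _) _; first by move=> i'; exact: measurable_sum.
rewrite [leRHS](_ : _ = \sum_(i' < L.+1) \sum_(j' < L.+1) q); last first.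
  by rewrite !sumr_const !card_ord -[RHS]mulr_natl -[q *+ _]mulr_natl mulrA.
apply: ler_sum => i' _; apply: le_trans (d0_sum _ _) _; first by move=> j'; exact: mEn.
by apply: ler_sum => j' _; rewrite d0_norm; exact: hK.
Qed.

(* The estimates are normalized by the length K + L of the stretch, while the
   normal equations involve only K regressors. *)
Lemma scaled_estimate_close eta : 0 < eta -> exists K0 : nat, forall K, (K0 < K)%N ->
  forall t (X : Omega -> 'rV[R]_L.+1), coord_measurable X ->
  (forall w, X w *m sample_gram L Y K t w = score L Y eps K t w) ->
  forall i, d0 P (fun w => Num.sqrt (K + L)%:R / Num.sqrt K%:R * X w ord0 i -
    limit_score K t w ord0 i) <= eta.
Proof.
(* The ratio [rho] of the square roots is at most 2, so [d0Z] multiplies the distance by at most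
   3. *)
move=> eta0; have eta2 : 0 < eta / 2 by lra. have eta6 : 0 < eta / 6 by lra.
have [B B1 hB] := limit_score_tight eta2.
have [K0 hK] := estimate_close eta6.
(* K >= L B gives rho - 1 <= rho^2 - 1 = L / K <= 1 / B, so that tightness absorbs the term with rho
   - 1. *)
exists (maxn K0 (L * Num.bound B)) => K; rewrite gtn_max => /andP[K0K BK] t X mX XS i.
have Kpos : (0 < K)%N by exact: leq_ltn_trans K0K.
have KR : 0 < K%:R :> R by rewrite ltr0n.
set rho := _ / _.
have rho2 : rho ^+ 2 = 1 + L%:R / K%:R.
  by rewrite exprMn exprVn !sqr_sqrtr// natrD mulrDl divff// gt_eqF.
have rho1 : 1 <= rho.
  rewrite -(@ler_pXn2r _ 2)// ?nnegrE ?ler01 ?divr_ge0//.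
  by rewrite expr1n rho2 lerDl divr_ge0.
have LB : L%:R / K%:R <= B^-1.
  rewrite ler_pdivrMr// [leRHS]mulrC ler_pdivlMr; last by lra.
  apply: (@le_trans _ _ (L%:R * (Num.bound B)%:R)).
    by rewrite ler_wpM2l// ltW// archi_boundP//; lra.
  by rewrite -natrM ler_nat ltnW.
have rhoB : rho - 1 <= B^-1.
  apply: le_trans LB; rewrite (_ : L%:R / K%:R = rho ^+ 2 - 1); last by rewrite rho2; ring.
  by rewrite lerD2r expr2 ler_peMr//; apply: le_trans rho1.
have Binv : B^-1 <= 1 by rewrite invf_le1//; lra.
have mV : measurable_fun setT (fun w => limit_score K t w ord0 i) by exact: limit_score_meas.
have mD : measurable_fun setT (fun w => X w ord0 i - limit_score K t w ord0 i).
  exact: measurable_funB.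
rewrite (_ : (fun w => _) = (fun w => rho * (X w ord0 i - limit_score K t w ord0 i) +
    (rho - 1) * limit_score K t w ord0 i)); last by apply/funext => w; ring.
apply: le_trans (d0D _ _ _) _; [exact: measurable_funM..|].
rewrite (_ : eta = eta / 2 + eta / 2); last by field.
apply: lerD.
  apply: le_trans (d0Z _ _ mD) _; have := hK K K0K t X mX XS i.
  have := d0_ge0 P (fun w => X w ord0 i - limit_score K t w ord0 i).
  rewrite ger0_norm; last by lra.
  nra.
apply: le_trans (hB K t Kpos).
apply: (@le_trans _ _ (d0 P (fun w => B^-1 * limit_score K t w ord0 i))).
  apply: d0_le; [exact: measurable_funM..|move=> w].
  rewrite !normrM ler_wpM2r// !ger0_norm ?invr_ge0//; lra.
rewrite (bigD1 i)//= lerDl; apply: sumr_ge0 => j _; exact: d0_ge0.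
Qed.

Lemma limit_score_clt u v c eta : 0 < eta -> exists K0 : nat, forall K1 K2 g : nat,
  (K0 < K1)%N -> (K0 < K2)%N -> forall t : int,
  `|EE P (fun w => cos (dotrv u (limit_score K1 t w) +
       dotrv v (limit_score K2 (t + K1%:Z + g%:Z) w) + c)) -
    expR (- ((s2 * (u *m invmx G *m u^T) ord0 ord0 +
      s2 * (v *m invmx G *m v^T) ord0 ord0) / 2)) * cos c| <= eta.
Proof.
move=> eta0.
have [K0 hK] := clt_reg causal mY stat ar eiid eL2 e0 (u *m invmx G) (v *m invmx G) c eta0.
exists K0 => K1 K2 g K01 K02 t; have := hK K1 K2 g K01 K02 t.
have rvE z : reg_var P psi eps (z *m invmx G) = (z *m invmx G *m z^T) ord0 ord0.
  rewrite -(gramE P eps causal) -/G mulmxKV// trmx_mul trmx_inv.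
  by have [-> _] := pG; rewrite mulmxA.
rewrite !rvE -/s2; under [X in `|EE P X - _|]eq_fun do rewrite -!dotrv_limit_score.
by rewrite -mulrDr [s2 * _ / 2]mulrAC.
Qed.

Lemma EE_cos_estimates u v c (X1 X2 V1 V2 : Omega -> 'rV[R]_L.+1) eta :
  coord_measurable X1 -> coord_measurable X2 -> coord_measurable V1 -> coord_measurable V2 ->
  (forall i, d0 P (fun w => X1 w ord0 i - V1 w ord0 i) <= eta) ->
  (forall i, d0 P (fun w => X2 w ord0 i - V2 w ord0 i) <= eta) ->
  `|EE P (fun w => cos (dotrv u (X1 w) + dotrv v (X2 w) + c)) -
    EE P (fun w => cos (dotrv u (V1 w) + dotrv v (V2 w) + c))| <=
  2 * (\sum_i (1 + `|u ord0 i|) + \sum_i (1 + `|v ord0 i|)) * eta.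
Proof.
move=> m1 m2 n1 n2 h1 h2.
have md (z : 'rV[R]_L.+1) (X : Omega -> 'rV[R]_L.+1) : coord_measurable X -> measurable_fun setT (fun w => dotrv z (X w)).
  by move=> mX; exact: dotrv_measurable.
have ms (X X' : Omega -> 'rV[R]_L.+1) : coord_measurable X -> coord_measurable X' ->
    measurable_fun setT (fun w => dotrv u (X w) + dotrv v (X' w) + c).
  move=> mX mX'; apply: measurable_funD => //; apply: measurable_funD; exact: md.
apply: (@le_trans _ _ (2 * d0 P (fun w => (dotrv u (X1 w) + dotrv v (X2 w) + c) -
    (dotrv u (V1 w) + dotrv v (V2 w) + c)))).
  exact: (EE_cos_lip P (ms _ _ m1 m2) (ms _ _ n1 n2)).
rewrite -mulrA ler_wpM2l// mulrDl.
have bound (z : 'rV[R]_L.+1) (X V : Omega -> 'rV[R]_L.+1) : coord_measurable X -> coord_measurable V ->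
    (forall i, d0 P (fun w => X w ord0 i - V w ord0 i) <= eta) ->
    d0 P (fun w => dotrv z (X w) - dotrv z (V w)) <= (\sum_i (1 + `|z ord0 i|)) * eta.
  move=> mX mV h.
  have mXV i : measurable_fun setT (fun w => X w ord0 i - V w ord0 i).
    exact: measurable_funB.
  rewrite (_ : (fun w => _) = (fun w => \sum_i z ord0 i * (X w ord0 i - V w ord0 i))).
    apply: le_trans (d0_sum _ _) _; first by move=> i; exact: measurable_funM.
    rewrite mulr_suml; apply: ler_sum => i _; apply: le_trans (d0Z _ _ _) _ => //.
    by rewrite ler_wpM2l// addr_ge0.
  by apply/funext => w; rewrite /dotrv -sumrB; apply: eq_bigr => i _; rewrite mulrBr.
rewrite (_ : (fun w => _) = (fun w => (dotrv u (X1 w) - dotrv u (V1 w)) +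
    (dotrv v (X2 w) - dotrv v (V2 w)))); last by apply/funext => w; ring.
apply: le_trans (d0D _ _ _) _; [by apply: measurable_funB; exact: md..|].
by apply: lerD; exact: bound.
Qed.

End Slutsky.

(** * Joint limit of the estimates from the two stretches *)

Section SplitEstimates.
Context d (Omega : measurableType d) (R : realType) (P : probability Omega R).
Context (L : nat) (psi : 'rV[R]_L.+1) (Y eps : int -> Omega -> R).
Hypotheses (causal : causal_filter psi) (mY : forall n, measurable_fun setT (Y n)).
Hypothesis stat : strictly_stationary P Y.
Hypothesis ar : forall n w,
  Y n w = dotrv (regressor L (fun m => Y m w) n) psi + eps n w.
Hypothesis eiid : iid P eps.
Hypothesis eL2 : L2 P (eps 0).
Hypothesis e0 : EE P (eps 0) = 0.
Let s2 := EE P (fun w => eps 0 w ^+ 2).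
Hypothesis s2_gt0 : 0 < s2.
Let G := gram P psi eps.
Let V := limit_score P psi Y eps.

Let mV K t : coord_measurable (V K t).
Proof. exact: limit_score_meas. Qed.

Lemma ls_estimate_close eta : 0 < eta -> exists K0 : nat,
  forall a b (phi : Omega -> 'rV[R]_L.+1) (M := (b.+1 - a)%N), (K0 + L < M)%N ->
  coord_measurable phi ->
  (forall w, is_ls_estimate L (fun m => Y m w) a b (phi w)) ->
  forall i, d0 P (fun w => (Num.sqrt M%:R *: (phi w - psi)) ord0 i -
    V (M - L) (a + L)%:Z w ord0 i) <= eta.
Proof.
move=> eta0.
have [K0 hK] := scaled_estimate_close causal mY stat ar eiid eL2 e0 s2_gt0 eta0.
exists K0 => a b phi M K0M mphi ls i.
have KE : (M - L)%N = (b.+1 - (a + L))%N by rewrite subnDA.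
have K0K : (K0 < M - L)%N by rewrite ltn_subRL addnC.
have LM : (L <= M)%N by apply: ltnW; apply: leq_ltn_trans K0M; exact: leq_addl.
pose X w := Num.sqrt (M - L)%:R *: (phi w - psi).
have mX : coord_measurable X.
  move=> j; rewrite (_ : (fun w => _) =
    (fun w => Num.sqrt (M - L)%:R * (phi w ord0 j - psi ord0 j))).
    by apply: measurable_funM => //; apply: measurable_funB => //; exact: mphi.
  by apply/funext => w; rewrite !mxE.
have XS w : X w *m sample_gram L Y (M - L) (a + L)%:Z w = score L Y eps (M - L) (a + L)%:Z w.
  by rewrite /X KE; apply: ls_score => //; rewrite -KE; exact: leq_ltn_trans K0K.
have := hK _ K0K _ X mX XS i; congr (_ <= _); congr d0; apply/funext => w.
congr (_ - _); rewrite subnK// !mxE mulrA; congr (_ * _).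
by rewrite divfK// gt_eqF// sqrtr_gt0 ltr0n; exact: leq_ltn_trans K0K.
Qed.

Variables (N1 : nat -> nat) (psihat1 psihat2 : nat -> Omega -> 'rV[R]_L.+1).
Hypothesis N1oo : forall M : nat, \forall N \near \oo, (M <= N1 N)%N.
Hypothesis N2oo : forall M : nat, \forall N \near \oo, (M <= N - N1 N)%N.
Hypothesis ls1 : forall N w, is_ls_estimate L (fun m => Y m w) 1 (N1 N) (psihat1 N w).
Hypothesis ls2 : forall N w, is_ls_estimate L (fun m => Y m w) (N1 N).+1 N (psihat2 N w).
Hypothesis m1 : forall N, coord_measurable (psihat1 N).
Hypothesis m2 : forall N, coord_measurable (psihat2 N).

Let X1 N w := Num.sqrt (N1 N)%:R *: (psihat1 N w - psi).
Let X2 N w := Num.sqrt (N - N1 N)%:R *: (psihat2 N w - psi).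
Let V1 N := V (N1 N - L) (1 + L)%:Z.
Let V2 N := V (N - N1 N - L) ((N1 N).+1 + L)%:Z.

Let scaled_meas (a : R) (phi : Omega -> 'rV[R]_L.+1) : coord_measurable phi ->
  coord_measurable (fun w => a *: (phi w - psi)).
Proof.
move=> mphi j; rewrite (_ : (fun w => _) = (fun w => a * (phi w ord0 j - psi ord0 j))).
  by apply: measurable_funM => //; apply: measurable_funB => //; exact: mphi.
by apply/funext => w; rewrite !mxE.
Qed.

Let mX1 N : coord_measurable (X1 N). Proof. exact: scaled_meas. Qed.
Let mX2 N : coord_measurable (X2 N). Proof. exact: scaled_meas. Qed.

Let close eta : 0 < eta -> \forall N \near \oo,
  (forall i, d0 P (fun w => X1 N w ord0 i - V1 N w ord0 i) <= eta) /\
  (forall i, d0 P (fun w => X2 N w ord0 i - V2 N w ord0 i) <= eta).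
Proof.
move=> eta0; have [K0 hK] := ls_estimate_close eta0.
have := N1oo (K0 + L).+1; have := N2oo (K0 + L).+1; apply: filterS2 => N h2 h1.
have e1 : ((N1 N).+1 - 1)%N = N1 N by rewrite subn1.
have e2 : (N.+1 - (N1 N).+1)%N = (N - N1 N)%N by rewrite subSS.
split=> i.
- by have := hK 1%N (N1 N) (psihat1 N); rewrite e1; apply => //; exact: ls1.
- by have := hK (N1 N).+1 N (psihat2 N); rewrite e2; apply => //; exact: ls2.
Qed.

Lemma split_cos_cvg u v c :
  EE P (fun w => cos (dotrv u (X1 N w) + dotrv v (X2 N w) + c)) @[N --> \oo] -->
  expR (- ((s2 * (u *m invmx G *m u^T) ord0 ord0 +
    s2 * (v *m invmx G *m v^T) ord0 ord0) / 2)) * cos c.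
Proof.
apply/cvgrPdist_le => eta eta0; have eta2 : 0 < eta / 2 by lra.
pose C := 2 * (\sum_i (1 + `|u ord0 i|) + \sum_i (1 + `|v ord0 i|)).
have C0 : 0 <= C.
  by rewrite mulr_ge0// addr_ge0//; apply: sumr_ge0 => i _; rewrite addr_ge0.
have del0 : 0 < eta / 2 / (C + 1) by rewrite divr_gt0// ltr_wpDl.
have [K0 hK] := limit_score_clt causal mY stat ar eiid eL2 e0 s2_gt0 u v c eta2.
have := close del0; have := N1oo (K0 + L).+1; have := N2oo (K0 + L).+1.
apply: filterS3 => N h2 h1 [c1 c2].
have K1 : (K0 < N1 N - L)%N by rewrite ltn_subRL addnC.
have K2 : (K0 < N - N1 N - L)%N by rewrite ltn_subRL addnC.
have LN : (L <= N1 N)%N by apply: ltnW; apply: leq_ltn_trans h1; exact: leq_addl.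
(* The terms of the first stretch end at N1 and those of the second begin at N1 + 1 + L: the gap
   consists of the L times at which the second stretch supplies regressors only. *)
have := hK _ _ L K1 K2 (1 + L)%:Z.
have -> : (1 + L)%:Z + (N1 N - L)%:Z + L%:Z = ((N1 N).+1 + L)%:Z.
  by rewrite -!PoszD; congr Posz; rewrite -addnA subnK// addnAC add1n.
rewrite -/V -/(V1 N) -/(V2 N) -/s2 -/G distrC => h.
have := EE_cos_estimates u v c (mX1 N) (mX2 N) (mV _ _) (mV _ _) c1 c2.
rewrite -/C => h'.
have hC : C * (eta / 2 / (C + 1)) <= eta / 2.
  rewrite mulrCA; apply: ler_piMr; first exact: ltW.
  by rewrite ler_pdivrMr ?mul1r ?lerDl// ltr_wpDl.
apply: le_trans (ler_distD (EE P (fun w => cos (dotrv u (V1 N w) + dotrv v (V2 N w) + c))) _ _) _.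
rewrite (_ : eta = eta / 2 + eta / 2); last by field.
by apply: lerD; [exact: h|rewrite distrC; exact: le_trans h' hC].
Qed.

Let tail_le (X W : Omega -> 'rV[R]_L.+1) (B del : R) : 1 <= B ->
  coord_measurable X -> coord_measurable W ->
  (forall i, d0 P (fun w => X w ord0 i - W w ord0 i) <= del) ->
  coord_tail P X B <= L.+1%:R * del + coord_tail P W B.
Proof.
move=> B1 mX mW h; rewrite -[X in X%:R]card_ord mulr_natl -sumr_const -big_split.
have B0 : 0 < B by exact: lt_le_trans B1.
apply: ler_sum => i _ /=; apply: le_trans (lerD (h i) (lexx _)).
rewrite (_ : (fun w => B^-1 * X w ord0 i) = (fun w => B^-1 * (X w ord0 i - W w ord0 i) +
  B^-1 * W w ord0 i)); last by apply/funext => w; rewrite -mulrDr subrK.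
have mXW : measurable_fun setT (fun w => X w ord0 i - W w ord0 i) by exact: measurable_funB.
have mW' : measurable_fun setT (fun w => B^-1 * W w ord0 i) by exact: measurable_funM.
apply: le_trans (d0D _ _ mW') _; first exact: measurable_funM.
rewrite lerD2r; apply: d0_le => //; first exact: measurable_funM.
move=> w; rewrite normrM; apply: ler_piMl => //.
by rewrite ger0_norm ?invr_ge0 ?(ltW B0)// invf_le1.
Qed.

Lemma split_tight eta : 0 < eta -> exists2 B : R, 0 < B &
  \forall N \near \oo, coord_tail P (fun w => row_mx (X1 N w) (X2 N w)) B <= eta.
Proof.
move=> eta0; have eta4 : 0 < eta / 4 by lra.
have [B B1 hB] := limit_score_tight causal mY stat ar eiid eL2 e0 s2_gt0 eta4.
have del0 : 0 < eta / 4 / L.+1%:R by rewrite divr_gt0.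
exists B; first exact: lt_le_trans B1.
have := close del0; have := N1oo L.+1; have := N2oo L.+1.
apply: filterS3 => N h2 h1 [c1 c2].
have t1 := tail_le B1 (mX1 N) (mV _ _) c1; have t2 := tail_le B1 (mX2 N) (mV _ _) c2.
have t3 := hB (N1 N - L)%N (1 + L)%:Z; have t4 := hB (N - N1 N - L)%N ((N1 N).+1 + L)%:Z.
rewrite subn_gt0 in t3; rewrite subn_gt0 in t4.
have -> : coord_tail P (fun w => row_mx (X1 N w) (X2 N w)) B =
    coord_tail P (X1 N) B + coord_tail P (X2 N) B.
  rewrite /coord_tail big_split_ord; congr (_ + _); apply: eq_bigr => i _;
    by congr d0; apply/funext => w; rewrite ?row_mxEl ?row_mxEr.
have e4 : L.+1%:R * (eta / 4 / L.+1%:R) = eta / 4 by rewrite mulrC divfK.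
move: (t3 h1) (t4 h2) t1 t2; rewrite e4 /coord_tail -/V -/(V1 N) -/(V2 N); lra.
Qed.

Lemma dotrv_row_mx m n (w : 'rV[R]_(m + n)) (a : 'rV_m) (b : 'rV_n) :
  dotrv w (row_mx a b) = dotrv (lsubmx w) a + dotrv (rsubmx w) b.
Proof.
rewrite /dotrv big_split_ord; congr (_ + _); apply: eq_bigr => i _;
  by rewrite ?row_mxEl ?row_mxEr mxE.
Qed.

Lemma row_mx_measurable dT (T : measurableType dT) m n (A : T -> 'rV[R]_m) (B : T -> 'rV[R]_n) :
  coord_measurable A -> coord_measurable B -> coord_measurable (fun w => row_mx (A w) (B w)).
Proof.
move=> mA mB i; under eq_fun do rewrite mxE.
by case: (fintype.split i) => j; [exact: mA|exact: mB].
Qed.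

Lemma split_estimates_cvg : cvg_dist_indep_gaussian P X1 X2.
Proof.
(* A factor of the limit covariance s2 Gamma^-1, common to both limits. *)
have [B BE] : exists B : 'M[R]_L.+1, s2 *: invmx G = B *m B^T.
  by apply: pos_def_factor; apply: pos_defZ => //; exact/pos_def_inv/gram_pos_def.
have [d' [T [Q [G1 [G2 [g1 g2 ind GE]]]]]] := gauss_pair B.
exists d', T, Q, G1, G2; split; [exact: g1|split; [exact: g2|split; [exact: ind|]]].
move=> f cf [M fM].
(* The pair is read as one row vector of length 2 (L + 1), for which [weak_cvg] is stated. *)
pose F (x : 'rV[R]_(L.+1 + L.+1)) := f (lsubmx x, rsubmx x).
have cF : continuous F.
  move=> x; apply: (@continuous_comp _ _ _ (fun x => (lsubmx x, rsubmx x)) f); last exact: cf.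
  exact: (cvg_pair (@continuous_lsubmx _ _ _ _ x) (@continuous_rsubmx _ _ _ _ x)).
have mX N : coord_measurable (fun w => row_mx (X1 N w) (X2 N w)) by exact: row_mx_measurable.
have mG : coord_measurable (fun w => row_mx (G1 w) (G2 w)).
  by apply: row_mx_measurable; [have [] := g1|have [] := g2].
have qE u : dotrv (u *m B) (u *m B) = s2 * (u *m invmx G *m u^T) ord0 ord0.
  have -> : s2 * (u *m invmx G *m u^T) ord0 ord0 =
    (u *m (s2 *: invmx G) *m u^T) ord0 ord0 by rewrite -scalemxAr -scalemxAl [RHS]mxE.
  by rewrite dotrv_mx BE trmx_mul !mulmxA.
have hcos (w : 'rV[R]_(L.+1 + L.+1)) (c : R) :
    EE P (fun t => cos (dotrv w (row_mx (X1 N t) (X2 N t)) + c)) @[N --> \oo] -->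
    EE Q (fun t => cos (dotrv w (row_mx (G1 t) (G2 t)) + c)).
  rewrite (_ : EE Q _ = EE Q (fun t => cos (dotrv (lsubmx w) (G1 t) +
    dotrv (rsubmx w) (G2 t) + c))); last by congr EE; apply/funext => t; rewrite dotrv_row_mx.
  rewrite GE !qE.
  rewrite (_ : (fun N => _) = (fun N => EE P (fun t => cos (dotrv (lsubmx w) (X1 N t) +
    dotrv (rsubmx w) (X2 N t) + c)))); first exact: split_cos_cvg.
  by apply/funext => N; congr EE; apply/funext => t; rewrite dotrv_row_mx.
have FM x : `|F x| <= M by exact: fM.
have h := weak_cvg mX mG hcos split_tight cF FM.
have FE (A B' : 'rV[R]_L.+1) : F (row_mx A B') = f (A, B').
  by rewrite /F row_mxKl row_mxKr.
have iF dS (S : measurableType dS) (P' : probability S R) (Z : S -> 'rV[R]_(L.+1 + L.+1)) :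
    coord_measurable Z -> L1 P' (fun w => F (Z w)).
  move=> mZ; apply: (L1_bounded P' (B := M)); last by move=> w; exact: FM.
  exact: (continuous_measurable mZ cF FM).
rewrite (_ : (\int[Q]_w _)%E = (EE Q (fun t => F (row_mx (G1 t) (G2 t))))%:E); last first.
  by rewrite -EE_fin ?iF//; apply: eq_integral => w _; rewrite FE.
rewrite (_ : (fun N => _) = (fun N => (EE P (fun t => F (row_mx (X1 N t) (X2 N t))))%:E)).
  by apply: cvg_EFin; [exact: nearW|exact: h].
by apply/funext => N; rewrite -EE_fin ?iF//; apply: eq_integral => w _; rewrite FE.
Qed.

End SplitEstimates.

Theorem theorem1 (R : realType) (d : measure_display) (Omega : measurableType d)
  (P : probability Omega R) (L : nat) (psi : 'rV[R]_L.+1)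
  (Y eps : int -> Omega -> R) (sigma : R) (N1 : nat -> nat)
  (psihat1 psihat2 : nat -> Omega -> 'rV[R]_L.+1) :
  (* causal stationary AR(L) process with filter psi *)
  causal_filter psi ->
  (forall n, measurable_fun setT (Y n)) ->
  strictly_stationary P Y ->
  (forall n w, Y n w = dotrv (regressor L (fun m => Y m w) n) psi + eps n w) ->
  (* i.i.d. noise, mean 0, finite variance sigma^2 > 0 *)
  iid P eps ->
  (forall n, P.-integrable setT (fun w => (eps n w)%:E)) ->
  (forall n, (\int[P]_w (eps n w)%:E = 0)%E) ->
  (forall n, (\int[P]_w ((eps n w) ^+ 2)%:E = (sigma ^+ 2)%:E)%E) ->
  0 < sigma ->
  (* (A.1) *)
  (\int[P]_w (Num.max (ln `|eps 0 w|) 0)%:E < +oo)%E ->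
  has_nontrivial_ac_component P (eps 0) ->
  (* sample split N = N1 + N2, N1, N2 -> oo *)
  (forall N, (N1 N <= N)%N) ->
  (forall M : nat, \forall N \near \oo, (M <= N1 N)%N) ->
  (forall M : nat, \forall N \near \oo, (M <= N - N1 N)%N) ->
  (* least squares estimates from Y_1..Y_N1 and from Y_(N1+1)..Y_N *)
  (forall N w, is_ls_estimate L (fun m => Y m w) 1 (N1 N) (psihat1 N w)) ->
  (forall N w, is_ls_estimate L (fun m => Y m w) (N1 N).+1 N (psihat2 N w)) ->
  (forall N i, measurable_fun setT (fun w => psihat1 N w ord0 i)) ->
  (forall N i, measurable_fun setT (fun w => psihat2 N w ord0 i)) ->
  cvg_dist_indep_gaussian P
    (fun N w => Num.sqrt (N1 N)%:R *: (psihat1 N w - psi))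
    (fun N w => Num.sqrt (N - N1 N)%:R *: (psihat2 N w - psi)).
Proof.
move=> causal mY stat ar eiid ieps eps0 eps2 sigma0 _ _ N1N N1oo N2oo ls1 ls2 m1 m2.
have [meps _] := eiid.
have me2 : measurable_fun setT (fun w => eps 0 w ^+ 2) by exact: measurable_funX.
have ieps2 : L1 P (fun w => eps 0 w ^+ 2).
  apply/integrableP; split; first exact/measurable_EFinP.
  under eq_integral do rewrite gee0_abs ?lee_fin ?sqr_ge0//.
  by rewrite eps2 ltry.
have eL2 : L2 P (eps 0) by split.
have e0 : EE P (eps 0) = 0 by rewrite /EE /Rintegral eps0.
have s2 : 0 < EE P (fun w => eps 0 w ^+ 2) by rewrite /EE /Rintegral eps2 exprn_gt0.
exact: (split_estimates_cvg causal mY stat ar eiid eL2 e0 s2 N1oo N2oo ls1 ls2 m1 m2).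
Qed.
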